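(* Let $E_T\subsetneq\mathbb T$ be a finite union of disjoint non-degenerate closed arcs, let $x\in\mathbb R$ with $e^{ix}\in\mathbb T\setminus E_T$, and let $n\ge1$. Then there exist an $n$-regular comb $\tilde\Pi$ and a conformal map $\tilde\tau$ of $\mathbb C_+$ onto $\tilde\Pi$ such that the polynomial $P_{n,e^{ix}}$ defined by $$P_{n,e^{ix}}(e^{iz})=e^{iz\frac n2}\cos\Big(\frac n2\tilde\tau(z)\Big)$$ is an extremal polynomial of the problem defining $A_n(e^{ix};E_T)$, so that $A_n(e^{ix};E_T)=|P'_{n,e^{ix}}(e^{ix})|$. Moreover, the set $\tilde E=\{e^{it}: t\in\mathbb R,\ \tilde\tau(t)\in\mathbb R\}$ (corresponding to the base of the comb) contains $E_T$, and for every $k=0,\dots,n-1$ at least one of the (possibly two different) points $e^{i\tilde\tau^{-1}(\frac{2\pi k}n\pm0)}$ belongs to $E_T$.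
   Context: $\mathcal P_n(E_T)$ is the set of complex polynomials of degree at most $n$ with $|P|\le1$ on $E_T$, and for $\zeta\notin E_T$, $A_n(\zeta;E_T)=\sup\{|P'(\zeta)|:P\in\mathcal P_n(E_T),\ P(\zeta)=0\}$. An $n$-regular comb is a domain of the form $\tilde\Pi=\mathbb C_+\setminus\bigcup_{j}\bigcup_{m\in\mathbb Z}\{\tilde\omega_j+2\pi m+i\eta:\eta\in(0,h_j]\}$ with finitely many $\tilde\omega_j\in[0,2\pi)$, $h_j>0$, such that $\frac n{2\pi}\tilde\omega_j\in\mathbb Z$ for all $j$. The conformal map $\tilde\tau:\mathbb C_+\to\tilde\Pi$ extends continuously to $\mathbb R$ (boundary correspondence), and $\tilde\tau^{-1}(c\pm0)$ denote the preimages of the two sides of the base point $c$ of a slit (a single point if there is no slit at $c$). *)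

(* Defs.v *)
From Stdlib Require Import Reals List.
From Coquelicot Require Import Coquelicot.
Open Scope R_scope.

Definition cexp (z : C) : C :=
  (exp (Re z) * cos (Im z), exp (Re z) * sin (Im z)).
Definition ccos (w : C) : C :=
  Cmult (Cplus (cexp (Cmult Ci w)) (cexp (Cmult Ci (Copp w)))) (RtoC (/ 2)).
Definition expi (t : R) : C := cexp (Cmult Ci (RtoC t)).

Definition on_circle (w : C) : Prop := Cmod w = 1.

Definition arc (a b : R) : C -> Prop := fun w => exists t, a <= t <= b /\ w = expi t.
Definition nondeg_arc (ab : R * R) : Prop := fst ab < snd ab < fst ab + 2 * PI.

Definition finite_arc_union (E : C -> Prop) : Prop :=
  exists arcs : list (R * R),
    arcs <> nil /\
    (forall ab, In ab arcs -> nondeg_arc ab) /\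
    (forall i j, (i < length arcs)%nat -> (j < length arcs)%nat -> i <> j ->
       forall w, arc (fst (nth i arcs (0,0))) (snd (nth i arcs (0,0))) w ->
                 ~ arc (fst (nth j arcs (0,0))) (snd (nth j arcs (0,0))) w) /\
    (forall w, E w <-> exists ab, In ab arcs /\ arc (fst ab) (snd ab) w) /\
    (exists w, on_circle w /\ ~ E w).

Definition peval (n : nat) (a : nat -> C) (z : C) : C :=
  sum_n (fun k => Cmult (a k) (@pow_n C_Ring z k)) n.
Definition pderiv (n : nat) (a : nat -> C) (z : C) : C :=
  sum_n (fun k => Cmult (Cmult (RtoC (INR (S k))) (a (S k))) (@pow_n C_Ring z k)) (pred n).

Definition admissible (E : C -> Prop) (n : nat) (zeta : C) (a : nat -> C) : Prop :=
  (forall w, E w -> Cmod (peval n a w) <= 1) /\ peval n a zeta = RtoC 0.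

Definition A_n (E : C -> Prop) (n : nat) (zeta : C) : Rbar :=
  Lub_Rbar (fun r => exists a, admissible E n zeta a /\ r = Cmod (pderiv n a zeta)).

Definition extremal (E : C -> Prop) (n : nat) (zeta : C) (a : nat -> C) : Prop :=
  admissible E n zeta a /\
  forall b, admissible E n zeta b -> Cmod (pderiv n b zeta) <= Cmod (pderiv n a zeta).

Definition Cplus_half (z : C) : Prop := 0 < Im z.

Definition comb (slits : list (R * R)) (w : C) : Prop :=
  0 < Im w /\
  ~ (exists oh, In oh slits /\ exists m : Z,
        Re w = fst oh + 2 * PI * IZR m /\ 0 < Im w <= snd oh).

Definition n_regular_comb (n : nat) (slits : list (R * R)) : Prop :=
  forall oh, In oh slits ->
    0 <= fst oh < 2 * PI /\ 0 < snd oh /\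
    exists m : Z, INR n / (2 * PI) * fst oh = IZR m.

Definition conformal_onto (tau : C -> C) (D : C -> Prop) : Prop :=
  (forall z, Cplus_half z -> @ex_derive C_AbsRing C_NormedModule tau z) /\
  (forall z1 z2, Cplus_half z1 -> Cplus_half z2 -> tau z1 = tau z2 -> z1 = z2) /\
  (forall z, Cplus_half z -> D (tau z)) /\
  (forall w, D w -> exists z, Cplus_half z /\ tau z = w).

(* tau extends continuously to the closed upper half-plane (its values on R
   being the boundary correspondence) *)
Definition cont_closed_half (tau : C -> C) : Prop :=
  forall z, 0 <= Im z ->
    filterlim tau (within (fun w : C => 0 <= Im w) (locally z)) (locally (tau z)).

(* Main.v *)
Require Import Defs.
From Stdlib Require Import ZArith Reals List Lra Lia Psatz Classical ClassicalEpsilon Permutation Sorted.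
From Coquelicot Require Import Coquelicot.
Open Scope R_scope.

(** Write [P(e^(iz)) = e^(inz/2) F(z)].  With [t = x + PI + 2 atan u], the real functions [F] of
    this kind vanishing at [x] become [(1 + u^2)^(-n/2) p(u)] with [deg p < n], and [F'(x)] becomes
    the leading coefficient of [p].  The extremal [F] thus comes from a weighted Chebyshev problem on
    a compact set [K]; it is solved by minimising over the zeros of [p], and moving one or two
    zeros shows that each of the [n] intervals cut out by the zeros contains a point of [K] where
    the weighted modulus is maximal.  Hence [F] has [n] real zeros per period, and between any two consecutive
    ones a point of the arcs with [|F| = 1].  This alternation yields extremality: for a better
    competitor [G] the difference [F - Re (lambda G)] would have too many zeros.

    Counting zeros also shows that in the upper half-plane [F] avoids [[-1, 1]] and that
    [F'^2 <> r (F^2 - 1)] for [r >= 0].  The first fact gives an explicit branch [tau] of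
    [(2/n) arccos F], namely [tau = (2i/n) (log F + log (1 + sqrt (1 - 1/F^2)))]; the second says that
    [Re tau'] does not vanish, hence is positive, so [tau] is injective.  Its boundary values run
    along the real axis and up and down the slits, and its image, being open and relatively closed
    in the comb and containing all high points, is the whole comb. *)

(** The point [x] corresponds to [u = infinity], which is why [p] loses one degree: maximising
    [F'(x)] under [|F| <= 1] becomes minimising the weighted sup norm of a monic polynomial of
    degree [n - 1]. Only products of real linear factors compete in that problem, because lists of
    zeros clamped to a bounded interval form a compact set; optimality among all complex polynomials
    is recovered afterwards from the alternation. The [n - 1] zeros together with [x] bound [n]
    gaps, each with a critical point where [|F| >= 1]. This inequality and the alternating signs are
    all that the construction of the comb uses.

    No mapping theorem or boundary correspondence theorem is invoked. Convexity of the half-plane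
    gives injectivity, discreteness of the fibres of cosine gives continuity up to the axis, and the
    mean of [tau'] over a period, which is 1, fixes the sign of [Re tau']. Degrees are counted in
    halves, since for odd [n] the function [F] changes sign under translation by [2 PI]; hence the
    factors [sin ((z - y) / 2)] in every count of zeros. *)

Lemma half_min (a b : R) : 0 < a -> 0 < b ->
  0 < Rmin a b / 2 /\ Rmin a b / 2 < a /\ Rmin a b / 2 < b.
Proof. intros Ha Hb; generalize (Rmin_pos _ _ Ha Hb) (Rmin_l a b) (Rmin_r a b); lra. Qed.

(** * Real and imaginary parts, modulus inequalities *)

Lemma C_ext (a b : C) : Re a = Re b -> Im a = Im b -> a = b.
Proof. destruct a, b; simpl; intros; subst; reflexivity. Qed.

Lemma Re_plus (a b : C) : Re (a + b)%C = Re a + Re b. Proof. reflexivity. Qed.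
Lemma Im_plus (a b : C) : Im (a + b)%C = Im a + Im b. Proof. reflexivity. Qed.
Lemma Re_opp (a : C) : Re (- a)%C = - Re a. Proof. reflexivity. Qed.
Lemma Im_opp (a : C) : Im (- a)%C = - Im a. Proof. reflexivity. Qed.
Lemma Re_minus (a b : C) : Re (a - b)%C = Re a - Re b. Proof. reflexivity. Qed.
Lemma Im_minus (a b : C) : Im (a - b)%C = Im a - Im b. Proof. reflexivity. Qed.
Lemma Re_mult (a b : C) : Re (a * b)%C = Re a * Re b - Im a * Im b.
Proof. reflexivity. Qed.
Lemma Im_mult (a b : C) : Im (a * b)%C = Re a * Im b + Im a * Re b.
Proof. reflexivity. Qed.
Lemma Re_R (r : R) : Re (RtoC r) = r. Proof. reflexivity. Qed.
Lemma Im_R (r : R) : Im (RtoC r) = 0. Proof. reflexivity. Qed.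
Lemma Re_i : Re Ci = 0. Proof. reflexivity. Qed.
Lemma Im_i : Im Ci = 1. Proof. reflexivity. Qed.

#[export] Hint Rewrite Re_plus Im_plus Re_opp Im_opp Re_minus Im_minus Re_mult Im_mult Re_R Im_R
  Re_i Im_i : reim.
Ltac reim := autorewrite with reim.
Ltac ceq := apply C_ext; autorewrite with reim; try ring.

Lemma Ci2 : (Ci * Ci = - RtoC 1)%C. Proof. ceq. Qed.

Lemma Im_le_Cmod (c : C) : Rabs (Im c) <= Cmod c.
Proof. eapply Rle_trans; [apply Rmax_r | apply Rmax_Cmod]. Qed.

Lemma Cmod_le_ReIm (c : C) : Cmod c <= Rabs (Re c) + Rabs (Im c).
Proof.
  apply Rsqr_incr_0_var; [| generalize (Rabs_pos (Re c)) (Rabs_pos (Im c)); lra].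
  rewrite !Rsqr_pow2, Cmod2_alt.
  rewrite <- (pow2_abs (Re c)), <- (pow2_abs (Im c)).
  generalize (Rabs_pos (Re c)) (Rabs_pos (Im c)); nra.
Qed.

Lemma Cmod_minus_sym (a b : C) : Cmod (a - b) = Cmod (b - a).
Proof. rewrite <- Cmod_opp; f_equal; ring. Qed.

Lemma Cmod_triangle_inv (a b : C) : Cmod a - Cmod b <= Cmod (a - b).
Proof.
  generalize (Cmod_triangle (a - b) b).
  replace (a - b + b)%C with a by ring; lra.
Qed.

Lemma Cmod_minus_triangle (a b c : C) : Cmod (a - c) <= Cmod (a - b) + Cmod (b - c).
Proof. replace (a - c)%C with ((a - b) + (b - c))%C by ring; apply Cmod_triangle. Qed.

Lemma RtoC_neq0 (r : R) : r <> 0 -> RtoC r <> RtoC 0.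
Proof. intros H H0; apply H; exact (RtoC_inj _ _ H0). Qed.

Lemma Cmult_eq0 (a b : C) : (a * b)%C = 0 -> a = 0 \/ b = 0.
Proof.
  intros H; destruct (classic (a = 0)) as [?|Ha]; [left; auto|].
  destruct (classic (b = 0)) as [?|Hb]; [right; auto|].
  exfalso; exact (Cmult_neq_0 _ _ Ha Hb H).
Qed.

Lemma Cmod_pos_neq0 (z : C) : z <> 0 -> 0 < Cmod z.
Proof. intros; now apply Cmod_gt_0. Qed.

(** * Complex continuity and differentiability *)

Definition ccont (f : C -> C) (z : C) : Prop :=
  forall eps, 0 < eps -> exists del, 0 < del /\
    forall w, Cmod (w - z) < del -> Cmod (f w - f z) < eps.

(* Caratheodory's form of the complex derivative: products, compositions and
   inverses reduce to continuity of the slope [phi]. *)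
Definition cdiff (f : C -> C) (z l : C) : Prop :=
  exists phi, ccont phi z /\ phi z = l /\
    forall w, f w = (f z + phi w * (w - z))%C.

Lemma ccont_const (c z : C) : ccont (fun _ => c) z.
Proof.
  intros e He; exists 1; split; [lra|]; intros w _.
  replace (c - c)%C with (RtoC 0) by ring; now rewrite Cmod_0.
Qed.

Lemma ccont_id (z : C) : ccont (fun w => w) z.
Proof. intros e He; exists e; auto. Qed.

Lemma ccont_ext_loc (f g : C -> C) (z : C) (d : R) :
  0 < d -> (forall w, Cmod (w - z) < d -> f w = g w) -> ccont f z -> ccont g z.
Proof.
  intros Hd H Hf e He; destruct (Hf e He) as [d' [Hd' H']].
  exists (Rmin d d'); split; [now apply Rmin_pos|]; intros w Hw.
  assert (Hz : Cmod (z - z) < d).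
  { replace (z - z)%C with (RtoC 0) by ring; now rewrite Cmod_0. }
  rewrite <- (H w), <- (H z); auto.
  - apply H'; eapply Rlt_le_trans; [apply Hw | apply Rmin_r].
  - eapply Rlt_le_trans; [apply Hw | apply Rmin_l].
Qed.

Lemma ccont_plus (f g : C -> C) (z : C) :
  ccont f z -> ccont g z -> ccont (fun w => f w + g w)%C z.
Proof.
  intros Hf Hg e He.
  destruct (Hf (e / 2)) as [d1 [Hd1 H1]]; [lra|].
  destruct (Hg (e / 2)) as [d2 [Hd2 H2]]; [lra|].
  exists (Rmin d1 d2); split; [now apply Rmin_pos|]; intros w Hw.
  specialize (H1 w (Rlt_le_trans _ _ _ Hw (Rmin_l _ _))).
  specialize (H2 w (Rlt_le_trans _ _ _ Hw (Rmin_r _ _))).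
  replace (f w + g w - (f z + g z))%C with ((f w - f z) + (g w - g z))%C by ring.
  eapply Rle_lt_trans; [apply Cmod_triangle|]; lra.
Qed.

Lemma ccont_mult (f g : C -> C) (z : C) :
  ccont f z -> ccont g z -> ccont (fun w => f w * g w)%C z.
Proof.
  intros Hf Hg e He.
  set (A := Cmod (f z) + 1); set (B := Cmod (g z) + 1).
  assert (HA : 1 <= A) by (unfold A; generalize (Cmod_ge_0 (f z)); lra).
  assert (HB : 1 <= B) by (unfold B; generalize (Cmod_ge_0 (g z)); lra).
  destruct (Hf (e / (2 * B))) as [d1 [Hd1 H1]]; [apply Rdiv_lt_0_compat; lra|].
  destruct (Hg (Rmin 1 (e / (2 * A)))) as [d2 [Hd2 H2]].
  { apply Rmin_pos; [lra|]; apply Rdiv_lt_0_compat; lra. }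
  exists (Rmin d1 d2); split; [now apply Rmin_pos|]; intros w Hw.
  specialize (H1 w (Rlt_le_trans _ _ _ Hw (Rmin_l _ _))).
  specialize (H2 w (Rlt_le_trans _ _ _ Hw (Rmin_r _ _))).
  assert (H2a : Cmod (g w - g z) < 1) by (eapply Rlt_le_trans; [apply H2|apply Rmin_l]).
  assert (H2b : Cmod (g w - g z) < e / (2 * A)) by (eapply Rlt_le_trans; [apply H2|apply Rmin_r]).
  replace (f w * g w - f z * g z)%C with ((f w - f z) * g w + f z * (g w - g z))%C by ring.
  eapply Rle_lt_trans; [apply Cmod_triangle|]; rewrite !Cmod_mult.
  assert (Hgw : Cmod (g w) <= B).
  { generalize (Cmod_triangle_inv (g w) (g z)); unfold B; lra. }
  assert (E1 : Cmod (f w - f z) * Cmod (g w) <= e / (2 * B) * B).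
  { apply Rmult_le_compat; try apply Cmod_ge_0; lra. }
  assert (E2 : Cmod (f z) * Cmod (g w - g z) < A * (e / (2 * A))).
  { apply Rle_lt_trans with (A * Cmod (g w - g z)).
    - apply Rmult_le_compat_r; [apply Cmod_ge_0|unfold A; lra].
    - apply Rmult_lt_compat_l; lra. }
  replace (e / (2 * B) * B) with (e / 2) in E1 by (field; lra).
  replace (A * (e / (2 * A))) with (e / 2) in E2 by (field; lra).
  lra.
Qed.

Lemma ccont_comp (f g : C -> C) (z : C) :
  ccont f (g z) -> ccont g z -> ccont (fun w => f (g w)) z.
Proof.
  intros Hf Hg e He; destruct (Hf e He) as [d [Hd H]].
  destruct (Hg d Hd) as [d' [Hd' H']]; exists d'; split; auto.
Qed.

Lemma ccont_inv (f : C -> C) (z : C) :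
  f z <> 0 -> ccont f z -> ccont (fun w => / f w)%C z.
Proof.
  intros Hz Hf e He.
  assert (Hm := Cmod_pos_neq0 _ Hz); set (m := Cmod (f z)) in *.
  destruct (Hf (Rmin (m / 2) (e * (m / 2 * m)))) as [d [Hd H]].
  { apply Rmin_pos; [lra|]; repeat apply Rmult_lt_0_compat; lra. }
  exists d; split; auto; intros w Hw; specialize (H w Hw).
  assert (H1 := Rlt_le_trans _ _ _ H (Rmin_l _ _)).
  assert (H2 := Rlt_le_trans _ _ _ H (Rmin_r _ _)).
  assert (Hfw : m / 2 < Cmod (f w)).
  { generalize (Cmod_triangle_inv (f z) (f w)); rewrite Cmod_minus_sym; fold m; lra. }
  assert (Hw0 : f w <> 0) by (apply Cmod_gt_0; lra).
  replace (/ f w - / f z)%C with ((f z - f w) / (f w * f z))%C by (field; auto).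
  rewrite Cmod_div by (now apply Cmult_neq_0).
  rewrite Cmod_mult, Cmod_minus_sym; fold m.
  apply Rmult_lt_reg_r with (Cmod (f w) * m); [nra|].
  unfold Rdiv; rewrite Rmult_assoc, Rinv_l, Rmult_1_r by nra.
  eapply Rlt_le_trans; [apply H2|].
  apply Rmult_le_compat_l; [lra|]; apply Rmult_le_compat_r; lra.
Qed.

Lemma ccont_opp (f : C -> C) (z : C) : ccont f z -> ccont (fun w => - f w)%C z.
Proof.
  intros Hf e He; destruct (Hf e He) as [d [Hd H]]; exists d; split; auto.
  intros w Hw; replace (- f w - - f z)%C with (- (f w - f z))%C by ring.
  rewrite Cmod_opp; auto.
Qed.

Lemma ccont_minus (f g : C -> C) (z : C) :
  ccont f z -> ccont g z -> ccont (fun w => f w - g w)%C z.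
Proof. intros; apply (ccont_plus f (fun w => - g w)%C); auto; now apply ccont_opp. Qed.

Lemma ccont_Re (f : C -> C) (z : C) : ccont f z -> ccont (fun w => RtoC (Re (f w))) z.
Proof.
  intros Hf e He; destruct (Hf e He) as [d [Hd H]]; exists d; split; auto.
  intros w Hw; rewrite <- RtoC_minus, Cmod_R, <- Re_minus.
  eapply Rle_lt_trans; [apply re_le_Cmod|auto].
Qed.

Lemma ccont_Im (f : C -> C) (z : C) : ccont f z -> ccont (fun w => RtoC (Im (f w))) z.
Proof.
  intros Hf e He; destruct (Hf e He) as [d [Hd H]]; exists d; split; auto.
  intros w Hw; rewrite <- RtoC_minus, Cmod_R, <- Im_minus.
  eapply Rle_lt_trans; [apply Im_le_Cmod|auto].
Qed.

Lemma ccont_Cmod (f : C -> C) (z : C) : ccont f z -> ccont (fun w => RtoC (Cmod (f w))) z.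
Proof.
  intros Hf e He; destruct (Hf e He) as [d [Hd H]]; exists d; split; auto.
  intros w Hw; specialize (H w Hw); rewrite <- RtoC_minus, Cmod_R.
  generalize (Cmod_triangle_inv (f w) (f z)) (Cmod_triangle_inv (f z) (f w)).
  rewrite (Cmod_minus_sym (f z)); intros; apply Rabs_def1; lra.
Qed.

Lemma ccont_real_comp (h : R -> R) (f : C -> R) (z : C) :
  continuity_pt h (f z) -> ccont (fun w => RtoC (f w)) z -> ccont (fun w => RtoC (h (f w))) z.
Proof.
  intros Hh Hf e He; destruct (Hh e He) as [d [Hd H]].
  destruct (Hf d Hd) as [d' [Hd' H']]; exists d'; split; auto.
  intros w Hw; specialize (H' w Hw); rewrite <- RtoC_minus, Cmod_R in *.
  (* [continuity_pt] controls only arguments different from [f z], so equality is treated apart. *)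
  destruct (Req_dec (f z) (f w)) as [E|E].
  - rewrite E, Rminus_diag, Rabs_R0; lra.
  - apply (H (f w)); split; [split; [exact I|auto]|exact H'].
Qed.

Lemma ccont_pair (f : C -> C) (z : C) :
  ccont (fun w => RtoC (Re (f w))) z -> ccont (fun w => RtoC (Im (f w))) z -> ccont f z.
Proof.
  intros H1 H2.
  apply ccont_ext_loc with (d := 1) (f := fun w => (RtoC (Re (f w)) + Ci * RtoC (Im (f w)))%C).
  - lra.
  - intros w _; ceq.
  - apply ccont_plus; auto; apply ccont_mult; auto; apply ccont_const.
Qed.

(** The slope is the difference quotient completed by [l] at [z]; the error bound says precisely
    that it is continuous there. *)
Lemma cdiff_eps (f : C -> C) (z l : C) :
  (forall eps, 0 < eps -> exists del, 0 < del /\ forall w, Cmod (w - z) < del ->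
     Cmod (f w - f z - l * (w - z)) <= eps * Cmod (w - z)) -> cdiff f z l.
Proof.
  intros H.
  exists (fun w => if excluded_middle_informative (w = z) then l else ((f w - f z) / (w - z))%C).
  assert (Hz : forall w, w <> z -> (w - z)%C <> 0).
  { intros w Hw E; apply Hw; replace w with (w - z + z)%C by ring; rewrite E; ring. }
  split; [|split].
  - intros e He; destruct (H (e / 2)) as [d [Hd Hf]]; [lra|]; exists d; split; auto.
    intros w Hw.
    destruct (excluded_middle_informative (z = z)) as [_|n]; [|now contradiction n].
    destruct (excluded_middle_informative (w = z)) as [E|n].
    + replace (l - l)%C with (RtoC 0) by ring; rewrite Cmod_0; lra.
    + specialize (Hf w Hw); assert (Hn := Hz w n).
      replace ((f w - f z) / (w - z) - l)%C with ((f w - f z - l * (w - z)) / (w - z))%C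
        by (field; auto).
      rewrite Cmod_div by auto.
      assert (Hp := Cmod_pos_neq0 _ Hn).
      apply Rmult_lt_reg_r with (Cmod (w - z)); auto.
      unfold Rdiv; rewrite Rmult_assoc, Rinv_l by lra; nra.
  - destruct (excluded_middle_informative (z = z)) as [_|n]; [auto|now contradiction n].
  - intros w; destruct (excluded_middle_informative (w = z)) as [E|n].
    + subst; ring.
    + field; auto.
Qed.

Lemma cdiff_eps_inv (f : C -> C) (z l : C) : cdiff f z l ->
  (forall eps, 0 < eps -> exists del, 0 < del /\ forall w, Cmod (w - z) < del ->
     Cmod (f w - f z - l * (w - z)) <= eps * Cmod (w - z)).
Proof.
  intros [phi [Hc [Hl Hf]]] e He; destruct (Hc e He) as [d [Hd H]]; exists d; split; auto.
  intros w Hw; rewrite (Hf w), <- Hl.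
  replace (f z + phi w * (w - z) - f z - phi z * (w - z))%C with ((phi w - phi z) * (w - z))%C by ring.
  rewrite Cmod_mult; apply Rmult_le_compat_r; [apply Cmod_ge_0|]; left; auto.
Qed.

(** The slope identity in [cdiff] is global, so the slope of [f] cannot serve for [g], which agrees
    with it only near [z]. The passage goes through the epsilon form, which is local. *)
Lemma cdiff_ext_loc (f g : C -> C) (z l : C) (d : R) :
  0 < d -> (forall w, Cmod (w - z) < d -> f w = g w) -> cdiff f z l -> cdiff g z l.
Proof.
  intros Hd H Hf; apply cdiff_eps; intros e He.
  destruct (cdiff_eps_inv _ _ _ Hf e He) as [d' [Hd' H']].
  exists (Rmin d d'); split; [now apply Rmin_pos|]; intros w Hw.
  rewrite <- (H w), <- (H z).
  - apply H'; eapply Rlt_le_trans; [apply Hw | apply Rmin_r].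
  - replace (z - z)%C with (RtoC 0) by ring; now rewrite Cmod_0.
  - eapply Rlt_le_trans; [apply Hw | apply Rmin_l].
Qed.

Lemma cdiff_ext (f g : C -> C) (z l : C) :
  (forall w, f w = g w) -> cdiff f z l -> cdiff g z l.
Proof. intros H; apply cdiff_ext_loc with 1; auto; lra. Qed.

Lemma cdiff_ccont (f : C -> C) (z l : C) : cdiff f z l -> ccont f z.
Proof.
  intros [phi [Hc [Hl Hf]]].
  apply ccont_ext_loc with (d := 1) (f := fun w => (f z + phi w * (w - z))%C); auto; [lra|].
  apply ccont_plus; [apply ccont_const|]; apply ccont_mult; auto.
  apply ccont_minus; [apply ccont_id|apply ccont_const].
Qed.

Lemma cdiff_unique (f : C -> C) (z l l' : C) : cdiff f z l -> cdiff f z l' -> l = l'.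
Proof.
  intros H1 H2; apply Ceq_minus, Cmod_eq_0.
  apply Rle_antisym; [|apply Cmod_ge_0].
  apply Rnot_lt_le; intros Hp; set (e := Cmod (l - l')) in *.
  destruct (cdiff_eps_inv _ _ _ H1 (e / 4)) as [d1 [Hd1 K1]]; [lra|].
  destruct (cdiff_eps_inv _ _ _ H2 (e / 4)) as [d2 [Hd2 K2]]; [lra|].
  set (h := Rmin d1 d2 / 2).
  assert (Hh : 0 < h /\ h < d1 /\ h < d2) by (now apply half_min).
  destruct Hh as [Hh [Hh1 Hh2]].
  specialize (K1 (z + RtoC h)%C); specialize (K2 (z + RtoC h)%C).
  replace (z + RtoC h - z)%C with (RtoC h) in * by ring.
  rewrite Cmod_R, Rabs_pos_eq in * by lra.
  specialize (K1 Hh1); specialize (K2 Hh2).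
  set (u := (f (z + RtoC h) - f z)%C) in *.
  assert (Cmod ((l - l') * RtoC h) <= e / 2 * h).
  { replace ((l - l') * RtoC h)%C with ((u - l' * RtoC h) - (u - l * RtoC h))%C by ring.
    unfold Cminus at 1; eapply Rle_trans; [apply Cmod_triangle|]; rewrite Cmod_opp; lra. }
  rewrite Cmod_mult, Cmod_R, Rabs_pos_eq in H by lra; fold e in H; nra.
Qed.

Lemma cdiff_eq (f : C -> C) (z l l' : C) : cdiff f z l -> l = l' -> cdiff f z l'.
Proof. now intros H <-. Qed.

Lemma cdiff_const (c z : C) : cdiff (fun _ => c) z 0.
Proof.
  exists (fun _ => RtoC 0); split; [apply ccont_const|split; auto]; intros; ring.
Qed.

Lemma cdiff_id (z : C) : cdiff (fun w => w) z 1.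
Proof. exists (fun _ => RtoC 1); split; [apply ccont_const|split; auto]; intros; ring. Qed.

Lemma cdiff_plus (f g : C -> C) (z a b : C) :
  cdiff f z a -> cdiff g z b -> cdiff (fun w => f w + g w)%C z (a + b)%C.
Proof.
  intros [p [Hp [Ep Fp]]] [q [Hq [Eq Fq]]].
  exists (fun w => p w + q w)%C; split; [now apply ccont_plus|split; [now subst|]].
  intros w; rewrite (Fp w), (Fq w); ring.
Qed.

Lemma cdiff_mult (f g : C -> C) (z a b : C) :
  cdiff f z a -> cdiff g z b -> cdiff (fun w => f w * g w)%C z (a * g z + f z * b)%C.
Proof.
  intros [p [Hp [Ep Fp]]] Hg; assert (Hgc := cdiff_ccont _ _ _ Hg).
  destruct Hg as [q [Hq [Eq Fq]]].
  exists (fun w => p w * g w + f z * q w)%C; split.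
  - apply ccont_plus; apply ccont_mult; auto; apply ccont_const.
  - split; [now subst|]; intros w; rewrite (Fp w), (Fq w); ring.
Qed.

Lemma cdiff_scal (c : C) (f : C -> C) (z a : C) :
  cdiff f z a -> cdiff (fun w => c * f w)%C z (c * a)%C.
Proof.
  intros H; generalize (cdiff_mult _ _ _ _ _ (cdiff_const c z) H).
  replace (RtoC 0 * f z + c * a)%C with (c * a)%C by ring; auto.
Qed.

Lemma cdiff_opp (f : C -> C) (z a : C) : cdiff f z a -> cdiff (fun w => - f w)%C z (- a)%C.
Proof.
  intros H; apply cdiff_ext with (fun w => - RtoC 1 * f w)%C; [intros; ring|].
  replace (- a)%C with (- RtoC 1 * a)%C by ring; now apply cdiff_scal.
Qed.

Lemma cdiff_minus (f g : C -> C) (z a b : C) :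
  cdiff f z a -> cdiff g z b -> cdiff (fun w => f w - g w)%C z (a - b)%C.
Proof. intros; apply cdiff_plus; auto; now apply cdiff_opp. Qed.

Lemma cdiff_comp (f g : C -> C) (z a b : C) :
  cdiff f (g z) a -> cdiff g z b -> cdiff (fun w => f (g w)) z (a * b)%C.
Proof.
  intros [p [Hp [Ep Fp]]] Hg; assert (Hgc := cdiff_ccont _ _ _ Hg).
  destruct Hg as [q [Hq [Eq Fq]]].
  exists (fun w => p (g w) * q w)%C; split.
  - apply ccont_mult; auto; now apply (ccont_comp p g).
  - split; [now subst|]; intros w; rewrite (Fp (g w)).
    replace (g w - g z)%C with (q w * (w - z))%C; [ring|rewrite (Fq w); ring].
Qed.

Lemma cdiff_inv (f : C -> C) (z a : C) :
  f z <> 0 -> cdiff f z a -> cdiff (fun w => / f w)%C z (- a / (f z * f z))%C.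
Proof.
  intros Hz Hf; assert (Hc := cdiff_ccont _ _ _ Hf).
  destruct (Hc (Cmod (f z))) as [d [Hd H]]; [now apply Cmod_pos_neq0|].
  assert (Hw0 : forall w, Cmod (w - z) < d -> f w <> 0).
  { intros w Hw E; specialize (H w Hw); rewrite E in H.
    replace (RtoC 0 - f z)%C with (- f z)%C in H by ring; rewrite Cmod_opp in H; lra. }
  destruct Hf as [p [Hp [Ep Fp]]].
  apply cdiff_ext_loc with (d := d) (f := fun w => (/ f z + - (p w * / (f w * f z)) * (w - z))%C); auto.
  - intros w Hw; specialize (Hw0 w Hw).
    replace (- (p w * / (f w * f z)) * (w - z))%C with (- ((f z + p w * (w - z)) - f z) * / (f w * f z))%C
      by ring.
    rewrite <- Fp; field; auto.
  - exists (fun w => - (p w * / (f w * f z)))%C; split; [|split].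
    + apply ccont_opp, ccont_mult; auto; apply (ccont_inv (fun w => f w * f z)%C).
      * now apply Cmult_neq_0.
      * apply ccont_mult; auto; apply ccont_const.
    + subst a; field; auto.
    + intros w; ring.
Qed.

(** The slope of [f] is the reciprocal of the slope of [g] along [f], and that reciprocal is
    continuous because [f] is. Logarithm and square root are differentiated this way, from their
    continuity and from [cexp] and squaring. *)
Lemma cdiff_inverse (f g : C -> C) (z l : C) (d : R) :
  0 < d -> (forall w, Cmod (w - z) < d -> g (f w) = w) -> ccont f z ->
  cdiff g (f z) l -> l <> 0 -> cdiff f z (/ l)%C.
Proof.
  intros Hd Hgf Hc [p [Hp [Ep Fp]]] Hl.
  assert (Hpf := ccont_comp p f z Hp Hc).
  destruct (Hpf (Cmod l)) as [d' [Hd' H]]; [now apply Cmod_pos_neq0|].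
  set (e := Rmin d d').
  assert (He : 0 < e) by (now apply Rmin_pos).
  assert (Hp0 : forall w, Cmod (w - z) < e -> p (f w) <> 0).
  { intros w Hw E; specialize (H w (Rlt_le_trans _ _ _ Hw (Rmin_r _ _))); rewrite E, Ep in H.
    replace (RtoC 0 - l)%C with (- l)%C in H by ring; rewrite Cmod_opp in H; lra. }
  apply cdiff_ext_loc with (d := e) (f := fun w => (f z + / p (f w) * (w - z))%C); auto.
  - intros w Hw; specialize (Hp0 w Hw).
    assert (E : (w - z = p (f w) * (f w - f z))%C).
    { rewrite <- (Hgf w), (Fp (f w)) at 1 by (eapply Rlt_le_trans; [apply Hw|apply Rmin_l]).
      rewrite (Hgf z); [ring|].
      replace (z - z)%C with (RtoC 0) by ring; now rewrite Cmod_0. }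
    rewrite E; field; auto.
  - exists (fun w => / p (f w))%C; split; [|split].
    + apply ccont_inv; auto; rewrite Ep; auto.
    + now rewrite Ep.
    + intros w; ring.
Qed.

(** Bridge to the notion of derivative in [conformal_onto]; everything else stays with [cdiff]. *)
Lemma cdiff_is_derive (f : C -> C) (z l : C) :
  cdiff f z l -> @is_derive C_AbsRing C_NormedModule f z l.
Proof.
  intros H; split.
  - apply is_linear_scal_l.
  - intros y Hy.
    assert (E : y = z).
    { symmetry. apply is_filter_lim_locally_unique. exact Hy. }
    subst y; intros eps.
    destruct (cdiff_eps_inv _ _ _ H eps (cond_pos eps)) as [d [Hd K]].
    exists (mkposreal d Hd); intros w Hw.
    assert (Hw' : Cmod (w - z) < d) by exact Hw.
    specialize (K w Hw').
    change (Cmod ((f w - f z) - (w - z) * l) <= eps * Cmod (w - z)).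
    rewrite (Cmult_comm (w - z)); exact K.
Qed.

(** * Exponential, sine, cosine, logarithm, square root *)

Lemma Re_cexp (z : C) : Re (cexp z) = exp (Re z) * cos (Im z). Proof. reflexivity. Qed.
Lemma Im_cexp (z : C) : Im (cexp z) = exp (Re z) * sin (Im z). Proof. reflexivity. Qed.
#[export] Hint Rewrite Re_cexp Im_cexp : reim.

Lemma cexp_plus (a b : C) : cexp (a + b) = (cexp a * cexp b)%C.
Proof.
  apply C_ext; reim; rewrite exp_plus, ?cos_plus, ?sin_plus; ring.
Qed.

Lemma cexp_0 : cexp 0 = 1.
Proof. apply C_ext; reim; rewrite exp_0, ?cos_0, ?sin_0; ring. Qed.

Lemma Cmod_cexp (z : C) : Cmod (cexp z) = exp (Re z).
Proof.
  apply Rsqr_inj; [apply Cmod_ge_0|left; apply exp_pos|].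
  rewrite Rsqr_pow2, Cmod2_alt; reim.
  generalize (sin2_cos2 (Im z)); unfold Rsqr; intros E.
  transitivity (exp (Re z) * exp (Re z) * 1); [rewrite <- E; ring|ring].
Qed.

Lemma cexp_neq0 (z : C) : cexp z <> 0.
Proof. apply Cmod_gt_0; rewrite Cmod_cexp; apply exp_pos. Qed.

Lemma cexp_opp (z : C) : (cexp z * cexp (- z) = 1)%C.
Proof. rewrite <- cexp_plus; replace (z + - z)%C with (RtoC 0) by ring; apply cexp_0. Qed.

Lemma derivable_eps (f : R -> R) (l e : R) : derivable_pt_lim f 0 l -> 0 < e ->
  exists d, 0 < d /\ forall h, Rabs h < d -> Rabs (f h - f 0 - l * h) <= e * Rabs h.
Proof.
  intros H He; destruct (H e He) as [[d Hd] Hf]; exists d; split; auto.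
  intros h Hh; destruct (Req_dec h 0) as [->|Hn].
  - replace (f 0 - f 0 - l * 0) with 0 by ring; rewrite Rabs_R0; lra.
  - specialize (Hf h Hn Hh); rewrite Rplus_0_l in Hf.
    replace (f h - f 0 - l * h) with (((f h - f 0) / h - l) * h) by (now field).
    rewrite Rabs_mult; apply Rmult_le_compat_r; [apply Rabs_pos|lra].
Qed.

Lemma cdiff_cexp_0 : cdiff cexp 0 1.
Proof.
  apply cdiff_eps; intros e He.
  (* The errors of [exp], [cos] and [sin] add up to at most [6 * e1 * Cmod w], so a tenth of [e]
     suffices; the bound 1 keeps [exp a] below 2. *)
  set (e1 := Rmin 1 (e / 10)).
  assert (He1 : 0 < e1) by (apply Rmin_pos; lra).
  assert (He1a : e1 <= 1) by apply Rmin_l.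
  assert (He1b : e1 <= e / 10) by apply Rmin_r.
  destruct (derivable_eps exp 1 e1) as [d1 [Hd1 H1]]; auto.
  { generalize (derivable_pt_lim_exp 0); now rewrite exp_0. }
  destruct (derivable_eps cos 0 e1) as [d2 [Hd2 H2]]; auto.
  { generalize (derivable_pt_lim_cos 0); now rewrite sin_0, Ropp_0. }
  destruct (derivable_eps sin 1 e1) as [d3 [Hd3 H3]]; auto.
  { generalize (derivable_pt_lim_sin 0); now rewrite cos_0. }
  set (d := Rmin (Rmin d1 d2) (Rmin d3 (e1 / 2))).
  exists d; split; [repeat apply Rmin_pos; lra|].
  intros w Hw; replace (w - RtoC 0)%C with w in * by ring.
  assert (Ha := re_le_Cmod w); assert (Hb := Im_le_Cmod w).
  assert (Hwd : Cmod w < d1 /\ Cmod w < d2 /\ Cmod w < d3 /\ Cmod w < e1 / 2).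
  { unfold d in Hw; repeat split; eapply Rlt_le_trans; try apply Hw.
    - eapply Rle_trans; [apply Rmin_l|apply Rmin_l].
    - eapply Rle_trans; [apply Rmin_l|apply Rmin_r].
    - eapply Rle_trans; [apply Rmin_r|apply Rmin_l].
    - eapply Rle_trans; [apply Rmin_r|apply Rmin_r]. }
  destruct Hwd as [W1 [W2 [W3 W4]]].
  set (a := Re w) in *; set (b := Im w) in *.
  specialize (H1 a ltac:(lra)); specialize (H2 b ltac:(lra)); specialize (H3 b ltac:(lra)).
  rewrite exp_0, cos_0, sin_0 in *.
  assert (Hexp1 : Rabs (exp a - 1) <= e1).
  { replace (exp a - 1) with ((exp a - 1 - 1 * a) + a) by ring.
    eapply Rle_trans; [apply Rabs_triang|].
    assert (Rabs a <= e1 / 2) by lra; generalize (Rabs_pos a); nra. }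
  assert (Hexp : Rabs (exp a) <= 2).
  { replace (exp a) with ((exp a - 1) + 1) by ring.
    eapply Rle_trans; [apply Rabs_triang|]; rewrite Rabs_R1; lra. }
  rewrite cexp_0; eapply Rle_trans; [apply Cmod_le_ReIm|].
  replace (Re _) with ((exp a - 1 - 1 * a) + exp a * (cos b - 1 - 0 * b))
    by (reim; unfold a, b; ring).
  replace (Im _) with (exp a * (sin b - 0 - 1 * b) + (exp a - 1) * b)
    by (reim; unfold a, b; ring).
  assert (A1 := Rabs_triang (exp a - 1 - 1 * a) (exp a * (cos b - 1 - 0 * b))).
  assert (A2 := Rabs_triang (exp a * (sin b - 0 - 1 * b)) ((exp a - 1) * b)).
  rewrite Rabs_mult in A1; rewrite !Rabs_mult in A2.
  assert (B1 : Rabs (exp a) * Rabs (cos b - 1 - 0 * b) <= 2 * (e1 * Rabs b))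
    by (apply Rmult_le_compat; auto; apply Rabs_pos).
  assert (B2 : Rabs (exp a) * Rabs (sin b - 0 - 1 * b) <= 2 * (e1 * Rabs b))
    by (apply Rmult_le_compat; auto; apply Rabs_pos).
  assert (B3 : Rabs (exp a - 1) * Rabs b <= e1 * Rabs b)
    by (apply Rmult_le_compat_r; auto; apply Rabs_pos).
  assert (B4 : e1 * Rabs a <= e1 * Cmod w) by (apply Rmult_le_compat_l; lra).
  assert (B5 : e1 * Rabs b <= e1 * Cmod w) by (apply Rmult_le_compat_l; lra).
  assert (B6 : e1 * Cmod w <= e / 10 * Cmod w) by (apply Rmult_le_compat_r; [apply Cmod_ge_0|lra]).
  assert (0 <= e * Cmod w) by (apply Rmult_le_pos; [lra|apply Cmod_ge_0]); lra.
Qed.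

Lemma cdiff_cexp (z : C) : cdiff cexp z (cexp z).
Proof.
  apply cdiff_ext with (fun w => cexp z * cexp (w - z))%C.
  - intros w; rewrite <- cexp_plus; f_equal; ring.
  - apply cdiff_eq with (cexp z * (RtoC 1 * (RtoC 1 - RtoC 0)))%C; [|ring].
    apply cdiff_scal, (cdiff_comp cexp (fun w => w - z)%C).
    + replace (z - z)%C with (RtoC 0) by ring; apply cdiff_cexp_0.
    + apply cdiff_minus; [apply cdiff_id|apply cdiff_const].
Qed.

Definition csin (w : C) : C :=
  ((cexp (Ci * w) - cexp (Ci * - w)) / (2 * Ci))%C.

Lemma two_neq0 : RtoC 2 <> 0. Proof. apply RtoC_neq0; lra. Qed.

Ltac cfield := field; repeat split; first [apply Ci_nz | apply RtoC_neq0; lra | idtac].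

Lemma ccos_csin_exp (w : C) : (ccos w + Ci * csin w = cexp (Ci * w))%C.
Proof.
  unfold ccos, csin; rewrite RtoC_inv by lra; cfield.
Qed.

Lemma cdiff_csin (z : C) : cdiff csin z (ccos z).
Proof.
  unfold csin.
  apply cdiff_ext with (fun w => / (2 * Ci) * (cexp (Ci * w) - cexp ((- Ci) * w)))%C.
  { intros w; replace (- Ci * w)%C with (Ci * - w)%C by ring.
    unfold Cdiv; ring. }
  replace (ccos z) with (/ (2 * Ci) * (cexp (Ci * z) * (Ci * 1) - cexp ((- Ci) * z) * (- Ci * 1)))%C.
  - apply cdiff_scal, cdiff_minus; apply (cdiff_comp cexp); try apply cdiff_cexp; apply cdiff_scal, cdiff_id.
  - unfold ccos; rewrite RtoC_inv by lra.
    replace (- Ci * z)%C with (Ci * - z)%C by ring.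
    cfield.
Qed.

Lemma cdiff_ccos (z : C) : cdiff ccos z (- csin z)%C.
Proof.
  unfold ccos.
  apply cdiff_ext with (fun w => RtoC (/ 2) * (cexp (Ci * w) + cexp ((- Ci) * w)))%C.
  { intros w; replace (- Ci * w)%C with (Ci * - w)%C by ring; ring. }
  replace (- csin z)%C with (RtoC (/ 2) * (cexp (Ci * z) * (Ci * 1) + cexp ((- Ci) * z) * (- Ci * 1)))%C.
  - apply cdiff_scal, cdiff_plus; apply (cdiff_comp cexp); try apply cdiff_cexp; apply cdiff_scal, cdiff_id.
  - unfold csin; rewrite RtoC_inv by lra.
    replace (- Ci * z)%C with (Ci * - z)%C by ring.
    apply Ceq_minus.
    replace (_ - _)%C with ((Ci * Ci + RtoC 1) * (cexp (Ci * z) - cexp (Ci * - z)) / (2 * Ci))%C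
      by (cfield).
    rewrite Ci2; cfield.
Qed.

Lemma ccos2_csin2 (z : C) : (ccos z * ccos z + csin z * csin z = 1)%C.
Proof.
  assert (H1 := cexp_opp (Ci * z)); replace (- (Ci * z))%C with (Ci * - z)%C in H1 by ring.
  unfold ccos, csin; rewrite RtoC_inv by lra.
  set (a := cexp (Ci * z)) in *; set (b := cexp (Ci * - z)) in *.
  replace (RtoC 1) with (a * b)%C.
  apply Ceq_minus.
  replace (_ - _)%C with ((Ci * Ci + 1) * (a - b) * (a - b) / (4 * Ci * Ci))%C.
  - rewrite Ci2; cfield.
  - cfield.
Qed.

Lemma Re_ccos (z : C) : Re (ccos z) = cos (Re z) * cosh (Im z).
Proof.
  unfold ccos, cosh; reim.
  replace (0 * Re z - 1 * Im z) with (- Im z) by ring.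
  replace (0 * Im z + 1 * Re z) with (Re z) by ring.
  replace (0 * - Re z - 1 * - Im z) with (Im z) by ring.
  replace (0 * - Im z + 1 * - Re z) with (- Re z) by ring.
  rewrite cos_neg, sin_neg; field.
Qed.

Lemma Im_ccos (z : C) : Im (ccos z) = - (sin (Re z) * sinh (Im z)).
Proof.
  unfold ccos, sinh; reim.
  replace (0 * Re z - 1 * Im z) with (- Im z) by ring.
  replace (0 * Im z + 1 * Re z) with (Re z) by ring.
  replace (0 * - Re z - 1 * - Im z) with (Im z) by ring.
  replace (0 * - Im z + 1 * - Re z) with (- Re z) by ring.
  rewrite cos_neg, sin_neg; field.
Qed.

(** Isolates the exponential that grows in the upper half-plane. The remaining factor
    [1 - cexp (2 i z)] has positive real part there, hence a logarithm. *)
Lemma csin_exp_form (z : C) :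
  (csin z = Ci / 2 * cexp (- (Ci * z)) * (1 - cexp (2 * (Ci * z))))%C.
Proof.
  replace (2 * (Ci * z))%C with (Ci * z + Ci * z)%C by ring; rewrite cexp_plus.
  assert (H1 := cexp_opp (Ci * z)).
  unfold csin; replace (Ci * - z)%C with (- (Ci * z))%C by ring.
  set (a := cexp (Ci * z)) in *; set (b := cexp (- (Ci * z))) in *.
  replace (Ci / 2 * b * (1 - a * a))%C with (Ci / 2 * (b - (a * b) * a))%C by (cfield).
  rewrite H1; apply Ceq_minus.
  replace (_ - _)%C with ((1 + Ci * Ci) * (a - b) / (2 * Ci))%C.
  - rewrite Ci2; cfield.
  - cfield.
Qed.

Lemma Re_csin (z : C) : Re (csin z) = sin (Re z) * cosh (Im z).
Proof.
  assert (E : (csin z = - Ci * (cexp (Ci * z) - ccos z))%C).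
  { rewrite <- ccos_csin_exp.
    replace (- Ci * (ccos z + Ci * csin z - ccos z))%C with (- (Ci * Ci) * csin z)%C by ring.
    rewrite Ci2; ring. }
  rewrite E; reim; rewrite Im_ccos; unfold sinh, cosh; reim.
  replace (0 * Re z - 1 * Im z) with (- Im z) by ring.
  replace (0 * Im z + 1 * Re z) with (Re z) by ring; field.
Qed.

Lemma Im_csin (z : C) : Im (csin z) = cos (Re z) * sinh (Im z).
Proof.
  assert (E : (csin z = - Ci * (cexp (Ci * z) - ccos z))%C).
  { rewrite <- ccos_csin_exp.
    replace (- Ci * (ccos z + Ci * csin z - ccos z))%C with (- (Ci * Ci) * csin z)%C by ring.
    rewrite Ci2; ring. }
  rewrite E; reim; rewrite Re_ccos; unfold sinh, cosh; reim.
  replace (0 * Re z - 1 * Im z) with (- Im z) by ring.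
  replace (0 * Im z + 1 * Re z) with (Re z) by ring; field.
Qed.

Lemma csin_real (t : R) : csin (RtoC t) = RtoC (sin t).
Proof.
  apply C_ext; rewrite ?Re_csin, ?Im_csin; reim; rewrite ?cosh_0, ?sinh_0; ring.
Qed.

Lemma ccos_real (t : R) : ccos (RtoC t) = RtoC (cos t).
Proof.
  apply C_ext; rewrite ?Re_ccos, ?Im_ccos; reim; rewrite ?cosh_0, ?sinh_0; ring.
Qed.

(** The principal logarithm on the right half-plane only, where the argument is the arctangent of
    the slope; all arguments below have positive real part. *)
Definition clog (z : C) : C := (ln (Cmod z), atan (Im z / Re z)).

Lemma cexp_clog (z : C) : 0 < Re z -> cexp (clog z) = z.
Proof.
  intros Hz.
  assert (Hm : 0 < Cmod z) by (generalize (re_le_Cmod z); rewrite Rabs_pos_eq; lra).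
  
  assert (E : sqrt (1 + (Im z / Re z)²) = Cmod z / Re z).
  { replace (1 + (Im z / Re z)²) with (Rsqr (Cmod z / Re z)).
    - apply sqrt_Rsqr; left; now apply Rdiv_lt_0_compat.
    - unfold Rsqr; replace (Cmod z / Re z * (Cmod z / Re z)) with (Cmod z ^ 2 / (Re z ^ 2)) by (field; lra).
      rewrite Cmod2_alt; field; lra. }
  apply C_ext; reim; simpl; rewrite exp_ln by auto; fold (Re z) (Im z); rewrite ?cos_atan, ?sin_atan, E; field; lra.
Qed.

Lemma ccont_clog (z : C) : 0 < Re z -> ccont clog z.
Proof.
  intros Hz.
  assert (Hm : 0 < Cmod z) by (generalize (re_le_Cmod z); rewrite Rabs_pos_eq; lra).
  apply ccont_pair; simpl.
  - apply (ccont_real_comp ln (fun w => Cmod w)).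
    + apply derivable_continuous_pt; exists (/ Cmod z); now apply derivable_pt_lim_ln.
    + apply (ccont_Cmod (fun w => w)), ccont_id.
  - apply (ccont_real_comp atan (fun w => Im w / Re w)).
    + apply derivable_continuous_pt, derivable_pt_atan.
    + apply ccont_ext_loc with (d := Re z) (f := fun w => (RtoC (Im w) * / RtoC (Re w))%C); auto.
      * intros w Hw; assert (H := re_le_Cmod (w - z)).
        assert (0 < Re w).
        { assert (Hl : Rabs (Re (w - z)) < Re z) by lra; apply Rabs_def2 in Hl; rewrite Re_minus in Hl; lra. }
        rewrite RtoC_div by lra; reflexivity.
      * apply ccont_mult; [apply (ccont_Im (fun w => w)), ccont_id|].
        apply ccont_inv; [apply RtoC_neq0; lra|apply (ccont_Re (fun w => w)), ccont_id].
Qed.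

Lemma cdiff_clog (z : C) : 0 < Re z -> cdiff clog z (/ z)%C.
Proof.
  intros Hz; apply cdiff_inverse with (g := cexp) (d := Re z); auto.
  - intros w Hw; apply cexp_clog; assert (H := re_le_Cmod (w - z)).
    assert (Hl : Rabs (Re (w - z)) < Re z) by lra; apply Rabs_def2 in Hl; rewrite Re_minus in Hl; lra.
  - now apply ccont_clog.
  - rewrite <- (cexp_clog z) at 2 by auto; apply cdiff_cexp.
  - intros E; rewrite E in Hz; simpl in Hz; lra.
Qed.

(** Principal square root off the closed negative axis. The vector [w + |w|] bisects the angle
    between [w] and the positive axis, and [(w + |w|)^2 = 2 (|w| + Re w) w] gives the normalisation.
    The recurrent condition [0 < Cmod w + Re w] describes the slit plane. *)
Definition csqrt (w : C) : C :=
  ((w + RtoC (Cmod w)) * RtoC (/ sqrt (2 * (Cmod w + Re w))))%C.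

Lemma csqrt_sqr (w : C) : 0 < Cmod w + Re w -> (csqrt w * csqrt w = w)%C.
Proof.
  intros H; set (s := sqrt (2 * (Cmod w + Re w))).
  assert (Hs : 0 < s) by (apply sqrt_lt_R0; lra).
  assert (Hs2 : s * s = 2 * (Cmod w + Re w)) by (apply sqrt_sqrt; lra).
  unfold csqrt; fold s.
  replace (_ * _)%C with ((w + RtoC (Cmod w)) * (w + RtoC (Cmod w)) * RtoC (/ (s * s)))%C.
  2: { rewrite Rinv_mult, RtoC_mult; ring. }
  rewrite Hs2.
  assert (E2 : ((w + RtoC (Cmod w)) * (w + RtoC (Cmod w)) = w * RtoC (2 * (Cmod w + Re w)))%C).
  { assert (Hm := Cmod2_alt w); apply C_ext; reim; nra. }
  rewrite E2, RtoC_inv by lra.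
  field; apply RtoC_neq0; lra.
Qed.

Lemma Re_csqrt (w : C) : 0 < Cmod w + Re w -> 0 < Re (csqrt w).
Proof.
  intros H; unfold csqrt; reim.
  assert (0 < / sqrt (2 * (Cmod w + Re w))) by (apply Rinv_0_lt_compat, sqrt_lt_R0; lra).
  nra.
Qed.

Lemma ccont_csqrt (z : C) : 0 < Cmod z + Re z -> ccont csqrt z.
Proof.
  intros H; unfold csqrt.
  assert (Hid := ccont_id z).
  assert (H1 : ccont (fun w => RtoC (2 * (Cmod w + Re w))) z).
  { apply ccont_ext_loc with (d := 1) (f := fun w => (2 * (RtoC (Cmod w) + RtoC (Re w)))%C); [lra| |].
    - intros w _; now rewrite RtoC_mult, RtoC_plus.
    - apply ccont_mult; [apply ccont_const|]; apply ccont_plus;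
        [apply (ccont_Cmod (fun w => w)); auto|apply (ccont_Re (fun w => w)); auto]. }
  apply ccont_mult.
  - apply ccont_plus; auto; apply (ccont_Cmod (fun w => w)); auto.
  - apply (ccont_real_comp (fun r => / sqrt r) (fun w => 2 * (Cmod w + Re w))); auto.
    apply continuity_pt_inv.
    + apply continuity_pt_sqrt; lra.
    + apply Rgt_not_eq, sqrt_lt_R0; lra.
Qed.

Lemma ccont_pos_loc (f : C -> R) (z : C) :
  ccont (fun w => RtoC (f w)) z -> 0 < f z ->
  exists d, 0 < d /\ forall w, Cmod (w - z) < d -> 0 < f w.
Proof.
  intros H Hp; destruct (H (f z) Hp) as [d [Hd K]]; exists d; split; auto.
  intros w Hw; specialize (K w Hw); rewrite <- RtoC_minus, Cmod_R in K.
  apply Rabs_def2 in K; lra.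
Qed.

Lemma cdiff_csqrt (z : C) : 0 < Cmod z + Re z -> cdiff csqrt z (/ (2 * csqrt z))%C.
Proof.
  intros Hz.
  destruct (ccont_pos_loc (fun w => Cmod w + Re w) z) as [d [Hd H]]; auto.
  { apply ccont_ext_loc with (d := 1) (f := fun w => (RtoC (Cmod w) + RtoC (Re w))%C); [lra| |].
    - intros w _; now rewrite RtoC_plus.
    - apply ccont_plus; [apply (ccont_Cmod (fun w => w))|apply (ccont_Re (fun w => w))]; apply ccont_id. }
  apply cdiff_inverse with (g := fun w => (w * w)%C) (d := d); auto.
  - intros w Hw; apply csqrt_sqr; auto.
  - now apply ccont_csqrt.
  - apply cdiff_eq with (1 * csqrt z + csqrt z * 1)%C; [|ring].
    apply (cdiff_mult (fun w => w) (fun w => w)); apply cdiff_id.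
  - apply Cmult_neq_0; [apply two_neq0|].
    intros E; generalize (Re_csqrt z Hz); rewrite E; simpl; lra.
Qed.

Lemma not_negreal_pos (w : C) : ~ (Im w = 0 /\ Re w <= 0) -> 0 < Cmod w + Re w.
Proof.
  intros H; apply Rnot_le_lt; intros Hle; apply H.
  assert (Hm := Cmod2_alt w); generalize (Cmod_ge_0 w); intros H0.
  split; [|lra].
  assert (Im w ^ 2 <= 0) by nra; nra.
Qed.

(** Turns a complex derivative into that of a real function of a real variable, so that the real
    mean value theorem applies. The factor [c] selects the direction onto which the values of [f]
    are projected. *)
Lemma cdiff_segment (f : C -> C) (c z d l : C) (s : R) :
  cdiff f (z + RtoC s * d) l ->
  is_derive (fun u : R => Re (c * f (z + RtoC u * d)%C)) s (Re (c * (l * d)))%C.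
Proof.
  intros [phi [Hc [Hl Hf]]].
  apply is_derive_Reals; intros e He.
  assert (Hcc : ccont (fun w => c * (phi w * d))%C (z + RtoC s * d)).
  { apply ccont_mult; [apply ccont_const|]; apply ccont_mult; auto; apply ccont_const. }
  destruct (Hcc e He) as [del [Hdel K]].
  assert (Hd0 := Cmod_ge_0 d).
  assert (Hp : 0 < del / (Cmod d + 1)) by (apply Rdiv_lt_0_compat; lra).
  exists (mkposreal _ Hp); intros h Hh Hlt; simpl in Hlt.
  set (z0 := (z + RtoC s * d)%C) in *.
  assert (E : (z + RtoC (s + h) * d = z0 + RtoC h * d)%C) by (unfold z0; rewrite RtoC_plus; ring).
  rewrite E, (Hf (z0 + RtoC h * d)%C).
  replace (z0 + RtoC h * d - z0)%C with (RtoC h * d)%C by ring.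
  set (w := (z0 + RtoC h * d)%C).
  replace ((Re (c * (f z0 + phi w * (RtoC h * d))) - Re (c * f z0)) / h - Re (c * (l * d)))
    with (Re (c * (phi w * d) - c * (phi z0 * d))).
  2: { rewrite Hl; reim; field; auto. }
  eapply Rle_lt_trans; [apply re_le_Cmod|]; apply K.
  unfold w; replace (z0 + RtoC h * d - z0)%C with (RtoC h * d)%C by ring.
  rewrite Cmod_mult, Cmod_R.
  apply Rle_lt_trans with (Rabs h * (Cmod d + 1)).
  - apply Rmult_le_compat_l; [apply Rabs_pos|lra].
  - apply Rmult_lt_reg_r with (/ (Cmod d + 1)); [apply Rinv_0_lt_compat; lra|].
    rewrite Rmult_assoc, Rinv_r, Rmult_1_r by lra; exact Hlt.
Qed.

(** * Polynomials and trigonometric polynomials of half-integer degree *)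

(** Extensional form of [peval]: together with the Horner step [c + z * g z] as induction principle
    it avoids all formulas for coefficients. *)
Definition Pol (n : nat) (f : C -> C) : Prop := exists a, forall z, f z = peval n a z.

Lemma peval_0 (a : nat -> C) (z : C) : peval 0 a z = a 0%nat.
Proof. unfold peval; rewrite sum_O; change (a 0%nat * 1 = a 0%nat)%C; ring. Qed.

Lemma peval_S (n : nat) (a : nat -> C) (z : C) :
  peval (S n) a z = (a 0%nat + z * peval n (fun k => a (S k)) z)%C.
Proof.
  induction n.
  - rewrite peval_0; unfold peval; rewrite sum_Sn, sum_O.
    change (a 0%nat * 1 + a 1%nat * (z * 1) = a 0%nat + z * a 1%nat)%C; ring.
  - unfold peval in *; rewrite sum_Sn, IHn, (sum_Sn _ n).
    set (s := sum_n _ n).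
    change (a 0%nat + z * s + a (S (S n)) * (z * pow_n (K := C_Ring) z (S n)) =
      a 0%nat + z * (s + a (S (S n)) * pow_n (K := C_Ring) z (S n)))%C; ring.
Qed.

Lemma Pol_0 (f : C -> C) : Pol 0 f -> exists c, forall z, f z = c.
Proof. intros [a H]; exists (a 0%nat); intros z; now rewrite H, peval_0. Qed.

Lemma Pol_S_inv (n : nat) (f : C -> C) :
  Pol (S n) f -> exists c g, Pol n g /\ forall z, f z = (c + z * g z)%C.
Proof.
  intros [a H]; exists (a 0%nat), (peval n (fun k => a (S k))); split.
  - now exists (fun k => a (S k)).
  - intros z; now rewrite H, peval_S.
Qed.

Lemma Pol_S (n : nat) (c : C) (g f : C -> C) :
  Pol n g -> (forall z, f z = c + z * g z)%C -> Pol (S n) f.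
Proof.
  intros [a H] Hf; exists (fun k => match k with O => c | S k => a k end).
  intros z; rewrite peval_S, Hf, H; reflexivity.
Qed.

Lemma Pol_const (n : nat) (c : C) : Pol n (fun _ => c).
Proof.
  revert c; induction n; intros c.
  - exists (fun _ => c); intros; now rewrite peval_0.
  - apply (Pol_S n c (fun _ => RtoC 0)); auto; intros; ring.
Qed.

Lemma Pol_ext (n : nat) (f g : C -> C) : (forall z, f z = g z) -> Pol n f -> Pol n g.
Proof. intros H [a Ha]; exists a; intros; now rewrite <- H. Qed.

Lemma Pol_plus (n : nat) : forall f g, Pol n f -> Pol n g -> Pol n (fun z => f z + g z)%C.
Proof.
  induction n; intros f g Hf Hg.
  - apply Pol_0 in Hf; apply Pol_0 in Hg; destruct Hf as [c Hc], Hg as [d Hd].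
    apply Pol_ext with (fun _ => c + d)%C; [intros; now rewrite Hc, Hd|apply Pol_const].
  - apply Pol_S_inv in Hf; apply Pol_S_inv in Hg.
    destruct Hf as [c [f1 [Hf1 Ef]]], Hg as [d [g1 [Hg1 Eg]]].
    apply (Pol_S n (c + d)%C (fun z => f1 z + g1 z)%C); auto.
    intros z; rewrite Ef, Eg; ring.
Qed.

Lemma Pol_scal (n : nat) (c : C) : forall f, Pol n f -> Pol n (fun z => c * f z)%C.
Proof.
  induction n; intros f Hf.
  - apply Pol_0 in Hf; destruct Hf as [d Hd].
    apply Pol_ext with (fun _ => c * d)%C; [intros; now rewrite Hd|apply Pol_const].
  - apply Pol_S_inv in Hf; destruct Hf as [d [f1 [Hf1 Ef]]].
    apply (Pol_S n (c * d)%C (fun z => c * f1 z)%C); auto.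
    intros z; rewrite Ef; ring.
Qed.

Lemma Pol_succ (n : nat) : forall f, Pol n f -> Pol (S n) f.
Proof.
  induction n; intros f Hf.
  - apply Pol_0 in Hf; destruct Hf as [d Hd].
    apply Pol_ext with (fun _ => d); [intros; now rewrite Hd|apply Pol_const].
  - apply Pol_S_inv in Hf; destruct Hf as [d [f1 [Hf1 Ef]]].
    apply (Pol_S (S n) d f1); auto.
Qed.

Lemma Pol_mult (m n : nat) (f g : C -> C) :
  Pol n f -> Pol m g -> Pol (n + m) (fun z => f z * g z)%C.
Proof.
  revert f; induction n; intros f Hf Hg; simpl.
  - apply Pol_0 in Hf; destruct Hf as [c Hc].
    apply Pol_ext with (fun z => c * g z)%C; [intros; now rewrite Hc|now apply Pol_scal].
  - apply Pol_S_inv in Hf; destruct Hf as [c [f1 [Hf1 Ef]]].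
    apply Pol_ext with (fun z => c * g z + (0 + z * (f1 z * g z)))%C.
    { intros; rewrite Ef; ring. }
    apply Pol_plus.
    + assert (H : forall k, Pol (k + m) (fun z => c * g z)%C).
      { induction k; simpl; [now apply Pol_scal|now apply Pol_succ]. }
      exact (H (S n)).
    + eapply Pol_S; [apply (IHn f1); auto|]; reflexivity.
Qed.

Lemma Pol_division (n : nat) (z0 : C) : forall f, Pol (S n) f ->
  exists g, Pol n g /\ forall z, f z = (f z0 + (z - z0) * g z)%C.
Proof.
  induction n; intros f Hf; apply Pol_S_inv in Hf; destruct Hf as [c [h [Hh Ef]]].
  - exists h; split; auto; intros z; rewrite !Ef.
    apply Pol_0 in Hh; destruct Hh as [d Hd]; rewrite !Hd; ring.
  - destruct (IHn h Hh) as [k [Hk Ek]].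
    exists (fun z => h z0 + z * k z)%C; split.
    + eapply Pol_S; [apply Hk|]; reflexivity.
    + intros z; rewrite !Ef, (Ek z); ring.
Qed.

(** The degree is recorded for [z * df z] because differentiating [p (e^(iz))] produces exactly this
    combination at [e^(iz)]; hence derivatives of trigonometric polynomials keep their degree. *)
Lemma Pol_diff (n : nat) : forall f, Pol n f ->
  exists df, (forall z, cdiff f z (df z)) /\ Pol n (fun z => z * df z)%C.
Proof.
  induction n; intros f Hf.
  - apply Pol_0 in Hf; destruct Hf as [c Hc]; exists (fun _ => RtoC 0); split.
    + intros z; apply cdiff_ext with (fun _ => c); [auto|apply cdiff_const].
    + apply Pol_ext with (fun _ => RtoC 0); [intros; ring|apply Pol_const].
  - apply Pol_S_inv in Hf; destruct Hf as [c [g [Hg Ef]]].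
    destruct (IHn g Hg) as [dg [Hd Hp]].
    exists (fun z => g z + z * dg z)%C; split.
    + intros z; apply cdiff_ext with (fun z => c + z * g z)%C; [auto|].
      apply cdiff_eq with (0 + (1 * g z + z * dg z))%C; [|ring].
      apply cdiff_plus; [apply cdiff_const|].
      apply (cdiff_mult (fun w => w)); [apply cdiff_id|auto].
    + apply (Pol_S n 0 (fun z => g z + z * dg z)%C); [now apply Pol_plus|].
      intros; ring.
Qed.

(** The reciprocal polynomial with conjugated and reversed coefficients. On the circle it replaces
    the non-holomorphic conjugate by a polynomial of the same degree. *)
Lemma Pol_star (n : nat) : forall f, Pol n f ->
  exists g, Pol n g /\ forall w, Cmod w = 1 -> g w = (w ^ n * Cconj (f w))%C.
Proof.
  induction n; intros f Hf.
  - apply Pol_0 in Hf; destruct Hf as [c Hc]; exists (fun _ => Cconj c); split.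
    + apply Pol_const.
    + intros w _; rewrite Hc; simpl; ring.
  - apply Pol_S_inv in Hf; destruct Hf as [c [f1 [Hf1 Ef]]].
    destruct (IHn f1 Hf1) as [g1 [Hg1 Eg]].
    assert (Hpow : forall k, Pol k (fun z => z ^ k)%C).
    { induction k; [apply (Pol_const 0 1)|].
      apply (Pol_S k 0 (fun z => z ^ k)%C); auto; intros; simpl; ring. }
    exists (fun z => Cconj c * z ^ S n + g1 z)%C; split.
    + apply Pol_plus; [apply Pol_scal, Hpow|now apply Pol_succ].
    + intros w Hw; rewrite Eg, Ef, Cplus_conj, Cmult_conj by auto.
      assert (E : (w * Cconj w = 1)%C).
      { rewrite <- Cmod2_conj, Hw; rewrite pow1; reflexivity. }
      simpl; transitivity (Cconj c * (w * w ^ n) + w ^ n * ((w * Cconj w) * Cconj (f1 w)))%C; [rewrite E|]; ring.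
Qed.

Lemma cdiff_pow_n (z : C) (n : nat) :
  cdiff (fun w => @pow_n C_Ring w (S n)) z (RtoC (INR (S n)) * @pow_n C_Ring z n)%C.
Proof.
  induction n.
  - apply cdiff_ext with (fun w => w); [intros w; change (w = w * 1)%C; ring|].
    apply cdiff_eq with (RtoC 1); [apply cdiff_id|simpl; change (RtoC 1 = RtoC 1 * 1)%C; ring].
  - apply cdiff_ext with (fun w => w * @pow_n C_Ring w (S n))%C; [reflexivity|].
    eapply cdiff_eq; [apply (cdiff_mult (fun w => w)); [apply cdiff_id|apply IHn]|].
    rewrite (S_INR (S n)), RtoC_plus.
    change (@pow_n C_Ring z (S n)) with (z * @pow_n C_Ring z n)%C; ring.
Qed.

(** The condition on [n] matters: since [pred 0 = 0], the sum [pderiv 0] still contains the term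
    with [a 1]. *)
Lemma cdiff_peval (n : nat) (a : nat -> C) (z : C) :
  (1 <= n)%nat -> cdiff (peval n a) z (pderiv n a z).
Proof.
  intros Hn; destruct n as [|n]; [lia|clear Hn]; unfold pderiv; simpl pred.
  induction n.
  - apply cdiff_ext with (fun w => a 0%nat + w * a 1%nat)%C.
    { intros w; now rewrite peval_S, peval_0. }
    eapply cdiff_eq; [apply cdiff_plus; [apply cdiff_const|]|].
    + apply (cdiff_mult (fun w => w)); [apply cdiff_id|apply cdiff_const].
    + rewrite sum_O; simpl; change (0 + (1 * a 1%nat + z * 0) = RtoC 1 * a 1%nat * 1)%C; ring.
  - rewrite sum_Sn.
    apply cdiff_ext with (fun w => peval (S n) a w + a (S (S n)) * @pow_n C_Ring w (S (S n)))%C.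
    { intros w; unfold peval; now rewrite (sum_Sn _ (S n)). }
    eapply cdiff_eq; [apply cdiff_plus; [apply IHn|apply cdiff_scal, cdiff_pow_n]|].
    change plus with Cplus.
    set (s := sum_n _ n); set (p := @pow_n C_Ring z (S n)).
    change (s + a (S (S n)) * (RtoC (INR (S (S n))) * p) = s + RtoC (INR (S (S n))) * a (S (S n)) * p)%C.
    ring.
Qed.

Definition ehalf (n : nat) (z : C) : C := cexp (Ci * z * RtoC (INR n / 2)).

Lemma ehalf_plus (m n : nat) (z : C) : ehalf (m + n) z = (ehalf m z * ehalf n z)%C.
Proof.
  unfold ehalf; rewrite <- cexp_plus; f_equal.
  rewrite plus_INR; replace ((INR m + INR n) / 2) with (INR m / 2 + INR n / 2) by field.
  rewrite RtoC_plus; ring.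
Qed.

Lemma ehalf_0 (z : C) : ehalf 0 z = 1.
Proof.
  unfold ehalf; simpl; replace (0 / 2) with 0 by field.
  replace (Ci * z * RtoC 0)%C with (RtoC 0) by ring; apply cexp_0.
Qed.

Lemma ehalf_2 (z : C) : ehalf 2 z = cexp (Ci * z).
Proof.
  unfold ehalf; simpl; replace ((1 + 1) / 2) with 1 by field.
  f_equal; ring.
Qed.

Lemma ehalf_neq0 (n : nat) (z : C) : ehalf n z <> 0.
Proof. apply cexp_neq0. Qed.

Lemma ehalf_sqr (n : nat) (z : C) : (ehalf n z * ehalf n z = cexp (Ci * z) ^ n)%C.
Proof.
  induction n.
  - rewrite !ehalf_0; simpl; ring.
  - change (S n) with (1 + n)%nat; rewrite ehalf_plus.
    transitivity ((ehalf 1 z * ehalf 1 z) * (ehalf n z * ehalf n z))%C; [ring|].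
    rewrite IHn, <- ehalf_plus; change (1 + 1)%nat with 2%nat; rewrite ehalf_2; reflexivity.
Qed.

(** Trigonometric polynomials of degree [n / 2], with at most [n] zeros per period unless they
    vanish identically. Functions of odd index are antiperiodic, so they are functions of [z] and
    not of [e^(iz)]. *)
Definition Trig (n : nat) (f : C -> C) : Prop :=
  exists p, Pol n p /\ forall z, (f z * ehalf n z)%C = p (cexp (Ci * z)).

Lemma Trig_mult (m n : nat) (f g : C -> C) :
  Trig m f -> Trig n g -> Trig (m + n) (fun z => f z * g z)%C.
Proof.
  intros [p [Hp Ep]] [q [Hq Eq]]; exists (fun z => p z * q z)%C; split.
  - now apply Pol_mult.
  - intros z; rewrite ehalf_plus, <- Ep, <- Eq; ring.
Qed.

Lemma Trig_plus (n : nat) (f g : C -> C) :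
  Trig n f -> Trig n g -> Trig n (fun z => f z + g z)%C.
Proof.
  intros [p [Hp Ep]] [q [Hq Eq]]; exists (fun z => p z + q z)%C; split.
  - now apply Pol_plus.
  - intros z; rewrite <- Ep, <- Eq; ring.
Qed.

Lemma Trig_scal (n : nat) (c : C) (f : C -> C) : Trig n f -> Trig n (fun z => c * f z)%C.
Proof.
  intros [p [Hp Ep]]; exists (fun z => c * p z)%C; split.
  - now apply Pol_scal.
  - intros z; rewrite <- Ep; ring.
Qed.

Lemma Trig_0 (f : C -> C) : Trig 0 f -> exists c, forall z, f z = c.
Proof.
  intros [p [Hp E]]; apply Pol_0 in Hp; destruct Hp as [c Hc]; exists c.
  intros z; rewrite <- (Hc (cexp (Ci * z))), <- E, ehalf_0; ring.
Qed.

(** Only even indices contain nonzero constants. This is why constants are combined with squares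
    such as [F^2] or [F'^2], never with [F] itself. *)
Lemma Trig_const (n : nat) (c : C) : Trig (n + n) (fun _ => c).
Proof.
  exists (fun z => c * z ^ n)%C; split.
  - apply Pol_scal.
    assert (Hpow : forall k m, Pol (m + k) (fun z => z ^ k)%C).
    { induction k; intros m; [apply (Pol_const _ 1)|].
      rewrite Nat.add_succ_r; apply (Pol_S (m + k) 0 (fun z => z ^ k)%C); auto; intros; simpl; ring. }
    apply Hpow.
  - intros z; rewrite ehalf_plus, ehalf_sqr; reflexivity.
Qed.

Definition hsin (y : R) (z : C) : C := csin ((z - RtoC y) * RtoC (/ 2)).

(** The chord formula: up to factors without zeros, [hsin y] is [e^(iz) - e^(iy)], so it plays the
    part of a linear factor. *)
Lemma hsin_chord (y : R) (z : C) :
  (hsin y z * (2 * Ci * cexp (Ci * RtoC (y / 2)) * ehalf 1 z) = cexp (Ci * z) - cexp (Ci * RtoC y))%C.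
Proof.
  unfold hsin, csin.
  set (u := cexp (Ci * RtoC (y / 2))).
  assert (E1 : (cexp (Ci * ((z - RtoC y) * RtoC (/ 2))) * u = ehalf 1 z)%C).
  { unfold u, ehalf; rewrite <- cexp_plus; f_equal; simpl.
    unfold Rdiv; rewrite Rmult_1_l, RtoC_mult; ring. }
  assert (E2 : (cexp (Ci * - ((z - RtoC y) * RtoC (/ 2))) * ehalf 1 z = u)%C).
  { unfold u, ehalf; rewrite <- cexp_plus; f_equal; simpl.
    unfold Rdiv; rewrite Rmult_1_l, RtoC_mult; ring. }
  assert (E3 : (u * u = cexp (Ci * RtoC y))%C).
  { unfold u; rewrite <- cexp_plus; f_equal.
    replace (RtoC y) with (RtoC (y / 2) + RtoC (y / 2))%C by (rewrite <- RtoC_plus; f_equal; field); ring. }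
  assert (E4 : (ehalf 1 z * ehalf 1 z = cexp (Ci * z))%C).
  { rewrite ehalf_sqr; simpl; ring. }
  set (a := cexp (Ci * ((z - RtoC y) * RtoC (/ 2)))) in *.
  set (b := cexp (Ci * - ((z - RtoC y) * RtoC (/ 2)))) in *.
  transitivity ((a * u) * ehalf 1 z - (b * ehalf 1 z) * u)%C; [cfield|].
  rewrite E1, E2, E3, E4; reflexivity.
Qed.

Lemma Trig_hsin (y : R) : Trig 1 (hsin y).
Proof.
  set (u := (2 * Ci * cexp (Ci * RtoC (y / 2)))%C).
  assert (Hu : u <> 0).
  { unfold u; repeat apply Cmult_neq_0; [apply two_neq0|apply Ci_nz|apply cexp_neq0]. }
  exists (fun z => / u * (- cexp (Ci * RtoC y) + z * 1))%C; split.
  - apply Pol_scal; eapply (Pol_S 0 _ (fun _ => RtoC 1)); [apply Pol_const|reflexivity].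
  - intros z; generalize (hsin_chord y z); fold u; intros E.
    transitivity (/ u * (hsin y z * (u * ehalf 1 z)))%C; [field; auto|].
    rewrite E; ring.
Qed.

Lemma Trig_factor (n : nat) (f : C -> C) (y : R) :
  Trig (S n) f -> f (RtoC y) = 0 ->
  exists g, Trig n g /\ forall z, f z = (hsin y z * g z)%C.
Proof.
  intros [p [Hp Ep]] Hy.
  destruct (Pol_division n (cexp (Ci * RtoC y)) p Hp) as [q [Hq Eq]].
  rewrite <- Ep, Hy in Eq.
  set (u := (2 * Ci * cexp (Ci * RtoC (y / 2)))%C).
  exists (fun z => u * q (cexp (Ci * z)) / ehalf n z)%C; split.
  - exists (fun z => u * q z)%C; split; [now apply Pol_scal|].
    intros z; field; apply ehalf_neq0.
  - intros z; assert (E := Ep z); rewrite Eq, <- hsin_chord in E; fold u in E.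
    change (S n) with (1 + n)%nat in E; rewrite ehalf_plus in E.
    assert (H1 := ehalf_neq0 1 z); assert (Hn := ehalf_neq0 n z).
    transitivity (f z * (ehalf 1 z * ehalf n z) / (ehalf 1 z * ehalf n z))%C; [field; auto|].
    rewrite E; field; auto.
Qed.

Lemma Trig_diff (n : nat) (f : C -> C) : Trig n f ->
  exists df, Trig n df /\ forall z, cdiff f z (df z).
Proof.
  intros [p [Hp Ep]]; destruct (Pol_diff n p Hp) as [dp [Hd Hdp]].
  set (c := (Ci * RtoC (INR n / 2))%C).
  assert (He : forall z, cdiff (fun w => cexp (- c * w))%C z (cexp (- c * z) * (- c * 1))%C).
  { intros z; apply (cdiff_comp cexp); [apply cdiff_cexp|apply cdiff_scal, cdiff_id]. }
  assert (Hi : forall z, (cexp (- c * z) * ehalf n z = 1)%C).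
  { intros z; unfold ehalf; rewrite <- cexp_plus, <- cexp_0; f_equal; unfold c; ring. }
  exists (fun z => (Ci * (cexp (Ci * z) * dp (cexp (Ci * z))) + - c * p (cexp (Ci * z))) * cexp (- c * z))%C.
  split.
  - exists (fun z => Ci * (z * dp z) + - c * p z)%C; split.
    + apply Pol_plus; apply Pol_scal; auto.
    + intros z; rewrite <- Cmult_assoc, Hi; ring.
  - intros z; apply cdiff_ext with (fun w => p (cexp (Ci * w)) * cexp (- c * w))%C.
    + intros w; rewrite <- Ep, <- Cmult_assoc, (Cmult_comm (ehalf n w)), Hi; ring.
    + eapply cdiff_eq; [apply cdiff_mult|].
      * apply (cdiff_comp p (fun w => cexp (Ci * w))); [apply Hd|].
        apply (cdiff_comp cexp (fun w => Ci * w)%C); [apply cdiff_cexp|apply cdiff_scal, cdiff_id].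
      * apply He.
      * cbv beta; ring.
Qed.

Lemma Cmod_cexp_real (t : R) : Cmod (cexp (Ci * RtoC t)) = 1.
Proof. rewrite Cmod_cexp; reim; replace (0 * t - 1 * 0) with 0 by ring; apply exp_0. Qed.

(** With [g], the average of [f] and [g] is a trigonometric polynomial of the same degree that
    equals [Re f] on the real line. *)
Lemma Trig_star (n : nat) (f : C -> C) : Trig n f ->
  exists g, Trig n g /\ forall t : R, g (RtoC t) = Cconj (f (RtoC t)).
Proof.
  intros [p [Hp Ep]]; destruct (Pol_star n p Hp) as [q [Hq Eq]].
  exists (fun z => q (cexp (Ci * z)) / ehalf n z)%C; split.
  - exists q; split; auto; intros z; field; apply ehalf_neq0.
  - intros t; rewrite Eq by apply Cmod_cexp_real.
    rewrite <- Ep, Cmult_conj, <- ehalf_sqr.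
    assert (E : (ehalf n (RtoC t) * Cconj (ehalf n (RtoC t)) = 1)%C).
    { rewrite <- Cmod2_conj; unfold ehalf; rewrite <- Cmult_assoc, <- RtoC_mult, Cmod_cexp_real, pow1.
      reflexivity. }
    assert (Hn := ehalf_neq0 n (RtoC t)).
    transitivity (Cconj (f (RtoC t)) * (ehalf n (RtoC t) * Cconj (ehalf n (RtoC t))))%C;
      [field; auto|rewrite E; ring].
Qed.

Lemma hsin_real (y t : R) : hsin y (RtoC t) = RtoC (sin ((t - y) / 2)).
Proof.
  unfold hsin; rewrite <- RtoC_minus, <- RtoC_mult; apply csin_real.
Qed.

Lemma sin_half_neq0 (s t : R) : s <> t -> Rabs (s - t) < 2 * PI -> sin ((s - t) / 2) <> 0.
Proof.
  intros Hn Hl; apply Rabs_def2 in Hl.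
  destruct (Rtotal_order s t) as [H|[H|H]]; [|lra|].
  - replace ((s - t) / 2) with (- ((t - s) / 2)) by field; rewrite sin_neg.
    assert (0 < sin ((t - s) / 2)) by (apply sin_gt_0; lra); lra.
  - assert (0 < sin ((s - t) / 2)) by (apply sin_gt_0; lra); lra.
Qed.

Lemma cosh_ge_1 (x : R) : 1 <= cosh x.
Proof.
  unfold cosh; assert (Hp := exp_pos x); assert (E : exp x * exp (- x) = 1).
  { rewrite <- exp_plus, Rplus_opp_r; apply exp_0. }
  assert (Hm := exp_pos (- x)).
  assert (0 <= (exp x - exp (- x)) ^ 2) by apply pow2_ge_0.
  apply Rmult_le_reg_r with 2; [lra|]; field_simplify; nra.
Qed.

Lemma sinh_pos (x : R) : 0 < x -> 0 < sinh x.
Proof. intros; rewrite <- sinh_0; now apply sinh_lt. Qed.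

Lemma sinh_eq0 (x : R) : sinh x = 0 -> x = 0.
Proof.
  intros H; destruct (Rtotal_order x 0) as [K|[K|K]]; auto.
  - apply sinh_lt in K; rewrite sinh_0 in K; lra.
  - apply sinh_pos in K; lra.
Qed.

Lemma csin_zero_real (w : C) : csin w = 0 -> Im w = 0.
Proof.
  intros H; assert (H1 := Re_csin w); assert (H2 := Im_csin w).
  rewrite H in H1, H2; autorewrite with reim in H1, H2.
  assert (Hc := cosh_ge_1 (Im w)).
  assert (sin (Re w) = 0) by nra.
  assert (Hcs := sin2_cos2 (Re w)); rewrite H0 in Hcs; unfold Rsqr in Hcs.
  apply sinh_eq0; destruct (Rmult_integral _ _ (eq_sym H2)) as [K|K]; auto.
  rewrite K in Hcs; lra.
Qed.

Lemma hsin_neq0_upper (y : R) (z : C) : Im z <> 0 -> hsin y z <> 0.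
Proof.
  intros H E; apply csin_zero_real in E; autorewrite with reim in E; lra.
Qed.

Lemma cdiff_hsin (y : R) (z : C) :
  cdiff (hsin y) z (ccos ((z - RtoC y) * RtoC (/ 2)) * RtoC (/ 2))%C.
Proof.
  unfold hsin; eapply cdiff_eq.
  - apply (cdiff_comp csin (fun w => (w - RtoC y) * RtoC (/ 2))%C); [apply cdiff_csin|].
    apply cdiff_mult; [apply cdiff_minus; [apply cdiff_id|apply cdiff_const]|apply cdiff_const].
  - cbv beta; ring.
Qed.

Lemma hsin_self (y : R) : hsin y (RtoC y) = 0.
Proof. rewrite hsin_real; f_equal; rewrite Rminus_diag; unfold Rdiv; rewrite Rmult_0_l; apply sin_0. Qed.

Lemma cdiff_hsin_self (y : R) : cdiff (hsin y) (RtoC y) (RtoC (/ 2)).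
Proof.
  eapply cdiff_eq; [apply cdiff_hsin|].
  rewrite <- RtoC_minus, <- RtoC_mult, ccos_real, Rminus_diag, Rmult_0_l, cos_0; ring.
Qed.

(** * Division by sine factors and counting of zeros *)

Fixpoint sprod (r : nat -> R) (m : nat) (z : C) : C :=
  match m with O => RtoC 1 | S m => (sprod r m z * hsin (r m) z)%C end.

Lemma sprod_neq0 (r : nat -> R) (m : nat) (z : C) :
  (forall k, (k < m)%nat -> hsin (r k) z <> 0) -> sprod r m z <> 0.
Proof.
  induction m; intros H; simpl; [apply RtoC_neq0; lra|].
  apply Cmult_neq_0; auto.
Qed.

Lemma Trig_sprod (r : nat -> R) (m : nat) : Trig m (sprod r m).
Proof.
  induction m; simpl.
  - apply (Trig_const 0 1).
  - replace (S m) with (m + 1)%nat by lia; apply Trig_mult; auto; apply Trig_hsin.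
Qed.

Lemma Trig_divide_simple (m : nat) : forall N f r, Trig (m + N) f ->
  (forall k, (k < m)%nat -> f (RtoC (r k)) = 0) ->
  (forall j k, (j < k < m)%nat -> hsin (r j) (RtoC (r k)) <> 0) ->
  exists g, Trig N g /\ forall z, f z = (sprod r m z * g z)%C.
Proof.
  induction m; intros N f r Hf Hz Hd; simpl.
  - exists f; split; auto; intros; ring.
  - destruct (IHm (S N) f r) as [g [Hg Eg]]; auto.
    { now rewrite Nat.add_succ_r. }
    { intros j k Hjk; apply Hd; lia. }
    assert (Hgr : g (RtoC (r m)) = 0).
    { assert (E := Hz m ltac:(lia)); rewrite Eg in E; apply Cmult_eq0 in E; destruct E as [E|E]; auto.
      exfalso; revert E; apply sprod_neq0; intros k Hk; apply Hd; lia. }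
    destruct (Trig_factor N g (r m) Hg Hgr) as [h [Hh Eh]].
    exists h; split; auto; intros z; rewrite Eg, Eh; ring.
Qed.

(** After one factor is split off from [g], the derivative of [f] at [c] is [q(c) / 2] times the
    value of the quotient [h] at [c]. As it vanishes, [h] can be divided once more. *)
Lemma Trig_double_zero (N : nat) (q g f : C -> C) (c : R) :
  (exists l, cdiff q (RtoC c) l) -> q (RtoC c) <> 0 -> Trig (S (S N)) g ->
  (forall z, f z = q z * g z)%C -> f (RtoC c) = 0 -> cdiff f (RtoC c) 0 ->
  exists h, Trig N h /\ forall z, g z = (hsin c z * hsin c z * h z)%C.
Proof.
  intros [l Hl] Hq Hg Ef H0 H1.
  assert (Hg0 : g (RtoC c) = 0).
  { rewrite Ef in H0; apply Cmult_eq0 in H0; tauto. }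
  destruct (Trig_factor _ g c Hg Hg0) as [h [Hh Eh]].
  destruct (Trig_diff _ h Hh) as [dh [_ Hdh]].
  assert (Hh0 : h (RtoC c) = 0).
  { assert (Hd : cdiff f (RtoC c)
      (l * (hsin c (RtoC c) * h (RtoC c)) + q (RtoC c) * (RtoC (/ 2) * h (RtoC c) + hsin c (RtoC c) * dh (RtoC c)))%C).
    { apply cdiff_ext with (fun z => q z * (hsin c z * h z))%C.
      - intros w; now rewrite Ef, Eh.
      - apply (cdiff_mult q (fun z => hsin c z * h z)%C); auto.
        apply cdiff_mult; auto; apply cdiff_hsin_self. }
    assert (E := cdiff_unique _ _ _ _ H1 Hd); rewrite hsin_self in E.
    assert (E' : (q (RtoC c) * RtoC (/ 2) * h (RtoC c) = 0)%C) by (rewrite E; ring).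
    apply Cmult_eq0 in E'; destruct E' as [E'|E']; auto.
    exfalso; revert E'; apply Cmult_neq_0; auto; apply RtoC_neq0; lra. }
  destruct (Trig_factor _ h c Hh Hh0) as [k [Hk Ek]].
  exists k; split; auto; intros z; rewrite Eh, Ek; ring.
Qed.

(** Zeros are removed in pairs so that two distinct zeros and one double zero are treated uniformly;
    the points of different pairs must be distinct modulo the period. *)
Lemma Trig_divide_pairs (m : nat) : forall N f r s, Trig (m + m + N) f ->
  (forall k, (k < m)%nat -> f (RtoC (r k)) = 0 /\ f (RtoC (s k)) = 0 /\
     (hsin (r k) (RtoC (s k)) <> 0 \/ r k = s k /\ cdiff f (RtoC (r k)) 0)) ->
  (forall j k, (j < k < m)%nat -> hsin (r j) (RtoC (r k)) <> 0 /\ hsin (r j) (RtoC (s k)) <> 0 /\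
     hsin (s j) (RtoC (r k)) <> 0 /\ hsin (s j) (RtoC (s k)) <> 0) ->
  exists g, Trig N g /\ forall z, f z = (sprod r m z * sprod s m z * g z)%C.
Proof.
  induction m; intros N f r s Hf Hz Hd; simpl.
  - exists f; split; auto; intros; ring.
  - destruct (IHm (S (S N)) f r s) as [g [Hg Eg]]; auto.
    { replace (m + m + S (S N))%nat with (S m + S m + N)%nat by lia; auto. }
    { intros j k Hjk; apply Hd; lia. }
    destruct (Hz m ltac:(lia)) as [Hr [Hs Hrs]].
    assert (Qr : (sprod r m (RtoC (r m)) * sprod s m (RtoC (r m)))%C <> 0) by (apply Cmult_neq_0; apply sprod_neq0; intros k Hk; apply (Hd k m); lia).
    assert (Qs : (sprod r m (RtoC (s m)) * sprod s m (RtoC (s m)))%C <> 0) by (apply Cmult_neq_0; apply sprod_neq0; intros k Hk; apply (Hd k m); lia).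
    destruct Hrs as [Hrs|[Hrs Hc]].
    + assert (Hgr : g (RtoC (r m)) = 0).
      { rewrite Eg in Hr; apply Cmult_eq0 in Hr; tauto. }
      destruct (Trig_factor _ g (r m) Hg Hgr) as [h [Hh Eh]].
      assert (Hhs : h (RtoC (s m)) = 0).
      { rewrite Eg, Eh in Hs; apply Cmult_eq0 in Hs; destruct Hs as [Hs|Hs]; [tauto|].
        apply Cmult_eq0 in Hs; tauto. }
      destruct (Trig_factor _ h (s m) Hh Hhs) as [k [Hk Ek]].
      exists k; split; auto; intros z; rewrite Eg, Eh, Ek; ring.
    + destruct (Trig_double_zero N (fun z => sprod r m z * sprod s m z)%C g f (r m)) as [h [Hh Eh]]; auto.
      { destruct (Trig_diff _ _ (Trig_mult _ _ _ _ (Trig_sprod r m) (Trig_sprod s m))) as [dq [_ Hdq]].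
        eexists; apply Hdq. }
      exists h; split; auto; intros z; rewrite <- Hrs, Eg, Eh; ring.
Qed.

Lemma nat_choice (A : Type) (P : nat -> A -> Prop) :
  (forall k, exists x, P k x) -> exists f, forall k, P k (f k).
Proof.
  intros H; exists (fun k => proj1_sig (constructive_indefinite_description _ (H k))).
  intros k; exact (proj2_sig (constructive_indefinite_description _ (H k))).
Qed.

Lemma increasing_upto (n : nat) (y : nat -> R) :
  (forall k, (k < n)%nat -> y k < y (S k)) -> forall j k, (j < k <= n)%nat -> y j < y k.
Proof.
  intros H j k; induction k; intros Hjk; [lia|].
  destruct (Nat.eq_dec j k) as [->|Hn]; [apply H; lia|].
  apply Rlt_trans with (y k); [apply IHk; lia|apply H; lia].
Qed.

Lemma nondecreasing_upto (n : nat) (y : nat -> R) :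
  (forall k, (k < n)%nat -> y k < y (S k)) -> forall j k, (j <= k <= n)%nat -> y j <= y k.
Proof.
  intros H j k Hjk; destruct (Nat.eq_dec j k) as [->|]; [lra|].
  left; apply (increasing_upto n y H); lia.
Qed.

(** Points of two different gaps of one period differ by more than 0 and less than [2 PI]. *)
Lemma hsin_separated (n : nat) (y : nat -> R) (j k : nat) (a b : R) :
  (forall k, (k < n)%nat -> y k < y (S k)) -> y n = y 0%nat + 2 * PI ->
  (j < k < n)%nat -> y j < a < y (S j) -> y k < b < y (S k) -> hsin a (RtoC b) <> 0.
Proof.
  intros Hy Hn Hjk Ha Hb; rewrite hsin_real; apply RtoC_neq0.
  assert (Hi := nondecreasing_upto n y Hy).
  assert (y (S j) <= y k) by (apply Hi; lia).
  assert (y 0%nat <= y j) by (apply Hi; lia).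
  assert (y (S k) <= y n) by (apply Hi; lia).
  apply sin_half_neq0; [lra|]; rewrite Rabs_pos_eq; lra.
Qed.

Lemma ccont_continuity (f : C -> C) (h : R -> R) (t : R) :
  (forall t, f (RtoC t) = RtoC (h t)) -> ccont f (RtoC t) -> continuity_pt h t.
Proof.
  intros E H e He; destruct (H e He) as [d [Hd K]]; exists d; split; auto.
  intros u [_ Hu]; simpl in *; unfold Rdist in *.
  specialize (K (RtoC u)); rewrite !E, <- !RtoC_minus, !Cmod_R in K; auto.
Qed.

Lemma IVT_sign (h : R -> R) (a b : R) : continuity h -> a < b -> h a * h b < 0 ->
  exists c, a < c < b /\ h c = 0.
Proof.
  intros Hc Hab Hs.
  destruct (IVT_cor h a b Hc) as [c [Hc1 Hc2]]; [lra|lra|].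
  exists c; split; auto; split.
  - destruct Hc1 as [[K|K] _]; auto; subst; rewrite Hc2 in Hs; lra.
  - destruct Hc1 as [_ [K|K]]; auto; subst; rewrite Hc2 in Hs; lra.
Qed.

(* The two sign changes (or the double zero) in each of the [n] gaps exhaust the
   [2n] zeros per period of [f]. *)
Lemma Trig_real_rooted (n : nat) (f : C -> C) (h : R -> R) (y : nat -> R) :
  Trig (n + n) f -> (forall t, f (RtoC t) = RtoC (h t)) ->
  (forall k, (k < n)%nat -> y k < y (S k)) -> y n = y 0%nat + 2 * PI ->
  (forall k, (k <= n)%nat -> 0 < h (y k)) ->
  (forall k, (k < n)%nat -> exists c, y k < c < y (S k) /\
     (h c < 0 \/ h c = 0 /\ cdiff f (RtoC c) 0)) ->
  forall z, Im z <> 0 -> f z <> 0.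
Proof.
  intros Hf Eh Hy Hyn Hp Hc z Hz.
  assert (Hcont : continuity h).
  { intros t; apply ccont_continuity with f; auto.
    destruct (Trig_diff _ _ Hf) as [df [_ Hdf]]; eapply cdiff_ccont; apply Hdf. }
  destruct (nat_choice (R * R) (fun k p => (k < n)%nat ->
    (y k < fst p < y (S k)) /\ (y k < snd p < y (S k)) /\ h (fst p) = 0 /\ h (snd p) = 0 /\
    (hsin (fst p) (RtoC (snd p)) <> 0 \/ fst p = snd p /\ cdiff f (RtoC (fst p)) 0))) as [p Hpp].
  { intros k; destruct (Nat.lt_ge_cases k n) as [Hk|Hk]; [|exists (0, 0); lia].
    destruct (Hc k Hk) as [c [Hc1 [Hc2|[Hc2 Hc3]]]].
    - assert (P1 := Hp k ltac:(lia)); assert (P2 := Hp (S k) ltac:(lia)).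
      destruct (IVT_sign h (y k) c) as [r [Hr Er]]; [auto|lra|nra|].
      destruct (IVT_sign h c (y (S k))) as [s [Hs Es]]; [auto|lra|nra|].
      exists (r, s); simpl; intros _; repeat split; try lra.
      left; rewrite hsin_real; apply RtoC_neq0, sin_half_neq0; [lra|].
      rewrite Rabs_pos_eq by lra.
      assert (y 0%nat <= y k) by (apply (nondecreasing_upto n y); auto; lia).
      assert (y (S k) <= y n) by (apply (nondecreasing_upto n y); auto; lia).
      lra.
    - exists (c, c); simpl; intros _; repeat split; try lra; right; auto. }
  destruct (Trig_divide_pairs n 0 f (fun k => fst (p k)) (fun k => snd (p k))) as [g [Hg Eg]].
  - now rewrite Nat.add_0_r.
  - intros k Hk; destruct (Hpp k Hk) as [_ [_ [E1 [E2 H3]]]]; rewrite !Eh, E1, E2; auto.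
  - intros j k Hjk; destruct (Hpp j ltac:(lia)) as [J1 [J2 _]], (Hpp k ltac:(lia)) as [K1 [K2 _]].
    repeat split; eapply hsin_separated; eauto.
  - apply Trig_0 in Hg; destruct Hg as [c Hgc].
    rewrite Eg, Hgc; repeat apply Cmult_neq_0; try (apply sprod_neq0; intros; now apply hsin_neq0_upper).
    intros E; assert (K := Hp 0%nat ltac:(lia)).
    assert (K' := Eh (y 0%nat)); rewrite Eg, Hgc, E in K'.
    assert (h (y 0%nat) = 0) by (apply RtoC_inj; rewrite <- K'; ring); lra.
Qed.

(** One zero in each of the [n] gaps already exhausts the degree, so the quotient is a nonzero
    constant. Needed for [F'] itself. *)
Lemma Trig_real_rooted_simple (n : nat) (f : C -> C) (y c : nat -> R) :
  Trig n f -> (forall k, (k < n)%nat -> y k < y (S k)) -> y n = y 0%nat + 2 * PI ->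
  (forall k, (k < n)%nat -> y k < c k < y (S k) /\ f (RtoC (c k)) = 0) ->
  (exists w, f w <> 0) -> forall z, Im z <> 0 -> f z <> 0.
Proof.
  intros Hf Hy Hyn Hc [w Hw] z Hz.
  destruct (Trig_divide_simple n 0 f c) as [g [Hg Eg]].
  - now rewrite Nat.add_0_r.
  - intros k Hk; apply Hc; auto.
  - intros j k Hjk; eapply (hsin_separated n y j k); eauto; apply Hc; lia.
  - apply Trig_0 in Hg; destruct Hg as [d Hd].
    rewrite Eg, Hd; apply Cmult_neq_0; [apply sprod_neq0; intros; now apply hsin_neq0_upper|].
    intros E; apply Hw; rewrite Eg, Hd, E; ring.
Qed.

(** * A weighted Chebyshev problem *)

Lemma inv_INR_pos (i : nat) : 0 < / (INR i + 1).
Proof. apply Rinv_0_lt_compat; generalize (pos_INR i); lra. Qed.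

Lemma is_lim_seq_inv_INR : is_lim_seq (fun i => / (INR i + 1)) 0.
Proof.
  apply is_lim_seq_ext with (fun i => / (INR (S i))); [intros; now rewrite S_INR|].
  apply (is_lim_seq_incr_1 (fun i => / INR i)).
  replace (Finite 0) with (Rbar_inv p_infty) by reflexivity.
  apply is_lim_seq_inv; [apply is_lim_seq_INR|discriminate].
Qed.

Lemma bounded_subsequence (u : nat -> R) (a b : R) : (forall i, a <= u i <= b) ->
  exists (phi : nat -> nat) (l : R),
    filterlim phi eventually eventually /\ is_lim_seq (fun i => u (phi i)) l.
Proof.
  intros H.
  destruct (Bolzano_Weierstrass u (fun c => a <= c <= b) (compact_P3 a b) H) as [l Hl].
  (* The indices need not increase: [i <= phi i] makes [phi] tend to infinity, which is enough to
     pass to limits. *)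
  destruct (nat_choice nat (fun i p => (i <= p)%nat /\ Rabs (u p - l) < / (INR i + 1))) as [phi Hphi].
  { intros i.
    assert (Hi : 0 < / (INR i + 1)) by apply inv_INR_pos.
    destruct (Hl (disc l (mkposreal _ Hi)) i) as [p [Hp1 Hp2]].
    - exists (mkposreal _ Hi); intros y Hy; exact Hy.
    - exists p; split; auto. }
  exists phi, l; split.
  - intros P [N HN]; exists N; intros i Hi; apply HN; generalize (proj1 (Hphi i)); lia.
  - apply is_lim_seq_le_le with (u := fun i => l - / (INR i + 1)) (w := fun i => l + / (INR i + 1)).
    + intros i; destruct (Hphi i) as [_ K]; apply Rabs_def2 in K; lra.
    + replace (Finite l) with (Rbar_minus l 0) by (simpl; f_equal; ring).
      apply is_lim_seq_minus'; [apply is_lim_seq_const|apply is_lim_seq_inv_INR].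
    + replace (Finite l) with (Rbar_plus l 0) by (simpl; f_equal; ring).
      apply is_lim_seq_plus'; [apply is_lim_seq_const|apply is_lim_seq_inv_INR].
Qed.

(** * Monic real polynomials encoded by the lists of their zeros *)

Fixpoint lprod (l : list R) (u : R) : R :=
  match l with nil => 1 | v :: l => (u - v) * lprod l u end.

Lemma lprod_app (l1 l2 : list R) (u : R) : lprod (l1 ++ l2) u = lprod l1 u * lprod l2 u.
Proof. induction l1; simpl; [ring|rewrite IHl1; ring]. Qed.

Lemma lprod_perm (l1 l2 : list R) (u : R) : Permutation l1 l2 -> lprod l1 u = lprod l2 u.
Proof. induction 1; simpl; nra. Qed.

Lemma continuity_lprod (l : list R) : continuity (lprod l).
Proof.
  induction l; simpl.
  - apply continuity_const; intros x y; reflexivity.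
  - apply continuity_mult; auto; apply continuity_minus.
    + apply derivable_continuous, derivable_id.
    + apply continuity_const; intros x y; reflexivity.
Qed.

(** One zero is made convergent at a time. Pointwise convergence of the products suffices, because
    the bound to be preserved is itself pointwise. *)
Lemma lprod_subsequence (a b : R) (m : nat) : forall u : nat -> list R,
  (forall i, length (u i) = m /\ List.Forall (fun v => a <= v <= b) (u i)) ->
  exists (phi : nat -> nat) (l : list R),
    filterlim phi eventually eventually /\ length l = m /\
    forall x, is_lim_seq (fun i => lprod (u (phi i)) x) (lprod l x).
Proof.
  induction m; intros u Hu.
  - exists (fun i => i), nil; split; [apply filterlim_id|split; auto].
    intros x; apply is_lim_seq_ext with (fun _ => 1); [|apply is_lim_seq_const].
    intros i; destruct (Hu i) as [K _]; destruct (u i); [reflexivity|discriminate].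
  - destruct (bounded_subsequence (fun i => hd 0 (u i)) a b) as [phi [v [Hphi Hv]]].
    { intros i; destruct (Hu i) as [K1 K2]; destruct (u i); [discriminate|]; now inversion K2. }
    destruct (IHm (fun i => tl (u (phi i)))) as [psi [l [Hpsi [Hl HL]]]].
    { intros i; destruct (Hu (phi i)) as [K1 K2]; destruct (u (phi i)); [discriminate|].
      simpl in *; split; [lia|now inversion K2]. }
    exists (fun i => phi (psi i)), (v :: l); split; [|split].
    + eapply filterlim_comp; [apply Hpsi|apply Hphi].
    + simpl; lia.
    + intros x; simpl.
      apply is_lim_seq_ext with (fun i => (x - hd 0 (u (phi (psi i)))) * lprod (tl (u (phi (psi i)))) x).
      { intros i; destruct (Hu (phi (psi i))) as [K1 _]; destruct (u (phi (psi i))); [discriminate|reflexivity]. }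
      apply is_lim_seq_mult'; [|apply HL].
      apply is_lim_seq_minus'; [apply is_lim_seq_const|].
      apply (is_lim_seq_subseq (fun i => hd 0 (u (phi i)))); auto.
Qed.

(** Projecting a zero to the interval brings it no farther from any point of the interval. This
    confines the minimisation to a compact set of zeros. *)
Lemma lprod_clamp (a b u : R) (l : list R) : a <= u <= b ->
  Rabs (lprod (map (fun v => Rmax a (Rmin b v)) l) u) <= Rabs (lprod l u).
Proof.
  intros Hu; induction l; simpl; [lra|].
  rewrite !Rabs_mult; apply Rmult_le_compat; auto; try apply Rabs_pos.
  unfold Rmax, Rmin, Rabs; repeat destruct Rle_dec; repeat destruct Rcase_abs; lra.
Qed.

Lemma lprod_neq0_interval (l : list R) : forall c d, c < d ->
  exists c' d', c <= c' /\ c' < d' /\ d' <= d /\ forall u, c' <= u <= d' -> lprod l u <> 0.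
Proof.
  induction l as [|v l]; intros c d Hcd; simpl.
  - exists c, d; repeat split; try lra; intros; lra.
  - destruct (IHl c d Hcd) as [c1 [d1 [H1 [H2 [H3 H4]]]]].
    destruct (Rle_lt_dec v ((c1 + d1) / 2)) as [Hv|Hv].
    + exists ((c1 + 2 * d1) / 3), d1; repeat split; try lra.
      intros u Hu; apply Rmult_integral_contrapositive; split; [lra|apply H4; lra].
    + exists c1, ((2 * c1 + d1) / 3); repeat split; try lra.
      intros u Hu; apply Rmult_integral_contrapositive; split; [lra|apply H4; lra].
Qed.

Fixpoint insert_le (x : R) (l : list R) : list R :=
  match l with
  | nil => x :: nil
  | y :: t => if Rle_dec x y then x :: y :: t else y :: insert_le x t
  end.

Lemma insert_le_perm (x : R) (l : list R) : Permutation (x :: l) (insert_le x l).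
Proof.
  induction l as [|y t IH]; simpl; auto.
  destruct (Rle_dec x y); auto.
  eapply perm_trans; [apply perm_swap|]; now apply perm_skip.
Qed.

Lemma insert_le_sorted (x : R) (l : list R) :
  StronglySorted Rle l -> StronglySorted Rle (insert_le x l).
Proof.
  induction l as [|y t IH]; intros H; simpl.
  - repeat constructor.
  - inversion H as [|? ? Ht Hf]; subst; destruct (Rle_dec x y).
    + constructor; auto; constructor; auto.
      eapply Forall_impl; [|apply Hf]; simpl; intros; lra.
    + constructor; auto.
      apply Forall_forall; intros z Hz.
      apply (Permutation_in _ (Permutation_sym (insert_le_perm x t))) in Hz.
      destruct Hz as [->|Hz]; [lra|rewrite Forall_forall in Hf; auto].
Qed.

Lemma exists_sorted_perm (l : list R) : exists l', Permutation l l' /\ StronglySorted Rle l'.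
Proof.
  induction l as [|x l [l' [Hp Hs]]].
  - exists nil; split; constructor.
  - exists (insert_le x l'); split; [|now apply insert_le_sorted].
    eapply perm_trans; [apply perm_skip, Hp|apply insert_le_perm].
Qed.

Lemma StronglySorted_nth (l : list R) : StronglySorted Rle l ->
  forall k, (S k < length l)%nat -> nth k l 0 <= nth (S k) l 0.
Proof.
  induction 1 as [|x l Hs IH Hf]; simpl; intros k Hk; [lia|].
  destruct k.
  - rewrite Forall_forall in Hf; apply Hf, nth_In; lia.
  - apply IH; lia.
Qed.

Section Chebyshev.
Variables (K : R -> Prop) (w : R -> R) (a b : R) (m : nat).
Hypothesis K_closed : forall u, ~ K u -> exists d, 0 < d /\ forall s, Rabs (s - u) < d -> ~ K s.
Hypothesis K_bounded : forall u, K u -> a <= u <= b.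
Hypothesis K_interval : exists c d, c < d /\ forall u, c <= u <= d -> K u.
Hypothesis w_cont : continuity w.
Hypothesis w_pos : forall u, 0 < w u.
Hypothesis w_le1 : forall u, w u <= 1.

Definition bounded_on_K (l : list R) (B : R) : Prop :=
  forall u, K u -> Rabs (w u * lprod l u) <= B.

Lemma K_limit (u : nat -> R) (l : R) : (forall i, K (u i)) -> is_lim_seq u l -> K l.
Proof.
  intros Hu Hl; apply NNPP; intros Hn.
  destruct (K_closed l Hn) as [d [Hd H]].
  apply is_lim_seq_spec in Hl; destruct (Hl (mkposreal d Hd)) as [N HN].
  exact (H _ (HN N ltac:(lia)) (Hu N)).
Qed.

Lemma Chebyshev_minimizer : exists l I, length l = m /\ bounded_on_K l I /\
  forall l' B, length l' = m -> bounded_on_K l' B -> I <= B.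
Proof.
  destruct K_interval as [c [d [Hcd Hint]]].
  assert (Kc : K c) by (apply Hint; lra).
  assert (Hab := K_bounded c Kc).
  (* Bounds enter with the opposite sign, so that the supremum given by [completeness] is minus the
     infimum. *)
  set (S0 := fun e => exists l, length l = m /\ List.Forall (fun v => a <= v <= b) l /\ bounded_on_K l (- e)).
  destruct (completeness S0) as [I' [HI1 HI2]].
  { exists 0; intros e [l [_ [_ Hl]]]; specialize (Hl c Kc).
    generalize (Rabs_pos (w c * lprod l c)); lra. }
  (* All zeros placed at [a] give the bound [(b - a)^m], since the weight is at most 1. *)
  { exists (- (b - a) ^ m), (repeat a m); split; [apply repeat_length|split].
    - apply Forall_forall; intros v Hv; apply repeat_spec in Hv; subst; lra.
    - intros u Hu; rewrite Ropp_involutive.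
      specialize (K_bounded u Hu).
      assert (E : Rabs (lprod (repeat a m) u) <= (b - a) ^ m).
      { induction m; simpl; [rewrite Rabs_R1; lra|].
        rewrite Rabs_mult; apply Rmult_le_compat; auto; try apply Rabs_pos.
        rewrite Rabs_pos_eq; lra. }
      rewrite Rabs_mult, (Rabs_pos_eq (w u)) by (left; auto).
      rewrite <- (Rmult_1_l ((b - a) ^ m)); apply Rmult_le_compat; auto; [left; auto|apply Rabs_pos]. }
  set (I := - I').
  assert (Hmin : forall l' B, length l' = m -> bounded_on_K l' B -> I <= B).
  { intros l' B Hl' HB.
    assert (S0 (- B)).
    { exists (map (fun v => Rmax a (Rmin b v)) l'); split; [now rewrite length_map|split].
      - apply Forall_forall; intros v Hv; apply in_map_iff in Hv; destruct Hv as [v' [<- _]].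
        unfold Rmax, Rmin; repeat destruct Rle_dec; lra.
      - intros u Hu; rewrite Ropp_involutive.
        eapply Rle_trans; [|apply (HB u Hu)].
        rewrite !Rabs_mult; apply Rmult_le_compat_l; [apply Rabs_pos|].
        apply lprod_clamp; auto. }
    apply HI1 in H; unfold I; lra. }
  destruct (nat_choice (list R) (fun i l => length l = m /\ List.Forall (fun v => a <= v <= b) l /\
     bounded_on_K l (I + / (INR i + 1)))) as [L HL].
  { intros i; apply NNPP; intros Hn.
    assert (Hi : 0 < / (INR i + 1)) by apply inv_INR_pos.
    assert (I' <= I' - / (INR i + 1)); [|lra].
    apply HI2; intros e [l [H1 [H2 H3]]].
    apply Rnot_lt_le; intros Hlt; apply Hn; exists l; split; [auto|split; auto].
    intros u Hu; eapply Rle_trans; [apply H3; auto|unfold I; lra]. }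
  destruct (lprod_subsequence a b m L) as [phi [l [Hphi [Hl Hlim]]]].
  { intros i; destruct (HL i) as [H1 [H2 _]]; auto. }
  exists l, I; split; [auto|split; auto].
  intros u Hu.
  assert (Hle : Rbar_le (Rabs (w u * lprod l u)) (I + 0)).
  { apply is_lim_seq_le with (u := fun i => Rabs (w u * lprod (L (phi i)) u))
      (v := fun i => I + / (INR (phi i) + 1)).
    - intros i; destruct (HL (phi i)) as [_ [_ H3]]; auto.
    - apply (is_lim_seq_abs _ (w u * lprod l u)), is_lim_seq_mult'; [apply is_lim_seq_const|auto].
    - apply is_lim_seq_plus'; [apply is_lim_seq_const|].
      apply (is_lim_seq_subseq (fun i => / (INR i + 1))); auto; apply is_lim_seq_inv_INR. }
  simpl in Hle; lra.
Qed.

(** Finitely many zeros cannot fill the interval contained in [K]; this is where the non-degeneracy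
    of the arcs enters. *)
Lemma Chebyshev_minimum_pos (l : list R) (I : R) : bounded_on_K l I -> 0 < I.
Proof.
  intros H; destruct K_interval as [c [d [Hcd Hint]]].
  destruct (lprod_neq0_interval l c d Hcd) as [c' [d' [H1 [H2 [H3 H4]]]]].
  specialize (H c' (Hint c' ltac:(lra))); specialize (H4 c' ltac:(lra)).
  eapply Rlt_le_trans; [|apply H].
  apply Rabs_pos_lt, Rmult_integral_contrapositive; split; auto.
  apply Rgt_not_eq, w_pos.
Qed.

(* If [w * lprod l - eps * d] is admissible for arbitrarily small [eps], then [d] cannot
   push down the modulus at all the points where it is maximal. *)
Lemma Chebyshev_exchange (l : list R) (I : R) (d : R -> R) (L : nat -> list R) :
  bounded_on_K l I -> (forall l' B, length l' = m -> bounded_on_K l' B -> I <= B) ->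
  continuity d ->
  (forall i, length (L i) = m /\ forall u, w u * lprod (L i) u = w u * lprod l u - / (INR i + 1) * d u) ->
  exists u, K u /\ Rabs (w u * lprod l u) = I /\ ~ 0 < d u * (w u * lprod l u).
Proof.
  intros Hb Hmin Hd HL.
  assert (HI := Chebyshev_minimum_pos l I Hb).
  set (f := fun u => w u * lprod l u) in *.
  assert (Hf : continuity f) by (apply continuity_mult; auto; apply continuity_lprod).
  set (e := fun i => / (INR i + 1)).
  assert (He : forall i, 0 < e i).
  { intros; apply inv_INR_pos. }
  (* By minimality the perturbed product cannot stay below [I - e^2]. The slack is of second order,
     so that it cannot hide the first-order effect of [e * d]. *)
  destruct (nat_choice R (fun i u => K u /\ I - e i * e i < Rabs (f u - e i * d u))) as [u Hu].
  { intros i; apply NNPP; intros Hn; destruct (HL i) as [HL1 HL2].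
    assert (I <= I - e i * e i).
    { apply (Hmin (L i)); auto; intros u Hu; rewrite HL2.
      apply Rnot_lt_le; intros Hlt; apply Hn; exists u; auto. }
    specialize (He i); nra. }
  destruct (bounded_subsequence u a b) as [phi [us [Hphi Hus]]].
  { intros i; apply K_bounded, Hu. }
  assert (Hes : is_lim_seq (fun i => e (phi i)) 0).
  { apply (is_lim_seq_subseq e); auto; apply is_lim_seq_inv_INR. }
  assert (Hfs : is_lim_seq (fun i => f (u (phi i))) (f us)).
  { apply is_lim_seq_continuous; auto. }
  assert (Hds : is_lim_seq (fun i => d (u (phi i))) (d us)).
  { apply is_lim_seq_continuous; auto. }
  assert (Kus : K us).
  { apply K_limit with (fun i => u (phi i)); auto; intros; apply Hu. }
  exists us; split; auto; split.
  - apply Rle_antisym; [now apply Hb|].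
    assert (Hle : Rbar_le (I - 0 * 0) (Rabs (f us - 0 * d us))).
    { apply is_lim_seq_le with (u := fun i => I - e (phi i) * e (phi i))
        (v := fun i => Rabs (f (u (phi i)) - e (phi i) * d (u (phi i)))).
      - intros i; left; apply Hu.
      - apply is_lim_seq_minus'; [apply is_lim_seq_const|now apply is_lim_seq_mult'].
      - apply (is_lim_seq_abs _ (f us - 0 * d us)), is_lim_seq_minus'; auto; now apply is_lim_seq_mult'. }
    simpl in Hle; rewrite !Rmult_0_l, !Rminus_0_r in Hle; auto.
  - intros Hpos; change (w us * lprod l us) with (f us) in Hpos.
    (* Squaring [I - e^2 < |f - e d|], using [f^2 <= I^2] and dividing by [e] leaves
       [2 d f <= e (d^2 + 2 I)]; in the limit [d f <= 0]. *)
    assert (Hle : Rbar_le (2 * (d us * f us)) (0 * (d us * d us + 2 * I))); [|simpl in Hle; lra].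
    apply is_lim_seq_le_loc with (u := fun i => 2 * (d (u (phi i)) * f (u (phi i))))
      (v := fun i => e (phi i) * (d (u (phi i)) * d (u (phi i)) + 2 * I)).
    + apply is_lim_seq_spec in Hes.
      destruct (Hes (mkposreal _ (Rmin_pos _ _ Rlt_0_1 HI))) as [N HN].
      exists N; intros i Hi; specialize (HN i Hi); simpl in HN.
      rewrite Rminus_0_r, Rabs_pos_eq in HN by (left; apply He).
      assert (E1 := Rlt_le_trans _ _ _ HN (Rmin_l _ _)).
      assert (E2 := Rlt_le_trans _ _ _ HN (Rmin_r _ _)).
      destruct (Hu (phi i)) as [Ku Hlt].
      assert (Hbu := Hb _ Ku); change (Rabs (f (u (phi i))) <= I) in Hbu.
      assert (Hei := He (phi i)).
      set (ei := e (phi i)) in *; set (fi := f (u (phi i))) in *; set (di := d (u (phi i))) in *.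
      assert (P1 : (I - ei * ei) * (I - ei * ei) < (fi - ei * di) * (fi - ei * di)).
      { rewrite <- (Rabs_pos_eq (I - ei * ei)) by nra.
        assert (Q := Rsqr_lt_abs_1 (I - ei * ei) (fi - ei * di)).
        unfold Rsqr in Q; rewrite (Rabs_pos_eq (I - ei * ei)) by nra.
        rewrite (Rabs_pos_eq (I - ei * ei)) in Q by nra; auto. }
      assert (P2 : fi * fi <= I * I).
      { assert (Q := Rsqr_le_abs_1 fi I); unfold Rsqr in Q; rewrite (Rabs_pos_eq I) in Q by lra; auto. }
      apply Rmult_le_reg_l with ei; auto; nra.
    + apply (is_lim_seq_scal_l _ 2 (d us * f us)); now apply is_lim_seq_mult'.
    + apply is_lim_seq_mult'; auto; apply is_lim_seq_plus'; [now apply is_lim_seq_mult'|apply is_lim_seq_const].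
Qed.

(** Each interval has its own exchange direction: [d] times the weighted product has the sign of
    [u - v], of [v - u], or of [(u - v1) (u - v2)], up to a positive square. A maximal point where
    this is not positive must lie in the chosen interval. *)
Lemma Chebyshev_alternation : exists l I, length l = m /\ 0 < I /\ bounded_on_K l I /\
  forall k, (k <= m)%nat -> exists u, K u /\ Rabs (w u * lprod l u) = I /\
    ((0 < k)%nat -> nth (pred k) l 0 < u) /\ ((k < m)%nat -> u < nth k l 0).
Proof.
  destruct Chebyshev_minimizer as [l0 [I [Hlen0 [Hb0 Hmin]]]].
  destruct (exists_sorted_perm l0) as [l [Hp Hs]].
  assert (Hlen : length l = m) by (rewrite <- Hlen0; symmetry; now apply Permutation_length).
  assert (Hb : bounded_on_K l I).
  { intros u Hu; rewrite <- (lprod_perm _ _ u Hp); auto. }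
  assert (HI := Chebyshev_minimum_pos l I Hb).
  exists l, I; split; [auto|split; [auto|split; auto]].
  assert (Hwl : forall q, continuity (fun u => w u * lprod q u)).
  { intros q; apply continuity_mult; auto; apply continuity_lprod. }
  (* At a point of maximal modulus no factor vanishes, so strict inequalities follow from weak
     ones. *)
  assert (Hnz : forall u v r, Rabs (w u * lprod l u) = I -> lprod l u = (u - v) * r ->
     0 < (w u * r) * (w u * r)).
  { intros u v r H1 H2; apply Rsqr_pos_lt, Rmult_integral_contrapositive; split.
    - apply Rgt_not_eq, w_pos.
    - intros E; rewrite H2, E, !Rmult_0_r, Rabs_R0 in H1; lra. }
  intros k Hk; destruct (Nat.eq_dec k 0) as [->|Hk0]; destruct (Nat.eq_dec m 0) as [Hm0|Hm0].
  - destruct (Chebyshev_exchange l I (fun _ => 0) (fun _ => l)) as [u [H1 [H2 _]]]; auto.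
    { apply continuity_const; intros x y; reflexivity. }
    { intros i; split; auto; intros; ring. }
    exists u; split; [auto|split; [auto|split; lia]].
  - destruct l as [|v l']; [simpl in Hlen; lia|].
    (* Leftmost interval: the smallest zero moves to the right, which lowers the modulus everywhere
       to the right of it. *)
    destruct (Chebyshev_exchange (v :: l') I (fun u => w u * lprod l' u)
      (fun i => (v + / (INR i + 1)) :: l')) as [u [H1 [H2 H3]]]; auto.
    { intros i; split; auto; intros u; simpl; ring. }
    exists u; split; [auto|split; [auto|split; [lia|intros _]]]; simpl in *.
    specialize (Hnz u v (lprod l' u) H2 eq_refl).
    destruct (Rtotal_order u v) as [Q|[Q|Q]]; auto; exfalso.
    + rewrite Q in H2; replace (w v * ((v - v) * lprod l' v)) with 0 in H2 by ring; rewrite Rabs_R0 in H2; lra.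
    + apply H3; replace (_ * _) with ((u - v) * (w u * lprod l' u * (w u * lprod l' u))) by ring; nra.
  - lia.
  - destruct (Nat.eq_dec k m) as [->|Hkm].
    + destruct (nth_split l 0 (n := pred m) ltac:(lia)) as [l1 [l2 [El Hl1]]].
      set (v := nth (pred m) l 0) in *.
      (* Rightmost interval: the largest zero moves to the left. *)
      destruct (Chebyshev_exchange l I (fun u => - (w u * lprod (l1 ++ l2) u))
        (fun i => l1 ++ (v - / (INR i + 1)) :: l2)) as [u [H1 [H2 H3]]]; auto.
      { apply continuity_opp, Hwl. }
      { intros i; split.
        - rewrite <- Hlen, El, !length_app; reflexivity.
        - intros u; rewrite El, !lprod_app; simpl; ring. }
      assert (E : lprod l u = (u - v) * lprod (l1 ++ l2) u).
      { rewrite El, !lprod_app; simpl; ring. }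
      exists u; split; [auto|split; [auto|split; [intros _|lia]]].
      specialize (Hnz u v _ H2 E); rewrite E in H2, H3.
      set (r := lprod (l1 ++ l2) u) in *.
      destruct (Rtotal_order u v) as [Q|[Q|Q]]; auto; exfalso.
      * apply H3; replace (_ * _) with ((v - u) * (w u * r * (w u * r))) by ring; nra.
      * rewrite Q in H2; replace (w v * ((v - v) * r)) with 0 in H2 by ring; rewrite Rabs_R0 in H2; lra.
    + destruct (nth_split l 0 (n := pred k) ltac:(lia)) as [l1 [l2 [El Hl1]]].
      assert (Hle : nth (pred k) l 0 <= nth k l 0).
      { replace k with (S (pred k)) at 2 by lia; apply StronglySorted_nth; auto; lia. }
      set (v1 := nth (pred k) l 0) in *.
      assert (E2 : nth k l 0 = hd 0 l2).
      { rewrite El, app_nth2 by lia; replace (k - length l1)%nat with 1%nat by lia.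
        simpl; now destruct l2. }
      destruct l2 as [|v2 l2].
      { exfalso; rewrite El, length_app in Hlen; simpl in Hlen; lia. }
      simpl in E2; rewrite E2 in *.
      (* Two neighbouring zeros move apart: [(v1 + v2 - S) / 2] and [(v1 + v2 + S) / 2] are the
         roots of [(u - v1) (u - v2) - e] with [e = 1 / (i + 1)]. *)
      set (S := fun i : nat => sqrt ((v1 - v2) * (v1 - v2) + 4 * / (INR i + 1))).
      assert (HS : forall i, S i * S i = (v1 - v2) * (v1 - v2) + 4 * / (INR i + 1)).
      { intros i; apply sqrt_sqrt.
        assert (0 < / (INR i + 1)) by apply inv_INR_pos; nra. }
      destruct (Chebyshev_exchange l I (fun u => w u * lprod (l1 ++ l2) u)
        (fun i => l1 ++ ((v1 + v2 - S i) / 2) :: ((v1 + v2 + S i) / 2) :: l2)) as [u [H1 [H2 H3]]]; auto.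
      { intros i; split.
        - rewrite <- Hlen, El, !length_app; reflexivity.
        - intros u; rewrite El, !lprod_app; simpl.
          replace (/ (INR i + 1)) with ((S i * S i - (v1 - v2) * (v1 - v2)) / 4) by (rewrite HS; field;
             generalize (pos_INR i); lra).
          field. }
      assert (E : lprod l u = (u - v1) * ((u - v2) * lprod (l1 ++ l2) u)).
      { rewrite El, !lprod_app; simpl; ring. }
      exists u; split; [auto|split; [auto|]].
      set (r := lprod (l1 ++ l2) u) in *.
      assert (P1 := Hnz u v1 _ H2 E).
      assert (P2 : 0 < w u * r * (w u * r)).
      { apply Rsqr_pos_lt; intros E0.
        replace (w u * ((u - v2) * r)) with ((u - v2) * (w u * r)) in P1 by ring.
        rewrite E0, Rmult_0_r in P1; lra. }
      (* A strictly negative value also excludes [v1 = v2], so the zeros turn out to be simple. *)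
      assert (Hu : (u - v1) * (u - v2) < 0).
      { apply Rnot_le_lt; intros Q; rewrite E in H3, H2.
        destruct Q as [Q|Q].
        - apply H3; replace (_ * _) with ((u - v1) * (u - v2) * (w u * r * (w u * r))) by ring; nra.
        - replace (w u * ((u - v1) * ((u - v2) * r))) with (w u * (((u - v1) * (u - v2)) * r)) in H2 by ring.
          rewrite <- Q in H2; replace (w u * (0 * r)) with 0 in H2 by ring; rewrite Rabs_R0 in H2; lra. }
      split; intros _; nra.
Qed.

End Chebyshev.

(** * Arcs of the circle and the alternating function *)

Lemma expi_cos_sin (t : R) : expi t = (cos t, sin t).
Proof.
  unfold expi; apply C_ext; reim; simpl; replace (0 * t - 1 * 0) with 0 by ring;
  replace (0 * 0 + 1 * t) with t by ring; rewrite exp_0; unfold Re, Im; simpl; ring.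
Qed.

Lemma expi_period (t : R) (m : Z) : expi (t + 2 * PI * IZR m) = expi t.
Proof.
  rewrite !expi_cos_sin.
  assert (Hn : forall k s, cos (s + 2 * PI * IZR (Z.of_nat k)) = cos s /\ sin (s + 2 * PI * IZR (Z.of_nat k)) = sin s).
  { intros k s; rewrite <- INR_IZR_INZ.
    replace (s + 2 * PI * INR k) with (s + 2 * INR k * PI) by ring.
    split; [apply cos_period|apply sin_period]. }
  destruct (Z.le_gt_cases 0 m) as [H|H].
  - rewrite <- (Z2Nat.id m H); destruct (Hn (Z.to_nat m) t) as [-> ->]; reflexivity.
  - destruct (Hn (Z.to_nat (- m)) (t + 2 * PI * IZR m)) as [E1 E2].
    rewrite Z2Nat.id, opp_IZR in E1, E2 by lia.
    replace (t + 2 * PI * IZR m + 2 * PI * - IZR m) with t in E1, E2 by ring.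
    now rewrite <- E1, <- E2.
Qed.

Lemma expi_inj (s t : R) : expi s = expi t -> exists m : Z, s = t + 2 * PI * IZR m.
Proof.
  rewrite !expi_cos_sin; intros H; injection H; intros Hs Hc.
  assert (E : cos (s - t) = 1).
  { rewrite cos_minus, Hs, Hc; generalize (sin2_cos2 t); unfold Rsqr; lra. }
  replace (s - t) with (2 * ((s - t) / 2)) in E by field.
  rewrite cos_2a_sin in E.
  assert (E2 : sin ((s - t) / 2) = 0) by nra.
  apply sin_eq_0_0 in E2; destruct E2 as [k Hk]; exists k; lra.
Qed.

Lemma reduce_mod_2PI (x t : R) : exists m : Z, x <= t - 2 * PI * IZR m < x + 2 * PI.
Proof.
  assert (HP := PI_RGT_0).
  exists (Int_part ((t - x) / (2 * PI))).
  destruct (base_Int_part ((t - x) / (2 * PI))) as [H1 H2].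
  set (r := IZR (Int_part ((t - x) / (2 * PI)))) in *.
  assert (E : t - x = (t - x) / (2 * PI) * (2 * PI)) by (field; lra).
  set (q := (t - x) / (2 * PI)) in *; split; nra.
Qed.

Lemma IZR_between (r : R) (m : Z) : r = 2 * PI * IZR m -> 0 < r < 2 * PI -> False.
Proof.
  assert (HP := PI_RGT_0); intros E H; rewrite E in H.
  assert (H1 : 0 < IZR m) by nra; assert (H2 : IZR m < 1) by nra.
  apply lt_IZR in H1; apply lt_IZR in H2; lia.
Qed.

Lemma arc_complement_open (a b t : R) : a < b < a + 2 * PI -> ~ arc a b (expi t) ->
  exists d, 0 < d /\ forall s, Rabs (s - t) < d -> ~ arc a b (expi s).
Proof.
  intros Hab Hn; destruct (reduce_mod_2PI a t) as [m Hm].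
  set (p := 2 * PI * IZR m) in *.
  assert (Hb : b < t - p).
  { apply Rnot_le_lt; intros Hle; apply Hn; exists (t - p); split; [lra|].
    rewrite <- (expi_period (t - p) m); fold p; f_equal; ring. }
  (* The reduced point lies in the open gap from [b] to [a + 2 * PI]; the radius is its distance to
     the two ends. *)
  exists (Rmin (t - p - b) (a + 2 * PI - (t - p))); split; [apply Rmin_pos; lra|].
  intros s Hs [r [Hr E]]; apply expi_inj in E; destruct E as [q Hq].
  apply Rabs_def2 in Hs.
  assert (H1 := Rmin_l (t - p - b) (a + 2 * PI - (t - p))).
  assert (H2 := Rmin_r (t - p - b) (a + 2 * PI - (t - p))).
  apply (IZR_between (s - p - r) (q - m)); [rewrite minus_IZR; unfold p; rewrite Hq; ring|lra].
Qed.

Lemma arcs_complement_open (E : C -> Prop) (t : R) : finite_arc_union E -> ~ E (expi t) ->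
  exists d, 0 < d /\ forall s, Rabs (s - t) < d -> ~ E (expi s).
Proof.
  intros [arcs [_ [Hnd [_ [HE _]]]]] Ht.
  assert (H : exists d, 0 < d /\ forall s, Rabs (s - t) < d ->
    ~ exists ab, In ab arcs /\ arc (fst ab) (snd ab) (expi s)).
  { assert (Ht' : ~ exists ab, In ab arcs /\ arc (fst ab) (snd ab) (expi t)) by (now rewrite <- HE).
    clear HE Ht; induction arcs as [|ab l IH].
    - exists 1; split; [lra|]; intros s _ [ab [[] _]].
    - destruct IH as [d1 [Hd1 H1]].
      + intros; apply Hnd; now right.
      + intros [c [Hc1 Hc2]]; apply Ht'; exists c; split; auto; now right.
      + destruct (arc_complement_open (fst ab) (snd ab) t) as [d2 [Hd2 H2]].
        * apply Hnd; now left.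
        * intros Hc; apply Ht'; exists ab; split; auto; now left.
        * exists (Rmin d1 d2); split; [now apply Rmin_pos|].
          intros s Hs [c [[<-|Hc1] Hc2]].
          -- apply (H2 s); auto; eapply Rlt_le_trans; [apply Hs|apply Rmin_r].
          -- apply (H1 s); [eapply Rlt_le_trans; [apply Hs|apply Rmin_l]|]; exists c; auto. }
  destruct H as [d [Hd H]]; exists d; split; auto; intros s Hs; rewrite HE; auto.
Qed.

(** * Real sine products and the half-angle substitution *)

Fixpoint rprod (y : nat -> R) (m : nat) (t : R) : R :=
  match m with O => 1 | S m => rprod y m t * sin ((t - y m) / 2) end.

Lemma sprod_real (y : nat -> R) (m : nat) (t : R) : sprod y m (RtoC t) = RtoC (rprod y m t).
Proof. induction m; simpl; auto; rewrite IHm, hsin_real, <- RtoC_mult; reflexivity. Qed.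

(** A sine factor is negative exactly when its node lies to the right of [t]. Among the first [j]
    nodes there are [j - S k] of these, and truncated subtraction gives 0 as long as all nodes lie
    to the left. *)
Lemma rprod_sign_aux (y : nat -> R) (n : nat) : forall j k t,
  (forall i, (i < n)%nat -> y i < y (S i)) -> y n = y 0%nat + 2 * PI ->
  (k < n)%nat -> y k < t < y (S k) -> (j <= n)%nat ->
  0 < (-1) ^ (j - S k) * rprod y j t.
Proof.
  intros j k t Hy Hyn Hk Ht; assert (HP := PI_RGT_0).
  assert (Hi := nondecreasing_upto n y Hy).
  assert (H0 : y 0%nat <= y k) by (apply Hi; lia).
  assert (Hn : y (S k) <= y n) by (apply Hi; lia).
  induction j; intros Hj; simpl rprod; [simpl; lra|].
  specialize (IHj ltac:(lia)).
  destruct (Nat.lt_ge_cases k j) as [Hkj|Hkj].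
  - replace (S j - S k)%nat with (S (j - S k)) by lia.
    assert (sin ((t - y j) / 2) < 0).
    { assert (y (S k) <= y j) by (apply Hi; lia).
      assert (y j < y n) by (apply (increasing_upto n y Hy); lia).
      replace ((t - y j) / 2) with (- ((y j - t) / 2)) by field; rewrite sin_neg.
      assert (0 < sin ((y j - t) / 2)) by (apply sin_gt_0; lra); lra. }
    simpl pow; nra.
  - replace (S j - S k)%nat with 0%nat by lia; replace (j - S k)%nat with 0%nat in IHj by lia.
    assert (0 < sin ((t - y j) / 2)).
    { assert (y j <= y k) by (apply Hi; lia).
      assert (y 0%nat <= y j) by (apply Hi; lia).
      apply sin_gt_0; lra. }
    simpl in *; nra.
Qed.

Lemma rprod_sign (y : nat -> R) (n k : nat) (t : R) :
  (forall i, (i < n)%nat -> y i < y (S i)) -> y n = y 0%nat + 2 * PI ->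
  (k < n)%nat -> y k < t < y (S k) -> 0 < (-1) ^ (n - S k) * rprod y n t.
Proof. intros; apply rprod_sign_aux with n; auto. Qed.

(** Equal to [(1 + u^2)^(-1/2)], the weight that each sine factor contributes under the
    substitution. *)
Definition cosatan (u : R) : R := cos (atan u).

Lemma cosatan_pos (u : R) : 0 < cosatan u.
Proof. apply cos_gt_0; generalize (atan_bound u); lra. Qed.

Lemma sin_atan_minus (u v : R) : sin (atan u - atan v) = cosatan u * cosatan v * (u - v).
Proof.
  unfold cosatan; rewrite sin_minus.
  assert (Hu := cosatan_pos u); assert (Hv := cosatan_pos v); unfold cosatan in *.
  assert (Eu := tan_atan u); assert (Ev := tan_atan v); unfold tan in *.
  assert (Su : sin (atan u) = u * cos (atan u)) by (rewrite <- Eu at 2; field; lra).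
  assert (Sv : sin (atan v) = v * cos (atan v)) by (rewrite <- Ev at 2; field; lra).
  rewrite Su, Sv; ring.
Qed.

Fixpoint lcos (l : list R) : R :=
  match l with nil => 1 | v :: l => cosatan v * lcos l end.

Lemma lcos_pos (l : list R) : 0 < lcos l.
Proof. induction l; simpl; [lra|]; apply Rmult_lt_0_compat; auto; apply cosatan_pos. Qed.

Lemma lprod_firstn_S (l : list R) (k : nat) (u : R) : (k < length l)%nat ->
  lprod (firstn (S k) l) u = lprod (firstn k l) u * (u - nth k l 0).
Proof.
  revert k; induction l as [|v l IH]; intros k Hk; simpl in Hk; [lia|].
  destruct k; [simpl; ring|].
  change ((u - v) * lprod (firstn (S k) l) u = (u - v) * lprod (firstn k l) u * (u - nth k l 0)).
  rewrite IH by lia; ring.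
Qed.

Lemma lcos_firstn_S (l : list R) (k : nat) : (k < length l)%nat ->
  lcos (firstn (S k) l) = lcos (firstn k l) * cosatan (nth k l 0).
Proof.
  revert k; induction l as [|v l IH]; intros k Hk; simpl in Hk; [lia|].
  destruct k; [simpl; ring|].
  change (cosatan v * lcos (firstn (S k) l) = cosatan v * lcos (firstn k l) * cosatan (nth k l 0)).
  rewrite IH by lia; ring.
Qed.

(** The node [x] sits at [u = infinity] and gives only the factor
    [sin (PI / 2 + atan u) = cosatan u]. Hence [S m] nodes produce the weight to the power [S m] but
    a polynomial of degree [m]. *)
Lemma rprod_atan (x : R) (l : list R) (y : nat -> R) (u : R) (m : nat) :
  y 0%nat = x ->
  (forall k, (k < length l)%nat -> y (S k) = x + PI + 2 * atan (nth k l 0)) ->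
  (m <= length l)%nat ->
  rprod y (S m) (x + PI + 2 * atan u) =
    cosatan u ^ S m * lcos (firstn m l) * lprod (firstn m l) u.
Proof.
  intros H0 Hy; induction m; intros Hm.
  - simpl; rewrite H0.
    replace ((x + PI + 2 * atan u - x) / 2) with (PI / 2 + atan u) by field.
    rewrite sin_plus, sin_PI2, cos_PI2; unfold cosatan; ring.
  - change (rprod y (S (S m)) ?t) with (rprod y (S m) t * sin ((t - y (S m)) / 2)).
    rewrite IHm by lia; rewrite Hy by lia.
    replace ((x + PI + 2 * atan u - (x + PI + 2 * atan (nth m l 0))) / 2)
      with (atan u - atan (nth m l 0)) by field.
    rewrite sin_atan_minus, lprod_firstn_S, lcos_firstn_S by lia; simpl; ring.
Qed.

Lemma atan_inv_shift (x s : R) : x < s < x + 2 * PI ->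
  s = x + PI + 2 * atan (tan ((s - x - PI) / 2)).
Proof. intros H; rewrite atan_tan by lra; field. Qed.

Lemma arc_union_param (E : C -> Prop) (x : R) : finite_arc_union E -> ~ E (expi x) ->
  forall w, E w -> exists s, x < s < x + 2 * PI /\ w = expi s.
Proof.
  intros [arcs [_ [_ [_ [HE _]]]]] Hx w Hw.
  assert (Hw' := Hw); rewrite HE in Hw'; destruct Hw' as [ab [_ [t [_ ->]]]].
  destruct (reduce_mod_2PI x t) as [m Hm].
  assert (Et : expi t = expi (t - 2 * PI * IZR m)).
  { rewrite <- (expi_period (t - 2 * PI * IZR m) m); f_equal; ring. }
  exists (t - 2 * PI * IZR m); split; auto; split; [|lra].
  destruct Hm as [[Hm|Hm] _]; auto.
  exfalso; apply Hx; rewrite Hm, <- Et; auto.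
Qed.

Lemma arc_union_interval (E : C -> Prop) (x : R) : finite_arc_union E -> ~ E (expi x) ->
  exists a b, x < a /\ a < b /\ b < x + 2 * PI /\ forall t, a <= t <= b -> E (expi t).
Proof.
  intros [arcs [Hnil [Hnd [_ [HE _]]]]] Hx.
  destruct arcs as [|[a0 b0] l]; [congruence|].
  assert (Hab := Hnd (a0, b0) (or_introl eq_refl)); unfold nondeg_arc in Hab; simpl in Hab.
  destruct (reduce_mod_2PI x a0) as [m Hm]; set (p := 2 * PI * IZR m) in *.
  assert (HIn : forall t, a0 - p <= t <= b0 - p -> E (expi t)).
  { intros t Ht; rewrite HE; exists (a0, b0); split; [now left|]; simpl.
    exists (t + p); split; [lra|]; unfold p; now rewrite expi_period. }
  assert (H1 : x <> a0 - p) by (intros E1; apply Hx, HIn; lra).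
  assert (H2 : b0 - p < x + 2 * PI).
  { apply Rnot_le_lt; intros Hle; apply Hx.
    rewrite <- (expi_period x 1); apply HIn; lra. }
  exists (a0 - p), (b0 - p); repeat split; auto; lra.
Qed.

Lemma extremal_data (E : C -> Prop) (x : R) (n : nat) :
  finite_arc_union E -> ~ E (expi x) -> (1 <= n)%nat ->
  exists (y t : nat -> R) (A : R),
    y 0%nat = x /\ y n = y 0%nat + 2 * PI /\ (forall k, (k < n)%nat -> y k < y (S k)) /\
    (forall k, (k < n)%nat -> y k < t k < y (S k) /\ E (expi (t k)) /\
       A * rprod y n (t k) = (-1) ^ k) /\
    (forall s, x < s < x + 2 * PI -> E (expi s) -> Rabs (A * rprod y n s) <= 1).
Proof.
  intros HE Hx Hn; assert (HP := PI_RGT_0).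
  destruct n as [|m]; [lia|clear Hn].
  set (K := fun u => E (expi (x + PI + 2 * atan u))).
  assert (K_closed : forall u, ~ K u -> exists d, 0 < d /\ forall s, Rabs (s - u) < d -> ~ K s).
  { intros u Hu; destruct (arcs_complement_open E _ HE Hu) as [d [Hd H]].
    assert (Hc : continuity_pt (fun s => x + PI + 2 * atan s) u).
    { apply continuity_pt_plus; [apply continuity_pt_const; intros p q; reflexivity|].
      apply continuity_pt_scal, derivable_continuous_pt, derivable_pt_atan. }
    destruct (Hc d Hd) as [d' [Hd' H']]; exists d'; split; auto; intros s Hs.
    destruct (Req_dec s u) as [->|Hsu]; auto.
    apply H, (H' s); split; auto; split; [exact I|auto]. }
  destruct (arcs_complement_open E x HE Hx) as [d [Hd Hdx]].
  (* The arcs keep a distance from [x] on both sides of the circle, so [atan u] stays away from both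
     ends of its range and [K] is bounded. *)
  set (e := Rmin d PI / 2).
  assert (He : 0 < e /\ e < d /\ e < PI).
  { unfold e; generalize (Rmin_pos d PI Hd HP) (Rmin_l d PI) (Rmin_r d PI); lra. }
  assert (Kb : forall u, K u -> - (PI - e) / 2 <= atan u <= (PI - e) / 2).
  { intros u Hu; assert (Hb := atan_bound u); split; apply Rnot_lt_le; intros Hlt.
    - apply (Hdx (x + PI + 2 * atan u)); auto; apply Rabs_def1; lra.
    - apply (Hdx (x + PI + 2 * atan u + 2 * PI * IZR (-1))).
      + apply Rabs_def1; lra.
      + now rewrite expi_period. }
  assert (K_bounded : forall u, K u -> tan (- (PI - e) / 2) <= u <= tan ((PI - e) / 2)).
  { intros u Hu; specialize (Kb u Hu); assert (Hb := atan_bound u).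
    rewrite <- (tan_atan u); split.
    - destruct (proj1 Kb) as [H|H]; [left; apply tan_increasing; lra|rewrite <- H; lra].
    - destruct (proj2 Kb) as [H|H]; [left; apply tan_increasing; lra|rewrite <- H; lra]. }
  assert (K_interval : exists c d, c < d /\ forall u, c <= u <= d -> K u).
  { destruct (arc_union_interval E x HE Hx) as [a [b [H1 [H2 [H3 H4]]]]].
    assert (Ea := atan_inv_shift x a ltac:(lra)); assert (Eb := atan_inv_shift x b ltac:(lra)).
    exists (tan ((a - x - PI) / 2)), (tan ((b - x - PI) / 2)); split.
    - apply tan_increasing; lra.
    - assert (Hm : forall p q, p <= q -> atan p <= atan q).
      { intros p q [Hpq|Hpq]; [left; now apply atan_increasing|subst; lra]. }
      intros u Hu; apply H4; split; [rewrite Ea|rewrite Eb]; generalize (Hm _ _ (proj1 Hu)) (Hm _ _ (proj2 Hu)); lra. }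
  set (w := fun u => cosatan u ^ S m).
  assert (w_cont : continuity w).
  { intros u; apply (continuity_pt_comp cosatan (fun v => v ^ S m)).
    - apply (continuity_pt_comp atan cos); [apply derivable_continuous_pt, derivable_pt_atan|apply continuity_cos].
    - apply derivable_continuous_pt, derivable_pt_pow. }
  assert (w_pos : forall u, 0 < w u) by (intros; apply pow_lt, cosatan_pos).
  assert (w_le1 : forall u, w u <= 1).
  { intros u; unfold w; rewrite <- (pow1 (S m)); apply pow_incr; split; [left; apply cosatan_pos|apply COS_bound]. }
  destruct (Chebyshev_alternation K w _ _ m K_closed K_bounded K_interval w_cont w_pos w_le1)
    as [l [I [Hlen [HI [Hb Halt]]]]].
  (* Node 0 is [x], nodes 1 to [m] are the zeros of the minimiser, and node [S m] is [x] one period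
     later. *)
  set (y := fun k => match k with O => x | S k => if Nat.ltb k m then x + PI + 2 * atan (nth k l 0) else x + 2 * PI end).
  assert (y0 : y 0%nat = x) by reflexivity.
  assert (yS : forall k, (k < m)%nat -> y (S k) = x + PI + 2 * atan (nth k l 0)).
  { intros k Hk; simpl; apply Nat.ltb_lt in Hk; now rewrite Hk. }
  assert (ym : y (S m) = x + 2 * PI) by (simpl; now rewrite Nat.ltb_irrefl).
  assert (Hfl : firstn m l = l) by (rewrite <- Hlen; apply firstn_all).
  assert (Hr : forall u, rprod y (S m) (x + PI + 2 * atan u) = lcos l * (w u * lprod l u)).
  { intros u; rewrite (rprod_atan x l y u m), Hfl; auto; try lia; [unfold w; ring|].
    intros k Hk; apply yS; lia. }
  destruct (nat_choice R (fun k u => (k <= m)%nat -> K u /\ Rabs (w u * lprod l u) = I /\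
    ((0 < k)%nat -> nth (pred k) l 0 < u) /\ ((k < m)%nat -> u < nth k l 0))) as [u Hu].
  { intros k; destruct (Nat.le_gt_cases k m) as [Hk|Hk].
    - destruct (Halt k Hk) as [u Hu]; exists u; auto.
    - exists 0; lia. }
  set (t := fun k => x + PI + 2 * atan (u k)).
  assert (Hyt : forall k, (k < S m)%nat -> y k < t k < y (S k)).
  { intros k Hk; destruct (Hu k ltac:(lia)) as [_ [_ [H1 H2]]]; unfold t; split.
    - destruct k; [rewrite y0; generalize (atan_bound (u 0%nat)); lra|].
      rewrite yS by lia; specialize (H1 ltac:(lia)); apply atan_increasing in H1; simpl in H1; lra.
    - destruct (Nat.eq_dec k m) as [->|Hkm].
      + rewrite ym; generalize (atan_bound (u m)); lra.
      + rewrite yS by lia; specialize (H2 ltac:(lia)); apply atan_increasing in H2; lra. }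
  assert (Hyinc : forall k, (k < S m)%nat -> y k < y (S k)) by (intros k Hk; generalize (Hyt k Hk); lra).
  (* Scales the maximum on the arcs to 1; the sign makes the function positive on the first gap. *)
  set (A := (-1) ^ m / (I * lcos l)).
  assert (Hl := lcos_pos l).
  assert (HAr : forall v, Rabs (A * rprod y (S m) (x + PI + 2 * atan v)) = Rabs (w v * lprod l v) / I).
  { intros v; rewrite Hr; unfold A, Rdiv; rewrite !Rabs_mult, pow_1_abs, Rabs_inv, Rabs_mult.
    rewrite (Rabs_pos_eq I), (Rabs_pos_eq (lcos l)) by lra; field; lra. }
  exists y, t, A; split; [auto|split; [rewrite ym, y0; auto|split; [auto|split]]].
  - intros k Hk; split; [auto|split].
    + exact (proj1 (Hu k ltac:(lia))).
    + assert (Habs : Rabs (A * rprod y (S m) (t k)) = 1).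
      { unfold t; rewrite HAr; destruct (Hu k ltac:(lia)) as [_ [-> _]]; field; lra. }
      assert (Hs := rprod_sign y (S m) k (t k) Hyinc ltac:(rewrite ym, y0; auto) Hk (Hyt k Hk)).
      set (r := rprod y (S m) (t k)) in *.
      assert (Hs2 : 0 < (-1) ^ k * (A * r)).
      { unfold A; replace m with (k + (S m - S k))%nat at 1 by lia; rewrite pow_add.
        assert (E2 : (-1) ^ k * (-1) ^ k = 1) by (rewrite <- Rpow_mult_distr; replace (-1 * -1) with 1 by ring; apply pow1).
        replace ((-1) ^ k * ((-1) ^ k * (-1) ^ (S m - S k) / (I * lcos l) * r))
          with (((-1) ^ k * (-1) ^ k) * ((-1) ^ (S m - S k) * r) * / (I * lcos l)) by (unfold Rdiv; ring).
        rewrite E2, Rmult_1_l; apply Rmult_lt_0_compat; auto.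
        apply Rinv_0_lt_compat; nra. }
      assert (Hk1 : Rabs ((-1) ^ k) = 1) by apply pow_1_abs.
      revert Habs Hk1 Hs2; generalize ((-1) ^ k) (A * r); intros p q.
      unfold Rabs; destruct (Rcase_abs q), (Rcase_abs p); intros; nra.
  - intros s Hs HEs; rewrite (atan_inv_shift x s Hs) in HEs |- *.
    set (v := tan ((s - x - PI) / 2)) in *; rewrite HAr.
    specialize (Hb v HEs).
    apply Rmult_le_reg_r with I; auto; unfold Rdiv; rewrite Rmult_assoc, Rinv_l; lra.
Qed.

(** * Logarithms on the upper half-plane *)

(** A holomorphic logarithm with the data of the dominant term [e^(-imz/2)]: the change over one
    period and the asymptotics high up. Multiplied by [2i/m] they become
    [tau (z + 2 PI) = tau z + 2 PI] and the convergence of [tau z - z]. *)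
Definition has_log (m : nat) (f : C -> C) : Prop :=
  exists L, (forall z, 0 < Im z -> cexp (L z) = f z /\ (exists l, cdiff L z l) /\
      L (z + RtoC (2 * PI))%C = (L z - Ci * RtoC (PI * INR m))%C) /\
    exists kap, forall eps, 0 < eps -> exists Y, forall z, 0 < Im z -> Y < Im z ->
      Cmod (L z + Ci * z * RtoC (INR m / 2) - kap) < eps.

Lemma has_log_mult (m n : nat) (f g : C -> C) :
  has_log m f -> has_log n g -> has_log (m + n) (fun z => f z * g z)%C.
Proof.
  intros [L [HL [k Hk]]] [M [HM [j Hj]]]; exists (fun z => L z + M z)%C; split.
  - intros z Hz; destruct (HL z Hz) as [E1 [[l Hl] P1]], (HM z Hz) as [E2 [[l' Hl'] P2]].
    split; [|split].
    + now rewrite cexp_plus, E1, E2.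
    + exists (l + l')%C; now apply cdiff_plus.
    + rewrite P1, P2, plus_INR, Rmult_plus_distr_l, RtoC_plus; ring.
  - exists (k + j)%C; intros e He.
    destruct (Hk (e / 2)) as [Y1 H1]; [lra|]; destruct (Hj (e / 2)) as [Y2 H2]; [lra|].
    exists (Rmax Y1 Y2); intros z Hz HY.
    specialize (H1 z Hz (Rle_lt_trans _ _ _ (Rmax_l _ _) HY)).
    specialize (H2 z Hz (Rle_lt_trans _ _ _ (Rmax_r _ _) HY)).
    rewrite plus_INR; replace ((INR m + INR n) / 2) with (INR m / 2 + INR n / 2) by field.
    rewrite RtoC_plus.
    replace (_ - _)%C with ((L z + Ci * z * RtoC (INR m / 2) - k) + (M z + Ci * z * RtoC (INR n / 2) - j))%C by ring.
    eapply Rle_lt_trans; [apply Cmod_triangle|]; lra.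
Qed.

Lemma has_log_const (c : R) : c <> 0 -> has_log 0 (fun _ => RtoC c).
Proof.
  intros Hc.
  assert (H : exists k, cexp k = RtoC c).
  { destruct (Rlt_dec 0 c) as [H|H].
    - exists (RtoC (ln c)); apply C_ext; reim; rewrite ?cos_0, ?sin_0, exp_ln by auto; ring.
    - exists (ln (- c), PI); apply C_ext; reim; simpl; rewrite ?cos_PI, ?sin_PI, exp_ln by lra; ring. }
  destruct H as [k Hk]; exists (fun _ => k); split.
  - intros z _; split; [auto|split]; [exists 0; apply cdiff_const|simpl; ceq].
  - exists k; intros e He; exists 0; intros z _ _; simpl.
    replace (0 / 2) with 0 by field; replace (_ - _)%C with (RtoC 0) by ring; now rewrite Cmod_0.
Qed.

Lemma cexp_2PI : cexp (Ci * RtoC (2 * PI)) = 1.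
Proof.
  apply C_ext; reim; replace (0 * (2 * PI) - 1 * 0) with 0 by ring;
  replace (0 * 0 + 1 * (2 * PI)) with (2 * PI) by ring; rewrite exp_0, ?cos_2PI, ?sin_2PI; ring.
Qed.

Lemma has_log_hsin (y : R) : has_log 1 (hsin y).
Proof.
  (* A logarithm of the constant [i / 2] in the exponential form of the sine. *)
  set (k0 := ((- ln 2, PI / 2) : C)).
  assert (Hk0 : cexp k0 = (Ci / 2)%C).
  { apply C_ext.
    - reim; unfold k0; simpl; rewrite cos_PI2; unfold Re; simpl; field.
    - reim; unfold k0; simpl; rewrite sin_PI2, exp_Ropp, exp_ln by lra; unfold Im; simpl; field. }
  set (q := fun z : C => cexp (Ci * (z - RtoC y))).
  assert (Hq : forall z, Cmod (q z) = exp (- Im z)).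
  { intros z; unfold q; rewrite Cmod_cexp; f_equal; reim; ring. }
  (* In the upper half-plane [|q| < 1], so [1 - q] stays in the domain of [clog]. *)
  assert (Hq1 : forall z, 0 < Im z -> 0 < Re (1 - q z)%C).
  { intros z Hz; reim; assert (H := re_le_Cmod (q z)); rewrite Hq in H.
    assert (exp (- Im z) < 1) by (rewrite <- exp_0; apply exp_increasing; lra).
    apply Rabs_le_between in H; lra. }
  exists (fun z => k0 + - (Ci * ((z - RtoC y) * RtoC (/ 2))) + clog (1 - q z))%C; split.
  - intros z Hz; split; [|split].
    + rewrite !cexp_plus, cexp_clog, Hk0 by auto.
      unfold hsin; rewrite csin_exp_form; f_equal; f_equal; unfold q; f_equal.
      rewrite RtoC_inv by lra; cfield.
    + eexists; apply cdiff_plus.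
      * apply cdiff_plus; [apply cdiff_const|].
        apply cdiff_opp, cdiff_scal, cdiff_mult; [|apply cdiff_const].
        apply cdiff_minus; [apply cdiff_id|apply cdiff_const].
      * apply (cdiff_comp clog (fun w => 1 - q w)%C); [apply cdiff_clog; auto|].
        apply cdiff_minus; [apply cdiff_const|]; unfold q.
        apply (cdiff_comp cexp (fun w => Ci * (w - RtoC y))%C); [apply cdiff_cexp|].
        apply cdiff_scal, cdiff_minus; [apply cdiff_id|apply cdiff_const].
    + assert (E : q (z + RtoC (2 * PI))%C = q z).
      { unfold q; replace (Ci * (z + RtoC (2 * PI) - RtoC y))%C
          with (Ci * (z - RtoC y) + Ci * RtoC (2 * PI))%C by ring.
        rewrite cexp_plus, cexp_2PI; ring. }
      rewrite E; simpl; rewrite Rmult_1_r, RtoC_mult, RtoC_inv by lra; cfield.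
  - exists (k0 + Ci * RtoC (y / 2))%C; intros e He.
    destruct (ccont_clog 1 ltac:(simpl; lra) e He) as [d [Hd H]].
    exists (- ln d); intros z Hz HY.
    assert (Hqd : Cmod (q z) < d).
    { rewrite Hq, <- (exp_ln d) by auto; apply exp_increasing; lra. }
    specialize (H (1 - q z)%C).
    replace (1 - q z - 1)%C with (- q z)%C in H by ring; rewrite Cmod_opp in H; specialize (H Hqd).
    replace (clog 1) with (RtoC 0) in H.
    2: { unfold clog; rewrite Cmod_1, ln_1; simpl; replace (0 / 1) with 0 by field; now rewrite atan_0. }
    replace (clog (1 - q z) - 0)%C with (clog (1 - q z)) in H by ring.
    replace (_ - _)%C with (clog (1 - q z)); auto.
    simpl; unfold Rdiv; rewrite Rmult_1_l, RtoC_mult; ring.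
Qed.

Lemma has_log_sprod (y : nat -> R) (m : nat) : has_log m (sprod y m).
Proof.
  induction m; simpl.
  - apply has_log_const; lra.
  - replace (S m) with (m + 1)%nat by lia; apply has_log_mult; auto; apply has_log_hsin.
Qed.

(** * The half-plane and the fibres of [ccos] *)

(** Projecting on the directions 1 and [-i] along the axis: the first gives the derivative of [h],
    the second differentiates the constant 0. *)
Lemma real_derivative (f df : C -> C) (h : R -> R) :
  (forall t, f (RtoC t) = RtoC (h t)) -> (forall z, cdiff f z (df z)) ->
  forall t, is_derive h t (Re (df (RtoC t))) /\ df (RtoC t) = RtoC (Re (df (RtoC t))).
Proof.
  intros Hf Hd t.
  assert (E : forall u : R, (0 + RtoC u * 1)%C = RtoC u) by (intros; ring).
  assert (H1 := cdiff_segment f 1 0 1 (df (RtoC t)) t).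
  assert (H2 := cdiff_segment f (- Ci) 0 1 (df (RtoC t)) t).
  rewrite E in H1, H2; specialize (H1 (Hd _)); specialize (H2 (Hd _)).
  split.
  - replace (Re (df (RtoC t))) with (Re (1 * (df (RtoC t) * 1))%C) by (f_equal; ring).
    eapply is_derive_ext; [|apply H1]; intros u; simpl.
    rewrite E, Hf; reim; ring.
  - assert (H3 : is_derive (fun _ : R => 0) t (Re (- Ci * (df (RtoC t) * 1))%C)).
    { eapply is_derive_ext; [|apply H2]; intros u; simpl; rewrite E, Hf; reim; ring. }
    apply is_derive_unique in H3; rewrite Derive_const in H3; autorewrite with reim in H3.
    apply C_ext; reim; lra.
Qed.

Lemma upper_open (z w : C) : 0 < Im z -> Cmod (w - z) < Im z -> 0 < Im w.
Proof.
  intros Hz Hw; assert (H := Im_le_Cmod (w - z)).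
  assert (H' : Rabs (Im (w - z)) < Im z) by lra; apply Rabs_def2 in H'; rewrite Im_minus in H'; lra.
Qed.

Lemma cosh_surj (M : R) : 1 <= M -> exists h, 0 <= h /\ cosh h = M.
Proof.
  intros HM; set (s := sqrt (M * M - 1)).
  assert (Hs : 0 <= s) by apply sqrt_pos.
  assert (Hs2 : s * s = M * M - 1) by (apply sqrt_sqrt; nra).
  exists (ln (M + s)); split.
  - rewrite <- ln_1; destruct (Req_dec (M + s) 1) as [->|]; [lra|left; apply ln_increasing; lra].
  - unfold cosh; rewrite exp_Ropp, exp_ln by lra.
    assert (E : / (M + s) = M - s) by (apply Rmult_eq_reg_l with (M + s); [rewrite Rinv_r; nra|lra]).
    rewrite E; field.
Qed.

Lemma cosh_sqr_sinh (x : R) : cosh x * cosh x = 1 + sinh x * sinh x.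
Proof.
  assert (E : exp x * exp (- x) = 1) by (rewrite <- exp_plus, Rplus_opp_r; apply exp_0).
  rewrite <- E; unfold cosh, sinh; field.
Qed.

Lemma cosh_inj_le (a b : R) : 0 <= a -> 0 <= b -> cosh a <= cosh b -> a <= b.
Proof.
  intros Ha Hb H; apply Rnot_lt_le; intros Hlt.
  assert (E := cosh_sqr_sinh).
  assert (sinh b < sinh a) by (now apply sinh_lt).
  assert (0 <= sinh b) by (destruct Hb as [Hb|<-]; [left; now apply sinh_pos|rewrite sinh_0; lra]).
  assert (Ea := E a); assert (Eb := E b); generalize (cosh_ge_1 a) (cosh_ge_1 b); nra.
Qed.

Lemma ccos_minus_ccos (g p : C) :
  (ccos g - ccos p = - RtoC 2 * (csin ((g + p) * RtoC (/ 2)) * csin ((g - p) * RtoC (/ 2))))%C.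
Proof.
  assert (Eh : (RtoC (/ 2) + RtoC (/ 2) = 1)%C) by (rewrite <- RtoC_plus; f_equal; field).
  set (a := (Ci * ((g + p) * RtoC (/ 2)))%C); set (b := (Ci * ((g - p) * RtoC (/ 2)))%C).
  assert (E1 : (Ci * g = a + b)%C).
  { transitivity (Ci * g * (RtoC (/ 2) + RtoC (/ 2)))%C; [rewrite Eh; ring|unfold a, b; ring]. }
  assert (E2 : (Ci * p = a + - b)%C).
  { transitivity (Ci * p * (RtoC (/ 2) + RtoC (/ 2)))%C; [rewrite Eh; ring|unfold a, b; ring]. }
  unfold ccos, csin.
  replace (Ci * - g)%C with (- a + - b)%C by (transitivity (- (Ci * g))%C; [rewrite E1|]; ring).
  replace (Ci * - p)%C with (- a + b)%C by (transitivity (- (Ci * p))%C; [rewrite E2|]; ring).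
  replace (Ci * - ((g + p) * RtoC (/ 2)))%C with (- a)%C by (unfold a; ring).
  replace (Ci * - ((g - p) * RtoC (/ 2)))%C with (- b)%C by (unfold b; ring).
  fold a b; rewrite E1, E2, !cexp_plus, RtoC_inv by lra.
  apply Ceq_minus; set (u := cexp a); set (u' := cexp (- a)); set (v := cexp b); set (v' := cexp (- b)).
  replace (_ - _)%C with ((Ci * Ci + 1) * (u - u') * (v - v') / (2 * Ci * Ci))%C by cfield.
  rewrite Ci2; cfield.
Qed.

Lemma ccos_real_preimage (f : R) : exists a h, 0 <= h /\ ccos ((a, h) : C) = RtoC f.
Proof.
  destruct (Rle_dec 1 f) as [H1|H1].
  - destruct (cosh_surj f H1) as [h [Hh E]]; exists 0, h; split; auto.
    apply C_ext; rewrite ?Re_ccos, ?Im_ccos; simpl; rewrite ?cos_0, ?sin_0, ?E; ring.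
  - destruct (Rle_dec f (-1)) as [H2|H2].
    + destruct (cosh_surj (- f)) as [h [Hh E]]; [lra|]; exists PI, h; split; auto.
      apply C_ext; rewrite ?Re_ccos, ?Im_ccos; simpl; rewrite ?cos_PI, ?sin_PI, ?E; ring.
    + exists (acos f), 0; split; [lra|].
      apply C_ext; rewrite ?Re_ccos, ?Im_ccos; simpl; rewrite ?cosh_0, ?sinh_0, ?cos_acos by lra; ring.
Qed.

(** From [|sin w|^2 = sin^2 (Re w) + sinh^2 (Im w)]: both terms must be small, and a small real sine
    means being close to a multiple of [PI]. *)
Lemma csin_small (e : R) : 0 < e <= 1 -> exists d, 0 < d /\ forall w, Cmod (csin w) < d ->
  Rabs (Im w) < e /\ exists m : Z, Rabs (Re w - PI * IZR m) < e.
Proof.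
  intros He; assert (HP := PI2_1).
  set (d := Rmin (sin e) (sinh e)).
  assert (Hs : 0 < sin e) by (apply sin_gt_0; lra).
  assert (Hsh : 0 < sinh e) by (apply sinh_pos; lra).
  exists d; split; [now apply Rmin_pos|]; intros w Hw.
  assert (Hsq : Cmod (csin w) ^ 2 = sin (Re w) ^ 2 + sinh (Im w) ^ 2).
  { rewrite Cmod2_alt, Re_csin, Im_csin.
    assert (E1 := sin2_cos2 (Re w)); unfold Rsqr in E1.
    assert (E2 : cosh (Im w) ^ 2 = 1 + sinh (Im w) ^ 2).
    { generalize (cosh_sqr_sinh (Im w)); intros E; simpl; lra. }
    rewrite !Rpow_mult_distr, E2; nra. }
  assert (Hd0 := Cmod_ge_0 (csin w)).
  assert (Hd1 := Rlt_le_trans _ _ _ Hw (Rmin_l _ _)).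
  assert (Hd2 := Rlt_le_trans _ _ _ Hw (Rmin_r _ _)).
  split.
  - apply Rnot_le_lt; intros Hle.
    assert (sinh e <= Rabs (sinh (Im w))).
    { unfold Rabs at 1 in Hle; destruct (Rcase_abs (Im w)) as [Hn|Hn].
      - replace (Im w) with (- - Im w) by ring.
        assert (Eo : sinh (- - Im w) = - sinh (- Im w)) by (unfold sinh; rewrite Ropp_involutive; field).
        rewrite Eo, Rabs_Ropp; eapply Rle_trans; [|apply Rle_abs].
        destruct Hle as [H|H]; [left; now apply sinh_lt|rewrite H; lra].
      - eapply Rle_trans; [|apply Rle_abs].
        destruct Hle as [H|H]; [left; now apply sinh_lt|rewrite H; lra]. }
    rewrite <- (pow2_abs (sinh (Im w))) in Hsq; nra.
  - set (m := Int_part ((Re w + PI / 2) / PI)).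
    destruct (base_Int_part ((Re w + PI / 2) / PI)) as [B1 B2]; fold m in B1, B2.
    exists m; set (r := Re w - PI * IZR m).
    assert (Er : (Re w + PI / 2) / PI * PI = Re w + PI / 2) by (field; lra).
    assert (Hr : - (PI / 2) <= r <= PI / 2) by (unfold r; nra).
    assert (Esin : sin (Re w) ^ 2 = sin r ^ 2).
    { replace (Re w) with (r + PI * IZR m) by (unfold r; ring).
      rewrite sin_plus.
      assert (S0 : sin (PI * IZR m) = 0) by (rewrite Rmult_comm; apply sin_eq_0_1; eexists; reflexivity).
      assert (C0 := sin2_cos2 (PI * IZR m)); rewrite S0 in *; unfold Rsqr in C0.
      replace (sin r * cos (PI * IZR m) + cos r * 0) with (sin r * cos (PI * IZR m)) by ring.
      rewrite Rpow_mult_distr; replace (cos (PI * IZR m) ^ 2) with 1 by nra; ring. }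
    apply Rnot_le_lt; intros Hle.
    assert (sin e <= Rabs (sin r)).
    { unfold Rabs at 1 in Hle; destruct (Rcase_abs r) as [Hn|Hn].
      - replace r with (- - r) by ring; rewrite sin_neg, Rabs_Ropp; eapply Rle_trans; [|apply Rle_abs].
        apply sin_incr_1; lra.
      - eapply Rle_trans; [|apply Rle_abs]; apply sin_incr_1; lra. }
    rewrite Esin, <- (pow2_abs (sin r)) in Hsq; nra.
Qed.

(** The fibre of cosine over a real value lies, in the closed upper half-plane, on one horizontal
    line and is discrete. The uniform version holds because a difference of cosines is a product of
    two sines. *)
Lemma ccos_near (f : R) : exists a h, 0 <= h /\ forall e, 0 < e <= 1 -> exists d, 0 < d /\
  forall g, 0 <= Im g -> Cmod (ccos g - RtoC f) < d ->
    Rabs (Im g - h) < e /\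
    exists m : Z, Rabs (Re g - a - 2 * PI * IZR m) < e \/ Rabs (Re g + a - 2 * PI * IZR m) < e.
Proof.
  destruct (ccos_real_preimage f) as [a [h [Hh Ep]]]; exists a, h; split; auto.
  intros e He; destruct (csin_small (e / 2)) as [d [Hd H]]; [lra|].
  (* If the product of the two sines is below [d^2], one of them is below [d]. *)
  exists (2 * (d * d)); split; [nra|]; intros g Hg Hlt.
  set (p := ((a, h) : C)) in *; rewrite <- Ep, ccos_minus_ccos, !Cmod_mult, Cmod_opp, Cmod_R, Rabs_pos_eq in Hlt by lra.
  set (s1 := csin ((g + p) * RtoC (/ 2))) in *; set (s2 := csin ((g - p) * RtoC (/ 2))) in *.
  assert (H1 := Cmod_ge_0 s1); assert (H2 := Cmod_ge_0 s2).
  destruct (Rlt_dec (Cmod s2) d) as [K|K].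
  - destruct (H _ K) as [K1 [m K2]]; autorewrite with reim in K1, K2.
    change (Re p) with a in K2; change (Im p) with h in K1.
    apply Rabs_def2 in K1; apply Rabs_def2 in K2; split; [apply Rabs_def1; lra|].
    exists m; left; apply Rabs_def1; lra.
  (* Here [g] is near [-p] modulo the period. As [Im g] and [h] are nonnegative with a small sum,
     their difference is small as well. *)
  - assert (K' : Cmod s1 < d) by nra.
    destruct (H _ K') as [K1 [m K2]]; autorewrite with reim in K1, K2.
    change (Re p) with a in K2; change (Im p) with h in K1.
    apply Rabs_def2 in K1; apply Rabs_def2 in K2; split; [apply Rabs_def1; lra|].
    exists m; right; apply Rabs_def1; lra.
Qed.

Lemma IZR_small (r : R) (m : Z) : Rabs (r - 2 * PI * IZR m) < 1 -> Rabs r <= 1 -> m = 0%Z.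
Proof.
  intros H1 H2; assert (HP := PI2_1); apply Rabs_def2 in H1; apply Rabs_le_between in H2.
  assert (A1 : -1 < IZR m) by nra; assert (A2 : IZR m < 1) by nra.
  apply (lt_IZR (-1)) in A1; apply lt_IZR in A2; lia.
Qed.

Lemma C_eq_eps (a b : C) : (forall e, 0 < e -> Cmod (a - b) < e) -> a = b.
Proof.
  intros H; apply Ceq_minus, Cmod_eq_0, Rle_antisym; [|apply Cmod_ge_0].
  apply Rnot_lt_le; intros Hp; specialize (H _ Hp); lra.
Qed.

Lemma Im_eq0_RtoC (z : C) : Im z = 0 -> z = RtoC (Re z).
Proof. intros H; apply C_ext; reim; auto. Qed.

Lemma cos_period_Z (t : R) (m : Z) : cos (t + 2 * PI * IZR m) = cos t.
Proof. assert (E := expi_period t m); rewrite !expi_cos_sin in E; now injection E. Qed.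

Lemma C_bounded_subsequence (u : nat -> C) (M : R) : (forall i, Cmod (u i) <= M) ->
  exists (phi : nat -> nat) (l : C), filterlim phi eventually eventually /\
    forall e, 0 < e -> exists N, forall i, (N <= i)%nat -> Cmod (u (phi i) - l) < e.
Proof.
  intros H.
  destruct (bounded_subsequence (fun i => Re (u i)) (- M) M) as [phi [l1 [Hphi H1]]].
  { intros i; apply Rabs_le_between; eapply Rle_trans; [apply re_le_Cmod|auto]. }
  destruct (bounded_subsequence (fun i => Im (u (phi i))) (- M) M) as [psi [l2 [Hpsi H2]]].
  { intros i; apply Rabs_le_between; eapply Rle_trans; [apply Im_le_Cmod|auto]. }
  exists (fun i => phi (psi i)), ((l1, l2) : C); split; [eapply filterlim_comp; eauto|].
  intros e He.
  apply (is_lim_seq_subseq _ _ psi Hpsi) in H1.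
  apply is_lim_seq_spec in H1; apply is_lim_seq_spec in H2.
  assert (He2 : 0 < e / 2) by lra.
  destruct (H1 (mkposreal _ He2)) as [N1 K1], (H2 (mkposreal _ He2)) as [N2 K2].
  exists (N1 + N2)%nat; intros i Hi; specialize (K1 i ltac:(lia)); specialize (K2 i ltac:(lia)).
  eapply Rle_lt_trans; [apply Cmod_le_ReIm|]; reim; simpl in K1, K2; unfold Re, Im in *; simpl; lra.
Qed.

Lemma disc_minimum (f : C -> R) (z0 : C) (r : R) : 0 < r ->
  (forall z, Cmod (z - z0) <= r -> ccont (fun w => RtoC (f w)) z) -> (forall z, 0 <= f z) ->
  exists z1, Cmod (z1 - z0) <= r /\ forall z, Cmod (z - z0) <= r -> f z1 <= f z.
Proof.
  intros Hr Hc Hp.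
  assert (Hz0 : Cmod (z0 - z0) <= r) by (replace (z0 - z0)%C with (RtoC 0) by ring; rewrite Cmod_0; lra).
  destruct (completeness (fun v => exists z, Cmod (z - z0) <= r /\ v = - f z)) as [s [S1 S2]].
  { exists 0; intros v [z [_ ->]]; specialize (Hp z); lra. }
  { exists (- f z0), z0; auto. }
  destruct (nat_choice C (fun i z => Cmod (z - z0) <= r /\ f z < - s + / (INR i + 1))) as [u Hu].
  { intros i; apply NNPP; intros Hn.
    assert (Hi : 0 < / (INR i + 1)) by apply inv_INR_pos.
    assert (s <= s - / (INR i + 1)); [|lra].
    apply S2; intros v [z [Hz ->]]; apply Rnot_lt_le; intros Hlt; apply Hn; exists z; split; auto; lra. }
  destruct (C_bounded_subsequence (fun i => u i - z0)%C r) as [phi [l [Hphi Hl]]].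
  { intros i; apply Hu. }
  assert (Hl0 : Cmod l <= r).
  { apply Rnot_lt_le; intros Hlt; destruct (Hl (Cmod l - r)) as [N HN]; [lra|].
    specialize (HN N ltac:(lia)); destruct (Hu (phi N)) as [K _].
    generalize (Cmod_triangle_inv l (u (phi N) - z0)%C); rewrite (Cmod_minus_sym l); lra. }
  exists (z0 + l)%C.
  assert (Hl1 : Cmod (z0 + l - z0) <= r) by (replace (z0 + l - z0)%C with l by ring; auto).
  split; auto; intros z Hz.
  assert (f (z0 + l)%C <= - s).
  { apply Rnot_lt_le; intros Hlt; set (e := (f (z0 + l)%C + s) / 2).
    destruct (Hc _ Hl1 e) as [d [Hd K]]; [unfold e; lra|].
    destruct (Hl d Hd) as [N HN].
    assert (Hlim := is_lim_seq_inv_INR); apply (is_lim_seq_subseq _ _ phi Hphi) in Hlim.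
    apply is_lim_seq_spec in Hlim.
    assert (He : 0 < e) by (unfold e; lra).
    destruct (Hlim (mkposreal e He)) as [N2 HN2].
    set (i := (N + N2)%nat); specialize (HN i ltac:(unfold i; lia)); specialize (HN2 i ltac:(unfold i; lia)).
    simpl in HN2; rewrite Rminus_0_r in HN2; apply Rabs_def2 in HN2.
    specialize (K (u (phi i))).
    replace (u (phi i) - (z0 + l))%C with (u (phi i) - z0 - l)%C in K by ring.
    specialize (K HN); rewrite <- RtoC_minus, Cmod_R in K; apply Rabs_def2 in K.
    destruct (Hu (phi i)) as [_ K2]; unfold e in *; lra. }
  specialize (S1 (- f z) (ex_intro _ z (conj Hz eq_refl))); lra.
Qed.

Lemma comb_up (slits : list (R * R)) (w : C) (s : R) : 0 <= s -> comb slits w -> comb slits (w + Ci * RtoC s)%C.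
Proof.
  intros Hs [H1 H2]; split; [reim; lra|].
  intros [oh [Hin [m [Hre Him]]]]; apply H2; exists oh; split; auto; exists m.
  autorewrite with reim in Hre, Him; split; lra.
Qed.

(** * The conformal map attached to an alternating function *)

Section CombMap.
Variables (n : nat) (y : nat -> R) (A : R).
Definition Fr (t : R) : R := A * rprod y n t.
Definition Fc (z : C) : C := (RtoC A * sprod y n z)%C.
Hypothesis n_pos : (1 <= n)%nat.
Hypothesis y_period : y n = y 0%nat + 2 * PI.
Hypothesis y_inc : forall k, (k < n)%nat -> y k < y (S k).
Hypothesis F_sign : forall k t, (k < n)%nat -> y k < t < y (S k) -> 0 < (-1) ^ k * Fr t.
Hypothesis F_max : forall k, (k < n)%nat -> exists t, y k < t < y (S k) /\ 1 <= Rabs (Fr t).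

(** * Critical points in the gaps and values omitted off the real axis *)

Lemma Fc_real (t : R) : Fc (RtoC t) = RtoC (Fr t).
Proof. unfold Fc, Fr; rewrite sprod_real, <- RtoC_mult; reflexivity. Qed.

Lemma Trig_Fc : Trig n Fc.
Proof. apply Trig_scal, Trig_sprod. Qed.

Lemma A_neq0 : A <> 0.
Proof.
  intros E; destruct (F_max 0 ltac:(lia)) as [t [_ H]]; unfold Fr in H.
  rewrite E, Rmult_0_l, Rabs_R0 in H; lra.
Qed.

Lemma rprod_zero (m k : nat) : (k < m)%nat -> rprod y m (y k) = 0.
Proof.
  intros H; induction m; [lia|]; simpl.
  destruct (Nat.eq_dec k m) as [->|]; [|rewrite IHm by lia; ring].
  rewrite Rminus_diag; unfold Rdiv; rewrite Rmult_0_l, sin_0; ring.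
Qed.

Lemma Fr_zero (k : nat) : (k <= n)%nat -> Fr (y k) = 0.
Proof.
  intros H; unfold Fr; destruct (Nat.eq_dec k n) as [->|].
  - assert (E : forall m, (0 < m)%nat -> rprod y m (y n) = 0).
    { intros m Hm; induction m; [lia|]; simpl; destruct m.
      - simpl; rewrite y_period; replace ((y 0%nat + 2 * PI - y 0%nat) / 2) with PI by field.
        rewrite sin_PI; ring.
      - rewrite IHm by lia; ring. }
    rewrite E by lia; ring.
  - rewrite rprod_zero by lia; ring.
Qed.

Lemma Fr_continuity : continuity Fr.
Proof.
  intros t; apply ccont_continuity with Fc; [apply Fc_real|].
  destruct (Trig_diff _ _ Trig_Fc) as [d [_ Hd]]; eapply cdiff_ccont; apply Hd.
Qed.

(** [F] vanishes at the ends of the gap and reaches modulus 1 inside, so the maximum is interior and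
    critical. Multiplication by [(-1)^k] removes the absolute value and keeps the function
    differentiable. *)
Lemma gap_maximum (dF : C -> C) (k : nat) : (forall z, cdiff Fc z (dF z)) -> (k < n)%nat ->
  exists c, y k < c < y (S k) /\ 1 <= Rabs (Fr c) /\ dF (RtoC c) = 0 /\
    forall t, y k <= t <= y (S k) -> Rabs (Fr t) <= Rabs (Fr c).
Proof.
  intros Hd Hk.
  assert (Hyk := y_inc k Hk).
  set (g := fun t => (-1) ^ k * Fr t).
  assert (Hsg : Rabs ((-1) ^ k) = 1) by apply pow_1_abs.
  assert (Hga : forall t, Rabs (g t) = Rabs (Fr t)).
  { intros t; unfold g; rewrite Rabs_mult, Hsg; ring. }
  assert (Hgp : forall t, y k <= t <= y (S k) -> g t = Rabs (Fr t)).
  { intros t Ht; rewrite <- Hga; symmetry; apply Rabs_pos_eq; unfold g.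
    destruct (Req_dec t (y k)) as [->|]; [rewrite Fr_zero by lia; lra|].
    destruct (Req_dec t (y (S k))) as [->|]; [rewrite Fr_zero by lia; lra|].
    left; apply F_sign; auto; lra. }
  destruct (continuity_ab_maj g (y k) (y (S k))) as [c [Hc1 Hc2]]; [lra| |].
  { intros t _; apply continuity_pt_scal, Fr_continuity. }
  assert (HM : 1 <= Rabs (Fr c)).
  { destruct (F_max k Hk) as [t [Ht HFt]].
    specialize (Hc1 t ltac:(lra)); rewrite !Hgp in Hc1 by lra; lra. }
  assert (Hck : y k < c < y (S k)).
  { split.
    - destruct (proj1 Hc2) as [H|H]; auto; exfalso; rewrite <- H, Fr_zero, Rabs_R0 in HM by lia; lra.
    - destruct (proj2 Hc2) as [H|H]; auto; exfalso; rewrite H, Fr_zero, Rabs_R0 in HM by lia; lra. }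
  exists c; split; [auto|split; [auto|split]].
  - destruct (real_derivative Fc dF Fr Fc_real Hd c) as [H1 H2]; rewrite H2; f_equal.
    assert (H3 : is_derive g c ((-1) ^ k * Re (dF (RtoC c)))) by (apply is_derive_scal; auto).
    assert (pr : derivable_pt g c) by (eexists; apply is_derive_Reals; apply H3).
    assert (E : derive_pt g c pr = 0).
    { apply (deriv_maximum g (y k) (y (S k))); try lra; intros t Ht1 Ht2; apply Hc1; lra. }
    rewrite Derive_Reals, (is_derive_unique _ _ _ H3) in E.
    apply Rmult_integral in E; destruct E as [E|E]; auto.
    rewrite E, Rabs_R0 in Hsg; lra.
  - intros t Ht; rewrite <- !Hgp by lra; apply Hc1; lra.
Qed.

(** For [c > 0] the function [c - F^2] is positive at the nodes and at most 0 at the maximum in each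
    gap; if it is 0 there, the zero is double. So all its [2n] zeros are real. For [c = 0] the
    product formula decides. *)
Lemma Fc_sqr_not_in_01 (z : C) (c : R) : Im z <> 0 -> 0 <= c <= 1 -> (Fc z * Fc z)%C <> RtoC c.
Proof.
  intros Hz Hc E.
  destruct (Trig_diff _ _ Trig_Fc) as [dF [HdT Hd]].
  destruct (Req_dec c 0) as [->|Hc0].
  - revert E; apply Cmult_neq_0; (apply Cmult_neq_0; [apply RtoC_neq0, A_neq0|]);
      apply sprod_neq0; intros; now apply hsin_neq0_upper.
  - apply (Trig_real_rooted n (fun z => RtoC c + - RtoC 1 * (Fc z * Fc z))%C (fun t => c - Fr t * Fr t) y) in Hz;
      auto.
    + apply Hz; rewrite E; ring.
    + apply Trig_plus; [apply Trig_const|apply Trig_scal, Trig_mult; apply Trig_Fc].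
    + intros t; rewrite Fc_real, RtoC_minus, RtoC_mult; ring.
    + intros k Hk; rewrite Fr_zero by auto; lra.
    + intros k Hk; destruct (gap_maximum dF k Hd Hk) as [x [Hx [HM [HdF _]]]].
      exists x; split; auto.
      assert (HM2 : 1 <= Fr x * Fr x).
      { rewrite <- (Rabs_pos_eq (Fr x * Fr x)) by nra; rewrite Rabs_mult; nra. }
      destruct (Rlt_dec (c - Fr x * Fr x) 0) as [H|H]; [left; auto|right]; split; [lra|].
      eapply cdiff_eq; [apply cdiff_plus; [apply cdiff_const|apply cdiff_scal, cdiff_mult; apply Hd]|].
      rewrite HdF; ring.
Qed.

(** For [r > 0] the function [F'^2 - r (F^2 - 1)] is positive at the nodes, where [F = 0], and at
    most 0 at the critical points; if [|F| = 1] there, the zero is double. For [r = 0] the critical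
    points are all the zeros of [F']. *)
Lemma dFc_real_rooted (dF : C -> C) (z : C) (r : R) :
  (forall z, cdiff Fc z (dF z)) -> Trig n dF -> Im z <> 0 -> 0 <= r ->
  (dF z * dF z)%C <> (RtoC r * (Fc z * Fc z - 1))%C.
Proof.
  intros Hd HdT Hz Hr E.
  assert (Hreal := real_derivative Fc dF Fr Fc_real Hd).
  destruct (Req_dec r 0) as [->|Hr0].
  - destruct (nat_choice R (fun k c => (k < n)%nat -> y k < c < y (S k) /\ dF (RtoC c) = 0)) as [c Hc].
    { intros k; destruct (Nat.lt_ge_cases k n) as [Hk|Hk]; [|exists 0; lia].
      destruct (gap_maximum dF k Hd Hk) as [x [Hx [_ [HdF _]]]]; exists x; auto. }
    assert (E0 : dF z = 0).
    { assert (E' : (dF z * dF z = 0)%C) by (rewrite E; ring); apply Cmult_eq0 in E'; tauto. }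
    revert E0; apply (Trig_real_rooted_simple n dF y c); auto.
    apply NNPP; intros Hno.
    assert (H0 : forall w, dF w = 0) by (intros w; apply NNPP; intros Hw; apply Hno; exists w; auto).
    destruct (F_max 0 ltac:(lia)) as [t [Ht HFt]].
    assert (Ec : Fr t = Fr (y 0%nat)).
    { symmetry; apply (eq_is_derive Fr); [|apply Ht].
      intros u _; destruct (Hreal u) as [H1 _]; rewrite H0 in H1; exact H1. }
    rewrite Ec, Fr_zero, Rabs_R0 in HFt by lia; lra.
  - destruct (Trig_diff _ _ HdT) as [ddF [_ Hdd]].
    apply (Trig_real_rooted n (fun z => dF z * dF z + - RtoC r * (Fc z * Fc z + - RtoC 1))%C
      (fun t => Re (dF (RtoC t)) * Re (dF (RtoC t)) - r * (Fr t * Fr t - 1)) y) in Hz; auto.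
    + apply Hz; rewrite E; ring.
    + apply Trig_plus; [now apply Trig_mult|].
      apply Trig_scal, Trig_plus; [apply Trig_mult; apply Trig_Fc|apply Trig_const].
    + intros t; destruct (Hreal t) as [_ H2]; rewrite H2 at 1 2.
      rewrite Fc_real, !RtoC_minus, !RtoC_mult, RtoC_minus, RtoC_mult; ring.
    + intros k Hk; rewrite Fr_zero by auto.
      assert (0 <= Re (dF (RtoC (y k))) * Re (dF (RtoC (y k)))) by nra; nra.
    + intros k Hk; destruct (gap_maximum dF k Hd Hk) as [x [Hx [HM [HdF _]]]].
      exists x; split; auto; rewrite HdF, Re_R.
      assert (HM2 : 1 <= Fr x * Fr x).
      { rewrite <- (Rabs_pos_eq (Fr x * Fr x)) by nra; rewrite Rabs_mult; nra. }
      destruct (Rlt_dec 1 (Fr x * Fr x)) as [H|H]; [left; nra|right].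
      assert (E1 : Fr x * Fr x = 1) by lra.
      split; [rewrite E1; ring|].
      eapply cdiff_eq; [apply cdiff_plus; [apply cdiff_mult; apply Hdd|apply cdiff_scal, cdiff_plus;
        [apply cdiff_mult; apply Hd|apply cdiff_const]]|].
      rewrite HdF; ring.
Qed.

(* [e^(i n tau / 2)] is the root of modulus less than 1 of [X + 1/X = 2 F]. *)
Definition comb_branch (tau : C -> C) : Prop :=
  (forall z, 0 < Im z -> (exists l, cdiff tau z l) /\
     ccos (RtoC (INR n / 2) * tau z) = Fc z /\ 0 < Im (tau z) /\
     tau (z + RtoC (2 * PI))%C = (tau z + RtoC (2 * PI))%C) /\
  exists kap, forall eps, 0 < eps -> exists Y, forall z, 0 < Im z -> Y < Im z ->
     Cmod (tau z - z - kap) < eps.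

Lemma INR_n_pos : 0 < INR n.
Proof. apply lt_0_INR; lia. Qed.

Lemma comb_branch_exists : exists tau, comb_branch tau.
Proof.
  assert (HnR := INR_n_pos).
  assert (HF : has_log n Fc).
  { change n with (0 + n)%nat at 1; apply has_log_mult; [apply has_log_const, A_neq0|apply has_log_sprod]. }
  destruct HF as [L [HL [kap Hkap]]].
  (* [W] could meet the cut of the square root only where [F^2] lies in [(0, 1]], which is
     excluded. *)
  set (W := fun z => (1 - / (Fc z * Fc z))%C).
  assert (F0 : forall z, 0 < Im z -> (Fc z * Fc z)%C <> 0).
  { intros z Hz; apply Fc_sqr_not_in_01; lra. }
  assert (HW : forall z, 0 < Im z -> 0 < Cmod (W z) + Re (W z)).
  { intros z Hz; apply not_negreal_pos; intros [H1 H2].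
    set (s := - Re (W z)).
    assert (EW : W z = RtoC (- s)) by (apply C_ext; reim; unfold s; lra).
    assert (Hs : 0 <= s) by (unfold s; lra).
    assert (E : (Fc z * Fc z = RtoC (/ (1 + s)))%C).
    { assert (K := F0 z Hz).
      assert (E1 : (/ (Fc z * Fc z) = RtoC (1 + s))%C).
      { replace (/ (Fc z * Fc z))%C with (1 - W z)%C by (unfold W; ring).
        rewrite EW, <- RtoC_minus; f_equal; ring. }
      rewrite RtoC_inv, <- E1 by lra.
      assert (Fc z <> 0) by (intros E2; apply K; rewrite E2; ring).
      field; auto. }
    revert E; apply Fc_sqr_not_in_01; [lra|]; split; [left; apply Rinv_0_lt_compat; lra|].
    rewrite <- Rinv_1; apply Rinv_le_contravar; lra. }
  set (S := fun z => csqrt (W z)).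
  assert (HS : forall z, 0 < Im z -> 0 < Re (S z)) by (intros; apply Re_csqrt; auto).
  (* [F (1 + S)] and [F (1 - S)] are the two roots of [X + 1/X = 2 F]; [T] is a logarithm of the
     first one. *)
  set (T := fun z => (L z + clog (1 + S z))%C).
  assert (HT : forall z, 0 < Im z -> cexp (T z) = (Fc z * (1 + S z))%C).
  { intros z Hz; unfold T; rewrite cexp_plus, (proj1 (HL z Hz)), cexp_clog; auto.
    reim; specialize (HS z Hz); lra. }
  assert (HTm : forall z, 0 < Im z -> cexp (- T z) = (Fc z * (1 - S z))%C).
  { intros z Hz; assert (K := F0 z Hz).
    assert (E1 : (Fc z * (1 + S z) * (Fc z * (1 - S z)) = 1)%C).
    { transitivity (Fc z * Fc z * (1 - S z * S z))%C; [ring|].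
      unfold S; rewrite csqrt_sqr by auto; unfold W; field.
      intros E2; apply K; rewrite E2; ring. }
    assert (E2 := cexp_opp (T z)); rewrite HT in E2 by auto.
    transitivity (Fc z * (1 + S z) * cexp (- T z) * (Fc z * (1 - S z)))%C.
    - transitivity (cexp (- T z) * (Fc z * (1 + S z) * (Fc z * (1 - S z))))%C; [rewrite E1; ring|ring].
    - rewrite E2; ring. }
  assert (HRe : forall z, 0 < Im z -> 0 < Re (T z)).
  { intros z Hz.
    assert (H1 := Cmod_cexp (T z)); assert (H2 := Cmod_cexp (- T z)).
    rewrite HT, Cmod_mult in H1 by auto; rewrite HTm, Cmod_mult in H2 by auto.
    (* Since [Re S > 0], the point [S] is nearer to 1 than to -1; this makes [F (1 + S)] the root of
       larger modulus, and [tau] has positive imaginary part. *)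
    assert (Hlt : Cmod (1 - S z) < Cmod (1 + S z)).
    { apply Rsqr_incrst_0; try apply Cmod_ge_0; rewrite !Rsqr_pow2, !Cmod2_alt; reim.
      specialize (HS z Hz); nra. }
    assert (HFz : 0 < Cmod (Fc z)).
    { apply Cmod_gt_0; intros E2; apply (F0 z Hz); rewrite E2; ring. }
    assert (exp (Re (- T z)) < exp (Re (T z))) by (rewrite <- H1, <- H2; apply Rmult_lt_compat_l; auto).
    apply exp_lt_inv in H; rewrite Re_opp in H; lra. }
  exists (fun z => Ci * RtoC (2 / INR n) * T z)%C; split.
  - intros z Hz; split; [|split; [|split]].
    + destruct (HL z Hz) as [_ [[l Hl] _]].
      destruct (Trig_diff _ _ Trig_Fc) as [dF [_ Hd]].
      eexists; apply cdiff_scal; unfold T; apply cdiff_plus; [apply Hl|].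
      apply (cdiff_comp clog (fun w => 1 + S w)%C).
      { apply cdiff_clog; reim; specialize (HS z Hz); lra. }
      apply cdiff_plus; [apply cdiff_const|]; unfold S.
      apply (cdiff_comp csqrt W); [apply cdiff_csqrt; auto|]; unfold W.
      apply cdiff_minus; [apply cdiff_const|].
      apply (cdiff_inv (fun w => Fc w * Fc w)%C); auto.
      apply cdiff_mult; apply Hd.
    + assert (E1 : (Ci * (RtoC (INR n / 2) * (Ci * RtoC (2 / INR n) * T z)) = - T z)%C).
      { transitivity (Ci * Ci * (RtoC (INR n / 2) * RtoC (2 / INR n)) * T z)%C; [ring|].
        rewrite Ci2, <- RtoC_mult; replace (INR n / 2 * (2 / INR n)) with 1 by (field; lra); ring. }
      unfold ccos; rewrite E1.
      replace (Ci * - (RtoC (INR n / 2) * (Ci * RtoC (2 / INR n) * T z)))%C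
        with (- (Ci * (RtoC (INR n / 2) * (Ci * RtoC (2 / INR n) * T z))))%C by ring.
      rewrite E1; replace (- - T z)%C with (T z) by ring.
      rewrite HT, HTm, RtoC_inv by (auto; lra); cfield.
    + reim; specialize (HRe z Hz).
      assert (0 < 2 / INR n) by (apply Rdiv_lt_0_compat; lra); nra.
    + destruct (HL z Hz) as [E1 [_ E2]].
      (* Only the square is periodic for odd [n], and only the square enters [W]. *)
      assert (EF : (Fc (z + RtoC (2 * PI)) * Fc (z + RtoC (2 * PI)) = Fc z * Fc z)%C).
      { assert (Hz' : 0 < Im (z + RtoC (2 * PI))%C) by (reim; lra).
        destruct (HL _ Hz') as [E3 _]; rewrite <- E3, <- E1, E2, <- !cexp_plus.
        replace (L z - Ci * RtoC (PI * INR n) + (L z - Ci * RtoC (PI * INR n)))%C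
          with ((L z + L z) + - (Ci * RtoC (2 * PI * INR n)))%C
          by (rewrite !RtoC_mult; ring).
        rewrite cexp_plus; replace (cexp (- (Ci * RtoC (2 * PI * INR n)))) with (RtoC 1); [ring|].
        symmetry; replace (- (Ci * RtoC (2 * PI * INR n)))%C with (Ci * RtoC (0 + 2 * PI * IZR (- Z.of_nat n)))%C.
        - fold (expi (0 + 2 * PI * IZR (- Z.of_nat n))); rewrite expi_period, expi_cos_sin, cos_0, sin_0.
          reflexivity.
        - rewrite opp_IZR, <- INR_IZR_INZ, Rplus_0_l, Ropp_mult_distr_r_reverse, RtoC_opp; ring. }
      unfold T, S, W; rewrite EF, E2.
      assert (E4 : (RtoC (2 / INR n) * RtoC (PI * INR n) = RtoC (2 * PI))%C)
        by (rewrite <- RtoC_mult; f_equal; field; lra).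
      rewrite <- E4; apply Ceq_minus.
      replace (_ - _)%C with (- (Ci * Ci + 1) * (RtoC (2 / INR n) * RtoC (PI * INR n)))%C by ring.
      rewrite Ci2; ring.
  (* The correction to the logarithm of [F] depends on [u = 1/F^2], which tends to 0 high up;
     continuity of [G] at 0 gives the limit of [tau z - z]. *)
  - set (G := fun u => clog (1 + csqrt (1 - u))).
    assert (HG : ccont G 0).
    { assert (E : Cmod (1 - 0)%C + Re (1 - 0)%C = 2).
      { replace (1 - 0)%C with (RtoC 1) by ring; rewrite Cmod_1; simpl; lra. }
      assert (Hp := Re_csqrt (1 - 0)%C ltac:(lra)).
      unfold G; apply (ccont_comp clog (fun u => 1 + csqrt (1 - u))%C).
      - apply ccont_clog; reim; lra.
      - apply ccont_plus; [apply ccont_const|].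
        apply (ccont_comp csqrt (fun u => 1 - u)%C); [apply ccont_csqrt; lra|].
        apply ccont_minus; [apply ccont_const|apply ccont_id]. }
    exists (Ci * RtoC (2 / INR n) * (kap + G 0))%C; intros e He.
    set (q := 2 / INR n).
    assert (Hq : 0 < q) by (apply Rdiv_lt_0_compat; lra).
    destruct (HG (e / (2 * q))) as [d [Hd HGd]]; [apply Rdiv_lt_0_compat; lra|].
    destruct (Hkap (Rmin 1 (e / (2 * q)))) as [Y1 HY1].
    { apply Rmin_pos; [lra|apply Rdiv_lt_0_compat; lra]. }
    (* Above [Y1], [Re (L z)] differs from [Re kap + (n/2) Im z] by less than 1, so the second bound
       ensures [|1/F^2| = exp (-2 Re (L z)) < d]. *)
    exists (Rmax Y1 (q * (1 - Re kap - ln d / 2))); intros z Hz HY.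
    specialize (HY1 z Hz (Rle_lt_trans _ _ _ (Rmax_l _ _) HY)).
    assert (HY2 := Rle_lt_trans _ _ _ (Rmax_r _ _) HY).
    assert (K1 := Rlt_le_trans _ _ _ HY1 (Rmin_l _ _)).
    assert (K2 := Rlt_le_trans _ _ _ HY1 (Rmin_r _ _)).
    assert (K3 : ln d / 2 > - Re (L z)).
    { assert (K4 := re_le_Cmod (L z + Ci * z * RtoC (INR n / 2) - kap)).
      autorewrite with reim in K4; apply Rabs_le_between in K4.
      assert (Hn2 : INR n / 2 * q = 1) by (unfold q; field; lra).
      assert (INR n / 2 * Im z > 1 - Re kap - ln d / 2).
      { apply Rmult_gt_compat_l with (r := INR n / 2) in HY2; [|lra].
        rewrite <- Rmult_assoc, Hn2 in HY2; lra. }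
      lra. }
    assert (Hu : Cmod (/ (Fc z * Fc z) - 0)%C < d).
    { replace (/ (Fc z * Fc z) - 0)%C with (/ (Fc z * Fc z))%C by ring.
      rewrite Cmod_inv, Cmod_mult, <- (proj1 (HL z Hz)), Cmod_cexp, <- exp_plus by auto.
      rewrite <- exp_Ropp, <- (exp_ln d) by auto; apply exp_increasing; lra. }
    specialize (HGd _ Hu).
    unfold T, S; fold (W z); change (clog (1 + csqrt (W z))) with (G (/ (Fc z * Fc z))%C).
    set (g := G (/ (Fc z * Fc z))%C) in *.
    assert (Ez : (Ci * RtoC q * (Ci * z * RtoC (INR n / 2)) = - z)%C).
    { transitivity (Ci * Ci * (RtoC q * RtoC (INR n / 2)) * z)%C; [ring|].
      rewrite Ci2, <- RtoC_mult; replace (q * (INR n / 2)) with 1 by (unfold q; field; lra); ring. }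
    replace (Ci * RtoC q * (L z + g) - z - Ci * RtoC q * (kap + G 0))%C
      with (Ci * RtoC q * ((L z + Ci * z * RtoC (INR n / 2) - kap) + (g - G 0)))%C.
    2: { transitivity (Ci * RtoC q * (L z + g) + Ci * RtoC q * (Ci * z * RtoC (INR n / 2))
           - Ci * RtoC q * (kap + G 0))%C; [ring|rewrite Ez; ring]. }
    rewrite !Cmod_mult, Cmod_Ci, Cmod_R, Rabs_pos_eq, Rmult_1_l by lra.
    eapply Rle_lt_trans; [apply Rmult_le_compat_l; [lra|apply Cmod_triangle]|].
    replace e with (q * (e / (2 * q) + e / (2 * q))) by (field; lra).
    apply Rmult_lt_compat_l; lra.
Qed.

(** Differentiating [cos (n tau / 2) = F] gives a continuous formula for [tau'], whose denominator
    vanishes nowhere because [F^2 <> 1]. *)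
Lemma branch_derivative (tau : C -> C) : comb_branch tau ->
  exists dtau, forall z, 0 < Im z -> cdiff tau z (dtau z) /\ 0 < Re (dtau z).
Proof.
  intros [Hb _]; assert (HnR := INR_n_pos).
  destruct (Trig_diff _ _ Trig_Fc) as [dF [HdT Hd]].
  set (N := RtoC (INR n / 2)).
  assert (HN : N <> 0) by (apply RtoC_neq0; lra).
  set (dtau := fun z => (- dF z / (N * csin (N * tau z)))%C).
  assert (Hsin : forall z, 0 < Im z -> csin (N * tau z) <> 0).
  { intros z Hz E; destruct (Hb z Hz) as [_ [EF _]].
    assert (K := ccos2_csin2 (N * tau z)); rewrite E in K; unfold N in K; rewrite EF in K.
    apply (Fc_sqr_not_in_01 z 1 ltac:(lra) ltac:(lra)); rewrite <- K; ring. }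
  assert (Hrel : forall z l, 0 < Im z -> cdiff tau z l -> dF z = (- csin (N * tau z) * (N * l))%C).
  { intros z l Hz Hl; apply (cdiff_unique Fc z); auto.
    apply cdiff_ext_loc with (d := Im z) (f := fun w => ccos (N * tau w)); auto.
    - intros w Hw; apply Hb; now apply upper_open with z.
    - apply (cdiff_comp ccos (fun w => N * tau w)%C); [apply cdiff_ccos|now apply cdiff_scal]. }
  assert (Hder : forall z, 0 < Im z -> cdiff tau z (dtau z)).
  { intros z Hz; destruct (proj1 (Hb z Hz)) as [l Hl]; assert (E := Hrel z l Hz Hl).
    eapply cdiff_eq; [apply Hl|]; unfold dtau; rewrite E; field; auto. }
  assert (Hcont : forall z, 0 < Im z -> ccont dtau z).
  { intros z Hz; unfold dtau.
    assert (Ht := cdiff_ccont _ _ _ (Hder z Hz)).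
    destruct (Trig_diff _ _ HdT) as [ddF [_ Hdd]].
    apply ccont_mult; [apply ccont_opp; eapply cdiff_ccont; apply Hdd|].
    apply ccont_inv; [apply Cmult_neq_0; auto|].
    apply ccont_mult; [apply ccont_const|].
    apply (ccont_comp csin (fun w => N * tau w)%C).
    - eapply cdiff_ccont; apply cdiff_csin.
    - apply ccont_mult; [apply ccont_const|auto]. }
  assert (Hne : forall z, 0 < Im z -> Re (dtau z) <> 0).
  (* If [tau' = i b] with [b] real, the chain rule yields [F'^2 = (n b / 2)^2 (F^2 - 1)], which is
     excluded off the axis. *)
  { intros z Hz E0; assert (E := Hrel z _ Hz (Hder z Hz)).
    set (b := Im (dtau z)); assert (El : dtau z = (Ci * RtoC b)%C) by (apply C_ext; reim; unfold b; lra).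
    apply (dFc_real_rooted dF z ((INR n / 2) * (INR n / 2) * (b * b)) Hd HdT); [lra|nra|].
    destruct (Hb z Hz) as [_ [EF _]]; fold N in EF.
    assert (K := ccos2_csin2 (N * tau z)); rewrite EF in K.
    rewrite E, El, !RtoC_mult; fold N.
    transitivity (csin (N * tau z) * csin (N * tau z) * (N * N * (RtoC b * RtoC b)) * (Ci * Ci))%C; [ring|].
    rewrite Ci2; replace (csin (N * tau z) * csin (N * tau z))%C with (1 - Fc z * Fc z)%C; [ring|].
    rewrite <- K; ring. }
  exists dtau; intros z Hz; split; auto.
  apply Rnot_le_lt; intros Hle.
  assert (Hup : forall s : R, 0 < Im (z + RtoC s * 1)%C) by (intros; reim; lra).
  (* Along a horizontal period [Re tau] grows by [2 PI], so [Re tau'] equals 1 somewhere; a negative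
     value at [z] would force a zero in between. *)
  destruct (MVT_gen (fun s => Re (1 * tau (z + RtoC s * 1)%C)%C) 0 (2 * PI)
    (fun s => Re (1 * (dtau (z + RtoC s * 1)%C * 1))%C)) as [s [Hs E]].
  { intros s _; apply cdiff_segment; auto. }
  { intros s _; apply derivable_continuous_pt; eexists; apply is_derive_Reals, cdiff_segment; auto. }
  assert (HP := PI_RGT_0).
  replace (z + RtoC (2 * PI) * 1)%C with (z + RtoC (2 * PI))%C in E by ring.
  replace (z + RtoC 0 * 1)%C with z in E by ring.
  destruct (Hb z Hz) as [_ [_ [_ Ep]]]; rewrite Ep in E.
  rewrite Rmin_left, Rmax_right in Hs by lra.
  assert (Hp : Re (dtau (z + RtoC s * 1)%C) = 1).
  { autorewrite with reim in E.
    assert (E' : 2 * PI = Re (dtau (z + RtoC s * 1)%C) * (2 * PI)) by lra.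
    apply Rmult_eq_reg_r with (2 * PI); lra. }
  set (h := fun u => Re (dtau (z + RtoC u * 1)%C)).
  assert (Hh : continuity h).
  { intros u; apply (ccont_continuity (fun w => RtoC (Re (dtau (z + RtoC (Re w) * 1)%C))) h); [reflexivity|].
    apply (ccont_Re (fun w => dtau (z + RtoC (Re w) * 1)%C)).
    apply (ccont_comp dtau (fun w => z + RtoC (Re w) * 1)%C); [apply Hcont; auto|].
    apply ccont_plus; [apply ccont_const|]; apply ccont_mult; [|apply ccont_const].
    apply (ccont_Re (fun w => w)), ccont_id. }
  assert (h0 : h 0 < 0).
  { unfold h; replace (z + RtoC 0 * 1)%C with z by ring; destruct Hle as [H|H]; auto.
    exfalso; apply (Hne z); auto. }
  assert (hs : h s = 1) by exact Hp.
  assert (Hs0 : 0 < s).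
  { destruct (proj1 Hs) as [H|H]; auto; rewrite <- H in hs; lra. }
  destruct (IVT_sign h 0 s Hh Hs0) as [u [_ Hu]]; [nra|].
  apply (Hne (z + RtoC u * 1)%C); auto.
Qed.

(** The Noshiro-Warschawski argument: integrate [Re tau' > 0] along the segment, which stays in the
    convex half-plane. The strict inequality also survives in weak form on the boundary. *)
Lemma branch_monotone (tau : C -> C) (a b : C) : comb_branch tau ->
  0 < Im a -> 0 < Im b -> a <> b -> 0 < Re (Cconj (b - a) * (tau b - tau a))%C.
Proof.
  intros Hb Ha Hbb Hab; destruct (branch_derivative tau Hb) as [dtau Hd].
  set (d := (b - a)%C).
  assert (Hd0 : 0 < Cmod d).
  { apply Cmod_gt_0; intros E; apply Hab; symmetry; now apply Ceq_minus. }
  assert (Hup : forall s : R, 0 <= s <= 1 -> 0 < Im (a + RtoC s * d)%C).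
  { intros s Hs; unfold d; reim; nra. }
  destruct (MVT_gen (fun s => Re (Cconj d * tau (a + RtoC s * d)%C)%C) 0 1
    (fun s => Re (Cconj d * (dtau (a + RtoC s * d)%C * d))%C)) as [s [Hs E]].
  { intros s Hs; rewrite Rmin_left, Rmax_right in Hs by lra; apply cdiff_segment, Hd, Hup; lra. }
  { intros s Hs; rewrite Rmin_left, Rmax_right in Hs by lra; apply derivable_continuous_pt.
    eexists; apply is_derive_Reals, cdiff_segment, Hd, Hup; lra. }
  rewrite Rmin_left, Rmax_right in Hs by lra.
  replace (a + RtoC 1 * d)%C with b in E by (unfold d; ring).
  replace (a + RtoC 0 * d)%C with a in E by ring.
  replace (Re (Cconj d * (tau b - tau a))%C) with (Re (Cconj d * tau b)%C - Re (Cconj d * tau a)%C)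
    by (reim; ring).
  rewrite E.
  assert (Hp := proj2 (Hd _ (Hup s Hs))); set (l := dtau (a + RtoC s * d)%C) in *.
  replace (Cconj d * (l * d))%C with (l * (d * Cconj d))%C by ring.
  rewrite <- Cmod2_conj; reim.
  assert (0 < Cmod d ^ 2) by (apply pow_lt; auto); nra.
Qed.

Lemma branch_injective (tau : C -> C) (a b : C) : comb_branch tau ->
  0 < Im a -> 0 < Im b -> tau a = tau b -> a = b.
Proof.
  intros Hb Ha Hbb E; apply NNPP; intros Hn.
  generalize (branch_monotone tau a b Hb Ha Hbb Hn).
  rewrite E; replace (tau b - tau b)%C with (RtoC 0) by ring; rewrite Cmult_0_r; simpl; lra.
Qed.

(* Near [t] the values of [n tau / 2] accumulate only at the discrete set of solutions of
   [cos g = F t]; by connectedness they stay near one of them. *)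
Lemma branch_cauchy (tau : C -> C) (t : R) : comb_branch tau -> forall e, 0 < e <= 1 ->
  exists d, 0 < d /\ forall z1 z2, 0 < Im z1 -> 0 < Im z2 ->
    Cmod (z1 - RtoC t) < d -> Cmod (z2 - RtoC t) < d ->
    Rabs (INR n / 2 * Im (tau z1) - INR n / 2 * Im (tau z2)) < e /\
    INR n / 2 * Re (tau z2) < INR n / 2 * Re (tau z1) + e.
Proof.
  intros Hb e He; assert (HnR := INR_n_pos).
  destruct (ccos_near (Fr t)) as [a [h [Hh Hnear]]].
  destruct (Hnear (e / 16)) as [d' [Hd' HN]]; [lra|].
  assert (HFc : ccont Fc (RtoC t)).
  { destruct (Trig_diff _ _ Trig_Fc) as [dF [_ Hd]]; eapply cdiff_ccont; apply Hd. }
  destruct (HFc d' Hd') as [d [Hd HF]]; exists d; split; auto.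
  set (g := fun z => (RtoC (INR n / 2) * tau z)%C).
  assert (Hg : forall z, 0 < Im z -> Cmod (z - RtoC t) < d ->
    Rabs (Im (g z) - h) < e / 16 /\
    exists m : Z, Rabs (Re (g z) - a - 2 * PI * IZR m) < e / 16 \/ Rabs (Re (g z) + a - 2 * PI * IZR m) < e / 16).
  { intros z Hz Hzd; destruct (proj1 Hb z Hz) as [_ [EF [Ip _]]]; apply HN.
    - unfold g; reim; nra.
    - unfold g; rewrite EF, <- Fc_real; auto. }
  intros z1 z2 Hz1 Hz2 Hd1 Hd2.
  assert (Eg : forall z, Re (g z) = INR n / 2 * Re (tau z) /\ Im (g z) = INR n / 2 * Im (tau z)).
  { intros z; unfold g; reim; split; ring. }
  rewrite <- !(proj1 (Eg _)), <- !(proj2 (Eg _)).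
  split.
  - destruct (Hg z1 Hz1 Hd1) as [K1 _], (Hg z2 Hz2 Hd2) as [K2 _].
    apply Rabs_def2 in K1; apply Rabs_def2 in K2; apply Rabs_def1; lra.
  - apply Rnot_le_lt; intros Hle.
    set (p := fun s : R => (z1 + RtoC s * (z2 - z1))%C).
    assert (Hp : forall s, 0 <= s <= 1 -> 0 < Im (p s) /\ Cmod (p s - RtoC t) < d).
    { intros s Hs; split; [unfold p; reim; nra|].
      replace (p s - RtoC t)%C with (RtoC (1 - s) * (z1 - RtoC t) + RtoC s * (z2 - RtoC t))%C
        by (unfold p; rewrite RtoC_minus; ring).
      eapply Rle_lt_trans; [apply Cmod_triangle|].
      rewrite !Cmod_mult, !Cmod_R, !Rabs_pos_eq by lra.
      destruct (Req_dec s 0) as [->|]; [lra|].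
      assert (s * Cmod (z2 - RtoC t) < s * d) by (apply Rmult_lt_compat_l; lra).
      assert ((1 - s) * Cmod (z1 - RtoC t) <= (1 - s) * d) by (apply Rmult_le_compat_l; lra). lra. }
    assert (Hval : forall v, Re (g z1) < v < Re (g z2) -> exists z, 0 < Im z /\ Cmod (z - RtoC t) < d /\ Re (g z) = v).
    { intros v Hv.
      destruct (Ranalysis5.IVT_interv (fun s => Re (g (p s)) - v) 0 1) as [s [Hs Es]].
      - intros s Hs; destruct (proj1 Hb (p s) (proj1 (Hp s Hs))) as [[l Hl] _].
        apply continuity_pt_minus; [|apply continuity_pt_const; intros ? ?; reflexivity].
        apply derivable_continuous_pt; eexists; apply is_derive_Reals.
        apply (cdiff_segment tau (RtoC (INR n / 2)) z1 (z2 - z1)%C l s Hl).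
      - lra.
      - unfold p; replace (z1 + RtoC 0 * (z2 - z1))%C with z1 by ring; lra.
      - unfold p; replace (z1 + RtoC 1 * (z2 - z1))%C with z2 by ring; lra.
      - exists (p s); destruct (Hp s Hs); repeat split; auto; lra. }
    (* Pigeonhole: each of three values is [e/16]-close to one of the two progressions [a + 2 PI Z]
       and [-a + 2 PI Z]. Two of them share a progression, yet they differ by at least [e/4] and at
       most [e/2], which is impossible. *)
    destruct (Hval (Re (g z1) + e / 4)) as [w1 [W1 [D1 V1]]]; [lra|].
    destruct (Hval (Re (g z1) + e / 2)) as [w2 [W2 [D2 V2]]]; [lra|].
    destruct (Hval (Re (g z1) + e * 3 / 4)) as [w3 [W3 [D3 V3]]]; [lra|].
    destruct (Hg w1 W1 D1) as [_ [m1 K1]], (Hg w2 W2 D2) as [_ [m2 K2]], (Hg w3 W3 D3) as [_ [m3 K3]].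
    rewrite V1 in K1; rewrite V2 in K2; rewrite V3 in K3.
    set (r := Re (g z1)) in *.
    assert (Hclash : forall (c u v : R) (m m' : Z), Rabs (u + c - 2 * PI * IZR m) < e / 16 ->
      Rabs (v + c - 2 * PI * IZR m') < e / 16 -> e / 4 <= v - u <= e / 2 -> False).
    { intros c u v m m' Q1 Q2 Q3; apply Rabs_def2 in Q1; apply Rabs_def2 in Q2.
      assert (Em : (m' - m)%Z = 0%Z).
      { apply (IZR_small (v - u)); [rewrite minus_IZR; apply Rabs_def1; lra|apply Rabs_le_between; lra]. }
      assert (m' = m) by lia; subst m'; lra. }
    unfold Rminus in K1, K2, K3; rewrite ?(Rplus_assoc _ (- a)) in K1, K2, K3.
    destruct K1 as [K1|K1], K2 as [K2|K2], K3 as [K3|K3];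
      first [ eapply (Hclash _ _ _ _ _ K1 K2); lra | eapply (Hclash _ _ _ _ _ K2 K3); lra
            | eapply (Hclash _ _ _ _ _ K1 K3); lra
            | rewrite <- Rplus_assoc in K1, K2, K3;
              first [ eapply (Hclash _ _ _ _ _ K1 K2); lra | eapply (Hclash _ _ _ _ _ K2 K3); lra
            | eapply (Hclash _ _ _ _ _ K1 K3); lra ] ].
Qed.

Lemma branch_limit (tau : C -> C) (t : R) : comb_branch tau ->
  exists l, forall e, 0 < e -> exists d, 0 < d /\ forall z, 0 < Im z ->
    Cmod (z - RtoC t) < d -> Cmod (tau z - l) < e.
Proof.
  intros Hb; assert (HnR := INR_n_pos).
  assert (Hc : forall e, 0 < e -> exists d, 0 < d /\ forall z1 z2, 0 < Im z1 -> 0 < Im z2 ->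
    Cmod (z1 - RtoC t) < d -> Cmod (z2 - RtoC t) < d ->
    Rabs (Re (tau z1) - Re (tau z2)) < e /\ Rabs (Im (tau z1) - Im (tau z2)) < e).
  { intros e He; set (e' := Rmin 1 (INR n / 2 * e)).
    assert (He' : 0 < e') by (apply Rmin_pos; nra).
    destruct (branch_cauchy tau t Hb e') as [d [Hd H]]; [split; [auto|apply Rmin_l]|].
    assert (He2 : e' <= INR n / 2 * e) by apply Rmin_r.
    exists d; split; auto; intros z1 z2 P1 P2 Q1 Q2.
    destruct (H z1 z2 P1 P2 Q1 Q2) as [A1 B1], (H z2 z1 P2 P1 Q2 Q1) as [_ B2].
    apply Rabs_def2 in A1; split; apply Rabs_def1; nra. }
  (* A vertical approach supplies a candidate limit; the Cauchy estimate then extends it to every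
     approach from the open half-plane. *)
  set (u := fun k => (RtoC t + Ci * RtoC (/ (INR k + 1)))%C).
  assert (Hk : forall k, 0 < / (INR k + 1)) by (intros; apply inv_INR_pos).
  assert (Hu : forall k, 0 < Im (u k)) by (intros k; unfold u; reim; specialize (Hk k); lra).
  assert (Hud : forall d, 0 < d -> exists N, forall k, (N <= k)%nat -> Cmod (u k - RtoC t) < d).
  { intros d Hd; assert (Hl := is_lim_seq_inv_INR); apply is_lim_seq_spec in Hl.
    destruct (Hl (mkposreal d Hd)) as [N HN]; exists N; intros k Hk'; specialize (HN k Hk'); simpl in HN.
    unfold u; replace (RtoC t + Ci * RtoC (/ (INR k + 1)) - RtoC t)%C with (Ci * RtoC (/ (INR k + 1)))%C by ring.
    rewrite Cmod_mult, Cmod_Ci, Cmod_R, Rmult_1_l; now rewrite Rminus_0_r in HN. }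
  destruct (Rcomplete.R_complete (fun k => Re (tau (u k)))) as [l1 Hl1].
  { intros e He; destruct (Hc e He) as [d [Hd H]]; destruct (Hud d Hd) as [N HN].
    exists N; intros p q Hp Hq; apply H; auto. }
  destruct (Rcomplete.R_complete (fun k => Im (tau (u k)))) as [l2 Hl2].
  { intros e He; destruct (Hc e He) as [d [Hd H]]; destruct (Hud d Hd) as [N HN].
    exists N; intros p q Hp Hq; apply H; auto. }
  exists ((l1, l2) : C); intros e He.
  destruct (Hc (e / 4)) as [d [Hd H]]; [lra|]; exists d; split; auto; intros z Hz Hzd.
  destruct (Hud d Hd) as [N1 HN1]; destruct (Hl1 (e / 4)) as [N2 HN2]; [lra|].
  destruct (Hl2 (e / 4)) as [N3 HN3]; [lra|].
  set (k := (N1 + N2 + N3)%nat).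
  destruct (H z (u k) Hz (Hu k) Hzd (HN1 k ltac:(unfold k; lia))) as [A1 A2].
  specialize (HN2 k ltac:(unfold k; lia)); specialize (HN3 k ltac:(unfold k; lia)).
  unfold Rdist in *; apply Rabs_def2 in A1; apply Rabs_def2 in A2; apply Rabs_def2 in HN2; apply Rabs_def2 in HN3.
  eapply Rle_lt_trans; [apply Cmod_le_ReIm|]; reim; simpl.
  assert (Rabs (Re (tau z) - l1) < e / 2) by (apply Rabs_def1; lra).
  assert (Rabs (Im (tau z) - l2) < e / 2) by (apply Rabs_def1; lra).
  unfold Re, Im in *; lra.
Qed.

(** * Boundary values on the real axis *)

Definition boundary_cont (tau : C -> C) : Prop :=
  forall t e, 0 < e -> exists d, 0 < d /\ forall z, 0 < Im z ->
    Cmod (z - RtoC t) < d -> Cmod (tau z - tau (RtoC t)) < e.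

Lemma comb_branch_ext (tau tau' : C -> C) :
  (forall z, 0 < Im z -> tau z = tau' z) -> comb_branch tau -> comb_branch tau'.
Proof.
  intros E [Hb [k Hk]]; split.
  - intros z Hz; destruct (Hb z Hz) as [[l Hl] [H1 [H2 H3]]]; rewrite <- (E z Hz).
    split; [exists l|split; [auto|split; auto]].
    + apply cdiff_ext_loc with (d := Im z) (f := tau); auto.
      intros w Hw; apply E; now apply upper_open with z.
    + rewrite <- E; auto; reim; lra.
  - exists k; intros e He; destruct (Hk e He) as [Y HY]; exists Y; intros z Hz; rewrite <- E; auto.
Qed.

Lemma boundary_branch_exists : exists tau, comb_branch tau /\ boundary_cont tau.
Proof.
  destruct comb_branch_exists as [tau Hb].
  set (L := fun t => constructive_indefinite_description _ (branch_limit tau t Hb)).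
  set (tb := fun z => if Rlt_dec 0 (Im z) then tau z else proj1_sig (L (Re z))).
  assert (E : forall z, 0 < Im z -> tau z = tb z).
  { intros z Hz; unfold tb; destruct (Rlt_dec 0 (Im z)); auto; lra. }
  exists tb; split; [now apply comb_branch_ext with tau|].
  intros t e He; destruct (proj2_sig (L t) e He) as [d [Hd H]]; exists d; split; auto.
  intros z Hz Hzd; rewrite <- E by auto.
  replace (tb (RtoC t)) with (proj1_sig (L t)); auto.
  unfold tb; rewrite Im_R, Re_R; destruct (Rlt_dec 0 0); auto; lra.
Qed.

Lemma boundary_approx (tau : C -> C) (t : R) (e : R) : boundary_cont tau -> 0 < e ->
  exists d, 0 < d /\ forall h, 0 < h < d ->
    Cmod (tau (RtoC t + Ci * RtoC h)%C - tau (RtoC t)) < e.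
Proof.
  intros Hc He; destruct (Hc t e He) as [d [Hd H]]; exists d; split; auto.
  intros h Hh; apply H; [reim; lra|].
  replace (RtoC t + Ci * RtoC h - RtoC t)%C with (Ci * RtoC h)%C by ring.
  rewrite Cmod_mult, Cmod_Ci, Cmod_R, Rabs_pos_eq; lra.
Qed.

Lemma boundary_cont_closed (tau : C -> C) : comb_branch tau -> boundary_cont tau ->
  forall z, 0 <= Im z -> forall e, 0 < e -> exists d, 0 < d /\ forall w, 0 <= Im w ->
    Cmod (w - z) < d -> Cmod (tau w - tau z) < e.
Proof.
  intros Hb Hc z Hz e He; destruct (Rlt_dec 0 (Im z)) as [Hp|Hp].
  - destruct (proj1 (proj1 Hb z Hp)) as [l Hl]; apply cdiff_ccont in Hl.
    destruct (Hl e He) as [d [Hd H]]; exists d; split; auto.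
  - rewrite (Im_eq0_RtoC z) by lra; set (t := Re z).
    destruct (Hc t (e / 2)) as [d [Hd H]]; [lra|]; exists (d / 2); split; [lra|].
    intros w Hw Hwt; destruct (Rlt_dec 0 (Im w)) as [Hwp|Hwp].
    + apply Rlt_trans with (e / 2); [apply H; auto; lra|lra].
    (* A boundary point [s] near [t] is reached through an interior point just above it, to which
       the limit statements at both [s] and [t] apply. *)
    + assert (Ew := Im_eq0_RtoC w ltac:(lra)); set (s := Re w) in Ew; clearbody s; subst w.
      destruct (boundary_approx tau s (e / 2) Hc) as [d' [Hd' H']]; [lra|].
      set (h := Rmin d d' / 2).
      assert (Hh : 0 < h /\ h < d' /\ h <= d / 2).
      { unfold h; generalize (Rmin_pos _ _ Hd Hd') (Rmin_l d d') (Rmin_r d d'); lra. }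
      specialize (H' h ltac:(lra)); specialize (H (RtoC s + Ci * RtoC h)%C ltac:(reim; lra)).
      rewrite Cmod_minus_sym in H'.
      eapply Rle_lt_trans; [apply (Cmod_minus_triangle _ (tau (RtoC s + Ci * RtoC h)%C))|].
      assert (Cmod (RtoC s + Ci * RtoC h - RtoC t) < d).
      { replace (RtoC s + Ci * RtoC h - RtoC t)%C with ((RtoC s - RtoC t) + Ci * RtoC h)%C by ring.
        eapply Rle_lt_trans; [apply Cmod_triangle|].
        rewrite (Cmod_mult Ci), Cmod_Ci, (Cmod_R h), Rabs_pos_eq by lra; lra. }
      specialize (H H0); lra.
Qed.

Lemma boundary_cos (tau : C -> C) (t : R) : comb_branch tau -> boundary_cont tau ->
  ccos (RtoC (INR n / 2) * tau (RtoC t)) = RtoC (Fr t).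
Proof.
  intros Hb Hc; rewrite <- Fc_real; apply C_eq_eps; intros e He.
  assert (H1 : ccont (fun w => ccos (RtoC (INR n / 2) * w)) (tau (RtoC t))).
  { apply (ccont_comp ccos (fun w => RtoC (INR n / 2) * w)%C).
    - eapply cdiff_ccont; apply cdiff_ccos.
    - apply ccont_mult; [apply ccont_const|apply ccont_id]. }
  assert (H2 : ccont Fc (RtoC t)).
  { destruct (Trig_diff _ _ Trig_Fc) as [dF [_ Hd]]; eapply cdiff_ccont; apply Hd. }
  destruct (H1 (e / 2)) as [d1 [Hd1 K1]]; [lra|]; destruct (H2 (e / 2)) as [d2 [Hd2 K2]]; [lra|].
  destruct (boundary_approx tau t d1 Hc Hd1) as [d3 [Hd3 K3]].
  set (h := Rmin d2 d3 / 2).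
  assert (Hh : 0 < h /\ h < d2 /\ h < d3) by (now apply half_min).
  specialize (K3 h ltac:(lra)); set (z := (RtoC t + Ci * RtoC h)%C) in *.
  assert (Hz : 0 < Im z) by (unfold z; reim; lra).
  specialize (K1 _ K3); cbv beta in K1; rewrite (proj1 (proj2 (proj1 Hb z Hz))) in K1.
  specialize (K2 z).
  replace (z - RtoC t)%C with (Ci * RtoC h)%C in K2 by (unfold z; ring).
  rewrite Cmod_mult, Cmod_Ci, Cmod_R, Rabs_pos_eq, Rmult_1_l in K2 by lra.
  specialize (K2 ltac:(lra)); rewrite Cmod_minus_sym in K1.
  eapply Rle_lt_trans; [apply (Cmod_minus_triangle _ (Fc z))|]; lra.
Qed.

Lemma boundary_Im (tau : C -> C) (t : R) : comb_branch tau -> boundary_cont tau ->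
  0 <= Im (tau (RtoC t)).
Proof.
  intros Hb Hc; apply Rnot_lt_le; intros Hn.
  destruct (boundary_approx tau t (- Im (tau (RtoC t))) Hc) as [d [Hd H]]; [lra|].
  specialize (H (d / 2) ltac:(lra)); set (z := (RtoC t + Ci * RtoC (d / 2))%C) in *.
  assert (Hz : 0 < Im z) by (unfold z; reim; lra).
  destruct (proj1 Hb z Hz) as [_ [_ [Hp _]]].
  assert (K := Im_le_Cmod (tau z - tau (RtoC t))).
  assert (K' := Rle_lt_trans _ _ _ K H); apply Rabs_def2 in K'; rewrite Im_minus in K'; lra.
Qed.

Lemma boundary_period (tau : C -> C) (z : C) (m : Z) : comb_branch tau -> boundary_cont tau ->
  0 <= Im z -> tau (z + RtoC (2 * PI * IZR m))%C = (tau z + RtoC (2 * PI * IZR m))%C.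
Proof.
  intros Hb Hc.
  assert (H1 : forall z, 0 <= Im z -> tau (z + RtoC (2 * PI))%C = (tau z + RtoC (2 * PI))%C).
  { intros w Hw; destruct (Rlt_dec 0 (Im w)) as [Hp|Hp]; [apply Hb; auto|].
    rewrite (Im_eq0_RtoC w) by lra; set (t := Re w); rewrite <- RtoC_plus.
    apply C_eq_eps; intros e He.
    destruct (boundary_approx tau t (e / 2) Hc) as [d1 [Hd1 K1]]; [lra|].
    destruct (boundary_approx tau (t + 2 * PI) (e / 2) Hc) as [d2 [Hd2 K2]]; [lra|].
    set (h := Rmin d1 d2 / 2).
    assert (Hh : 0 < h /\ h < d1 /\ h < d2) by (now apply half_min).
    specialize (K1 h ltac:(lra)); specialize (K2 h ltac:(lra)).
    set (v := (RtoC t + Ci * RtoC h)%C) in *.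
    assert (Hv : 0 < Im v) by (unfold v; reim; lra).
    replace (RtoC (t + 2 * PI) + Ci * RtoC h)%C with (v + RtoC (2 * PI))%C in K2
      by (unfold v; rewrite RtoC_plus; ring).
    rewrite (proj2 (proj2 (proj2 (proj1 Hb v Hv)))), Cmod_minus_sym in K2.
    eapply Rle_lt_trans; [apply (Cmod_minus_triangle _ (tau v + RtoC (2 * PI))%C)|].
    replace (tau v + RtoC (2 * PI) - (tau (RtoC t) + RtoC (2 * PI)))%C with (tau v - tau (RtoC t))%C by ring.
    lra. }
  assert (H2 : forall k z, 0 <= Im z ->
    tau (z + RtoC (2 * PI * INR k))%C = (tau z + RtoC (2 * PI * INR k))%C).
  { induction k; intros w Hw.
    - simpl INR; rewrite Rmult_0_r; replace (w + RtoC 0)%C with w by ring; ring.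
    - rewrite S_INR, Rmult_plus_distr_l, Rmult_1_r, RtoC_plus, !Cplus_assoc, H1, IHk by (reim; lra).
      reflexivity. }
  intros Hz; destruct (Z.le_gt_cases 0 m) as [Hm|Hm].
  - rewrite <- (Z2Nat.id m Hm), <- INR_IZR_INZ; auto.
  - set (k := Z.to_nat (- m)).
    assert (Ek : IZR m = - INR k) by (unfold k; rewrite INR_IZR_INZ, Z2Nat.id, opp_IZR by lia; ring).
    rewrite Ek; replace (2 * PI * - INR k) with (- (2 * PI * INR k)) by ring.
    assert (K := H2 k (z + RtoC (- (2 * PI * INR k)))%C ltac:(reim; lra)).
    rewrite <- Cplus_assoc, <- RtoC_plus, Rplus_opp_l in K.
    replace (z + RtoC 0)%C with z in K by ring.
    rewrite K, RtoC_opp; ring.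
Qed.

Lemma boundary_mono (tau : C -> C) (s t : R) : comb_branch tau -> boundary_cont tau ->
  s <= t -> Re (tau (RtoC s)) <= Re (tau (RtoC t)).
Proof.
  intros Hb Hc [Hst|<-]; [|lra]; apply Rnot_lt_le; intros Hn.
  set (e := (Re (tau (RtoC s)) - Re (tau (RtoC t))) / 2).
  destruct (boundary_approx tau s e Hc) as [d1 [Hd1 K1]]; [unfold e; lra|].
  destruct (boundary_approx tau t e Hc) as [d2 [Hd2 K2]]; [unfold e; lra|].
  set (h := Rmin d1 d2 / 2).
  assert (Hh : 0 < h /\ h < d1 /\ h < d2) by (now apply half_min).
  specialize (K1 h ltac:(lra)); specialize (K2 h ltac:(lra)).
  set (a := (RtoC s + Ci * RtoC h)%C) in *; set (b := (RtoC t + Ci * RtoC h)%C) in *.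
  assert (Hm := branch_monotone tau a b Hb ltac:(unfold a; reim; lra) ltac:(unfold b; reim; lra)).
  assert (Eba : (b - a)%C = RtoC (t - s)) by (unfold a, b; rewrite RtoC_minus; ring).
  rewrite Eba in Hm; unfold Cconj in Hm; autorewrite with reim in Hm; simpl in Hm.
  assert (Hab : a <> b).
  { intros E; rewrite E in Eba; assert (E' : (b - b)%C = 0) by ring; rewrite E' in Eba.
    apply RtoC_inj in Eba; lra. }
  specialize (Hm Hab).
  assert (Q1 := Rle_lt_trans _ _ _ (re_le_Cmod _) K1); assert (Q2 := Rle_lt_trans _ _ _ (re_le_Cmod _) K2).
  apply Rabs_def2 in Q1; apply Rabs_def2 in Q2; rewrite Re_minus in Q1, Q2; unfold e in *.
  assert (Re (tau b) - Re (tau a) > 0).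
  { change (fst (tau b) + - fst (tau a)) with (Re (tau b) - Re (tau a)) in Hm. nra. }
  lra.
Qed.

(** Along the segment from [t] to [z] the projection of [tau] on the direction of the segment
    increases strictly. This keeps the slits, which consist of boundary values, out of the image of
    the open half-plane. *)
Lemma boundary_separated (tau : C -> C) (z : C) (t : R) : comb_branch tau -> boundary_cont tau ->
  0 < Im z -> tau z <> tau (RtoC t).
Proof.
  intros Hb Hc Hz E.
  set (d := (z - RtoC t)%C).
  assert (Id : Im d = Im z) by (unfold d; reim; ring).
  set (p := fun h : R => (RtoC t + RtoC h * d)%C).
  assert (Hp : forall h, 0 < h -> 0 < Im (p h)) by (intros h Hh; unfold p; reim; rewrite Id; nra).
  assert (Hd0 : 0 < Cmod d).
  { apply Cmod_gt_0; intros E'; rewrite E' in Id; simpl in Id; lra. }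
  assert (Hmono : forall h k, 0 < h < k -> 0 < Re (Cconj d * (tau (p k) - tau (p h)))%C).
  { intros h k Hhk; assert (Epk : (p k - p h)%C = (RtoC (k - h) * d)%C) by (unfold p; rewrite RtoC_minus; ring).
    assert (Hne : p h <> p k).
    { intros E'; assert (Im (p h) < Im (p k)) by (unfold p; reim; rewrite Id; nra); rewrite E' in H; lra. }
    assert (Hm := branch_monotone tau (p h) (p k) Hb (Hp h ltac:(lra)) (Hp k ltac:(lra)) Hne).
    rewrite Epk, Cmult_conj in Hm.
    replace (Cconj (RtoC (k - h))) with (RtoC (k - h)) in Hm by (unfold Cconj; apply C_ext; simpl; ring).
    rewrite <- Cmult_assoc, re_scal_l in Hm.
    apply Rmult_lt_reg_l with (k - h); lra. }
  assert (E1 : p 1 = z) by (unfold p, d; ring).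
  (* A fixed gain on the second half of the segment, which the limit at [t] cannot absorb. *)
  set (eta := Re (Cconj d * (tau (p 1) - tau (p (1 / 2)%R)))%C).
  assert (Heta : 0 < eta) by (apply Hmono; lra).
  destruct (Hc t (eta / Cmod d)) as [del [Hdel H]]; [now apply Rdiv_lt_0_compat|].
  set (h := Rmin (1 / 4) (del / (2 * Cmod d))).
  assert (Hh : 0 < h /\ h <= 1 / 4 /\ h <= del / (2 * Cmod d)).
  { unfold h; repeat split; [apply Rmin_pos; [lra|apply Rdiv_lt_0_compat; lra]|apply Rmin_l|apply Rmin_r]. }
  assert (Hm := Hmono h (1 / 2) ltac:(lra)).
  specialize (H (p h) (Hp h ltac:(lra))).
  assert (Hpd : Cmod (p h - RtoC t) < del).
  { unfold p; replace (RtoC t + RtoC h * d - RtoC t)%C with (RtoC h * d)%C by ring.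
    rewrite Cmod_mult, Cmod_R, Rabs_pos_eq by lra.
    apply Rle_lt_trans with (del / (2 * Cmod d) * Cmod d); [apply Rmult_le_compat_r; lra|].
    replace (del / (2 * Cmod d) * Cmod d) with (del / 2) by (field; lra); lra. }
  specialize (H Hpd).
  assert (Hlt : Cmod (Cconj d * (tau (p h) - tau (RtoC t)))%C < eta).
  { rewrite Cmod_mult, Cmod_conj; replace eta with (Cmod d * (eta / Cmod d)) by (field; lra).
    apply Rmult_lt_compat_l; auto. }
  assert (Q := Rle_lt_trans _ _ _ (re_le_Cmod _) Hlt); apply Rabs_def2 in Q.
  assert (Esum : Re (Cconj d * (tau (p 1) - tau (RtoC t)))%C = eta + Re (Cconj d * (tau (p (1 / 2)%R) - tau (p h)))%C
    + Re (Cconj d * (tau (p h) - tau (RtoC t)))%C).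
  { unfold eta; rewrite <- !Re_plus; f_equal; ring. }
  rewrite E1, E in Esum; replace (tau (RtoC t) - tau (RtoC t))%C with (RtoC 0) in Esum by ring.
  rewrite Cmult_0_r, Re_R in Esum; lra.
Qed.

Definition bRe (tau : C -> C) (t : R) : R := INR n / 2 * Re (tau (RtoC t)).
Definition bIm (tau : C -> C) (t : R) : R := INR n / 2 * Im (tau (RtoC t)).

Lemma boundary_eq (tau : C -> C) (t : R) : comb_branch tau -> boundary_cont tau ->
  cos (bRe tau t) * cosh (bIm tau t) = Fr t /\ sin (bRe tau t) * sinh (bIm tau t) = 0.
Proof.
  intros Hb Hc; assert (E := boundary_cos tau t Hb Hc).
  assert (E1 := f_equal Re E); assert (E2 := f_equal Im E).
  rewrite Re_ccos in E1; rewrite Im_ccos in E2; autorewrite with reim in E1, E2.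
  unfold bRe, bIm.
  replace (INR n / 2 * Re (tau (RtoC t)) - 0 * Im (tau (RtoC t))) with (INR n / 2 * Re (tau (RtoC t))) in * by ring.
  replace (INR n / 2 * Im (tau (RtoC t)) + 0 * Re (tau (RtoC t))) with (INR n / 2 * Im (tau (RtoC t))) in * by ring.
  split; [auto|lra].
Qed.

Lemma bRe_continuity (tau : C -> C) : comb_branch tau -> boundary_cont tau -> continuity (bRe tau).
Proof.
  intros Hb Hc t; apply continuity_pt_scal; intros e He.
  destruct (boundary_cont_closed tau Hb Hc (RtoC t) ltac:(reim; lra) e He) as [d [Hd H]].
  exists d; split; auto; intros u [_ Hu]; simpl in *; unfold Rdist in *.
  rewrite <- Re_minus; eapply Rle_lt_trans; [apply re_le_Cmod|].
  apply H; [reim; lra|]; now rewrite <- RtoC_minus, Cmod_R.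
Qed.

Lemma bRe_mono (tau : C -> C) (s t : R) : comb_branch tau -> boundary_cont tau ->
  s <= t -> bRe tau s <= bRe tau t.
Proof.
  intros Hb Hc H; apply Rmult_le_compat_l; [generalize INR_n_pos; lra|now apply boundary_mono].
Qed.

Lemma F_nonzero_gap (k : nat) (t : R) : (k < n)%nat -> y k < t < y (S k) -> Fr t <> 0.
Proof. intros Hk Ht E; generalize (F_sign k t Hk Ht); rewrite E; lra. Qed.

Lemma cos_bRe_zero (tau : C -> C) (k : nat) : comb_branch tau -> boundary_cont tau ->
  (k <= n)%nat -> cos (bRe tau (y k)) = 0.
Proof.
  intros Hb Hc Hk; destruct (boundary_eq tau (y k) Hb Hc) as [E _]; rewrite Fr_zero in E by auto.
  generalize (cosh_ge_1 (bIm tau (y k))); nra.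
Qed.

(* [n] steps of at most [PI] must add up to [n * PI]. *)
Lemma bRe_zeros (tau : C -> C) (k : nat) : comb_branch tau -> boundary_cont tau ->
  (k <= n)%nat -> bRe tau (y k) = bRe tau (y 0%nat) + INR k * PI.
Proof.
  intros Hb Hc; assert (HP := PI_RGT_0).
  assert (Hstep : forall j, (j < n)%nat -> bRe tau (y (S j)) <= bRe tau (y j) + PI).
  { intros j Hj; apply Rnot_lt_le; intros Hlt.
    destruct (Ranalysis5.IVT_interv (fun t => bRe tau t - (bRe tau (y j) + PI)) (y j) (y (S j))) as [t [Ht Et]].
    - intros t _; apply continuity_pt_minus; [now apply bRe_continuity|].
      apply continuity_pt_const; intros ? ?; reflexivity.
    - now apply y_inc.
    - lra.
    - lra.
    - assert (E : bRe tau t = bRe tau (y j) + PI) by lra.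
      destruct (boundary_eq tau t Hb Hc) as [E1 _].
      rewrite E, neg_cos, (cos_bRe_zero tau j Hb Hc) in E1 by lia.
      apply (F_nonzero_gap j t Hj).
      + split.
        * destruct (proj1 Ht) as [K|K]; auto; rewrite <- K in E; lra.
        * destruct (proj2 Ht) as [K|K]; auto; rewrite K in E; lra.
      + rewrite <- E1; ring. }
  assert (Hup : forall j, (j <= n)%nat -> bRe tau (y j) <= bRe tau (y 0%nat) + INR j * PI).
  { induction j; intros Hj; [simpl; lra|].
    specialize (IHj ltac:(lia)); specialize (Hstep j ltac:(lia)); rewrite S_INR; lra. }
  assert (Hn : bRe tau (y n) = bRe tau (y 0%nat) + INR n * PI).
  { unfold bRe; rewrite y_period, RtoC_plus.
    replace (2 * PI) with (2 * PI * IZR 1) by ring.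
    rewrite boundary_period by (auto; reim; lra); reim; field. }
  assert (Hdown : forall j, (j <= n)%nat -> bRe tau (y n) - INR j * PI <= bRe tau (y (n - j)%nat)).
  { induction j; intros Hj; [simpl; rewrite Nat.sub_0_r; lra|].
    specialize (IHj ltac:(lia)); specialize (Hstep (n - S j)%nat ltac:(lia)).
    replace (S (n - S j)) with (n - j)%nat in Hstep by lia; rewrite S_INR; lra. }
  intros Hk; apply Rle_antisym; [auto|].
  specialize (Hdown (n - k)%nat ltac:(lia)); replace (n - (n - k))%nat with k in Hdown by lia.
  rewrite minus_INR, Hn in Hdown by auto; lra.
Qed.

(** With this normalisation the part of the axis over gap [k] has [n Re tau / 2] within [PI / 2] of
    [k PI], which puts its slit at [2 PI k / n]. *)
Lemma normalized_branch_exists : exists tau, comb_branch tau /\ boundary_cont tau /\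
  bRe tau (y 0%nat) = - (PI / 2).
Proof.
  destruct boundary_branch_exists as [tau [Hb Hc]].
  assert (HP := PI_RGT_0); assert (HnR := INR_n_pos).
  assert (Hq : exists q : Z, bRe tau (y 0%nat) = - (PI / 2) + 2 * PI * IZR q).
  { assert (E0 := cos_bRe_zero tau 0 Hb Hc ltac:(lia)).
    apply cos_eq_0_0 in E0; destruct E0 as [m Hm].
    assert (E1 := bRe_zeros tau 1 Hb Hc ltac:(lia)); simpl INR in E1; rewrite Rmult_1_l in E1.
    destruct (F_max 0 ltac:(lia)) as [t [Ht _]].
    assert (Hs := F_sign 0 t ltac:(lia) Ht); simpl pow in Hs; rewrite Rmult_1_l in Hs.
    destruct (boundary_eq tau t Hb Hc) as [E2 _].
    assert (Hcos : 0 < cos (bRe tau t)) by (generalize (cosh_ge_1 (bIm tau t)); nra).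
    assert (M1 := bRe_mono tau (y 0%nat) t Hb Hc ltac:(lra)).
    assert (M2 := bRe_mono tau t (y 1%nat) Hb Hc ltac:(lra)).
    (* The starting value is [PI / 2 + m PI]. An even [m] would make the cosine nonpositive on the
       first gap, where [F > 0]. *)
    destruct (Z.Even_or_Odd m) as [[j Hj]|[j Hj]].
    - exfalso.
      assert (cos (bRe tau t + 2 * PI * IZR (- j)) <= 0); [|rewrite cos_period_Z in H; lra].
      rewrite opp_IZR; rewrite Hj, mult_IZR in Hm; apply cos_le_0; lra.
    - exists (j + 1)%Z; rewrite Hm, Hj, !plus_IZR, mult_IZR; field. }
  destruct Hq as [q Hq].
  (* Multiplied by [n / 2] this is [2 PI q], so the relation [cos (n tau / 2) = F] is unaffected. *)
  set (c := RtoC (4 * PI * IZR q / INR n)).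
  assert (Ec : (RtoC (INR n / 2) * c = RtoC (2 * PI * IZR q))%C).
  { unfold c; rewrite <- RtoC_mult; f_equal; field; lra. }
  exists (fun z => tau z - c)%C; split; [|split].
  - destruct Hb as [Hb [k Hk]]; split.
    + intros z Hz; destruct (Hb z Hz) as [[l Hl] [H1 [H2 H3]]]; split; [|split; [|split]].
      * exists (l - 0)%C; apply cdiff_minus; auto; apply cdiff_const.
      * rewrite <- H1; replace (RtoC (INR n / 2) * (tau z - c))%C
          with (RtoC (INR n / 2) * tau z - RtoC (INR n / 2) * c)%C by ring.
        rewrite Ec; set (g := (RtoC (INR n / 2) * tau z)%C); unfold ccos; f_equal; f_equal.
        -- replace (Ci * (g - RtoC (2 * PI * IZR q)))%C
             with (Ci * g + Ci * RtoC (0 + 2 * PI * IZR (- q)))%C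
             by (rewrite opp_IZR, Rplus_0_l, !RtoC_mult, RtoC_opp; ring).
           rewrite cexp_plus; fold (expi (0 + 2 * PI * IZR (- q))); rewrite expi_period, expi_cos_sin, cos_0, sin_0.
           change ((1, 0) : C) with (RtoC 1); ring.
        -- replace (Ci * - (g - RtoC (2 * PI * IZR q)))%C
             with (Ci * - g + Ci * RtoC (0 + 2 * PI * IZR q))%C
             by (rewrite Rplus_0_l, !RtoC_mult; ring).
           rewrite cexp_plus; fold (expi (0 + 2 * PI * IZR q)); rewrite expi_period, expi_cos_sin, cos_0, sin_0.
           change ((1, 0) : C) with (RtoC 1); ring.
      * unfold c; reim; lra.
      * rewrite H3; ring.
    + exists (k - c)%C; intros e He; destruct (Hk e He) as [Y HY]; exists Y; intros z Hz Hz'.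
      replace (tau z - c - z - (k - c))%C with (tau z - z - k)%C by ring; auto.
  - intros t e He; destruct (Hc t e He) as [d [Hd H]]; exists d; split; auto; intros z Hz Hzd.
    replace (tau z - c - (tau (RtoC t) - c))%C with (tau z - tau (RtoC t))%C by ring; auto.
  - unfold bRe in *; rewrite Re_minus; unfold c; rewrite Re_R.
    rewrite Rmult_minus_distr_l, Hq; field; lra.
Qed.

Definition normalized (tau : C -> C) : Prop :=
  comb_branch tau /\ boundary_cont tau /\ bRe tau (y 0%nat) = - (PI / 2).

(** Since [sin (bRe) * sinh (bIm) = 0], a boundary value lies on the base or over a multiple of
    [PI]. Monotonicity leaves [k PI] as the only multiple in this gap, and the size of [|F|] decides
    between the two cases. *)
Lemma gap_values (tau : C -> C) (k : nat) (t : R) : normalized tau -> (k < n)%nat ->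
  y k <= t <= y (S k) ->
  (1 <= Rabs (Fr t) -> bRe tau t = INR k * PI /\ cosh (bIm tau t) = Rabs (Fr t)) /\
  (Rabs (Fr t) <= 1 -> bIm tau t = 0).
Proof.
  intros [Hb [Hc H0]] Hk Ht; assert (HP := PI_RGT_0); assert (HnR := INR_n_pos).
  assert (M1 := bRe_mono tau (y k) t Hb Hc ltac:(lra)).
  assert (M2 := bRe_mono tau t (y (S k)) Hb Hc ltac:(lra)).
  rewrite (bRe_zeros tau k Hb Hc), H0 in M1 by lia.
  rewrite (bRe_zeros tau (S k) Hb Hc), H0, S_INR in M2 by lia.
  destruct (boundary_eq tau t Hb Hc) as [E1 E2].
  assert (HI : 0 <= bIm tau t).
  { unfold bIm; apply Rmult_le_pos; [lra|now apply boundary_Im]. }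
  set (G := bRe tau t) in *; set (J := bIm tau t) in *.
  assert (Hch := cosh_ge_1 J).
  assert (Hsc := sin2_cos2 G); unfold Rsqr in Hsc.
  assert (HF : Rabs (Fr t) * Rabs (Fr t) = cos G * cos G * (cosh J * cosh J)).
  { rewrite <- Rabs_mult, Rabs_pos_eq by nra; rewrite <- E1; ring. }
  assert (Hloc : sin G = 0 -> G = INR k * PI /\ cosh J = Rabs (Fr t)).
  { intros Hs; split.
    - apply sin_eq_0_0 in Hs; destruct Hs as [m Hm].
      assert (m = Z.of_nat k).
      { rewrite INR_IZR_INZ in M1, M2.
        assert (A1 : IZR (Z.of_nat k) < IZR m + 1) by nra.
        assert (A2 : IZR m < IZR (Z.of_nat k) + 1) by nra.
        rewrite <- (plus_IZR _ 1) in A1; rewrite <- (plus_IZR _ 1) in A2; apply lt_IZR in A1; apply lt_IZR in A2; lia. }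
      rewrite Hm, H, <- INR_IZR_INZ; reflexivity.
    - rewrite Hs in Hsc; assert (cos G * cos G = 1) by lra.
      rewrite H, Rmult_1_l in HF; generalize (Rabs_pos (Fr t)); nra. }
  apply Rmult_integral in E2; split; intros HFt.
  - apply Hloc; destruct E2 as [E2|E2]; auto.
    apply sinh_eq0 in E2; rewrite E2, cosh_0 in HF; nra.
  - destruct E2 as [E2|E2]; [|now apply sinh_eq0].
    destruct (Hloc E2) as [_ E3].
    assert (J <= 0); [|lra]; apply cosh_inj_le; try lra; rewrite cosh_0; lra.
Qed.

Lemma locate_gap (t : R) : y 0%nat <= t < y n -> exists k, (k < n)%nat /\ y k <= t <= y (S k).
Proof.
  intros Ht.
  assert (H : forall m, (m <= n)%nat -> y 0%nat <= t < y m -> exists k, (k < m)%nat /\ y k <= t <= y (S k)).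
  { induction m; intros Hm Hmt; [lra|].
    destruct (Rlt_dec t (y m)) as [H|H].
    - destruct (IHm ltac:(lia) ltac:(lra)) as [k [Hk Hk']]; exists k; split; auto.
    - exists m; split; [lia|lra]. }
  auto.
Qed.

(** * The slits and the image of the axis and of the half-plane *)

Definition slit_heights (h : nat -> R) : Prop := forall k, (k < n)%nat -> 0 <= h k /\
  (forall t, y k <= t <= y (S k) -> Rabs (Fr t) <= cosh (INR n / 2 * h k)) /\
  exists c, y k < c < y (S k) /\ Rabs (Fr c) = cosh (INR n / 2 * h k).

Lemma gap_heights : exists h : nat -> R, slit_heights h.
Proof.
  assert (HnR := INR_n_pos).
  apply (nat_choice R (fun k h => (k < n)%nat -> 0 <= h /\
    (forall t, y k <= t <= y (S k) -> Rabs (Fr t) <= cosh (INR n / 2 * h)) /\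
    exists c, y k < c < y (S k) /\ Rabs (Fr c) = cosh (INR n / 2 * h))).
  intros k; destruct (Nat.lt_ge_cases k n) as [Hk|Hk]; [|exists 0; lia].
  destruct (Trig_diff _ _ Trig_Fc) as [dF [_ Hd]].
  destruct (gap_maximum dF k Hd Hk) as [c [Hc1 [Hc2 [_ Hc3]]]].
  destruct (cosh_surj _ Hc2) as [h [Hh Eh]].
  exists (h / (INR n / 2)); intros _.
  replace (INR n / 2 * (h / (INR n / 2))) with h by (field; lra); rewrite Eh.
  split; [apply Rdiv_le_0_compat; lra|split; auto]; exists c; auto.
Qed.

(** Gaps with maximum exactly 1 have height 0 and must be dropped, because a regular comb asks for
    positive heights. *)
Definition slit_list (h : nat -> R) : list (R * R) :=
  flat_map (fun k => if Rlt_dec 0 (h k) then (2 * PI * INR k / INR n, h k) :: nil else nil) (seq 0 n).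

Lemma in_slit_list (h : nat -> R) (oh : R * R) : In oh (slit_list h) <->
  exists k, (k < n)%nat /\ 0 < h k /\ oh = (2 * PI * INR k / INR n, h k).
Proof.
  unfold slit_list; rewrite in_flat_map; split.
  - intros [k [Hk H]]; apply in_seq in Hk; exists k; destruct (Rlt_dec 0 (h k)); simpl in H; [|tauto].
    destruct H as [<-|[]]; repeat split; auto; lia.
  - intros [k [Hk [Hh ->]]]; exists k; split; [apply in_seq; lia|].
    destruct (Rlt_dec 0 (h k)); [now left|lra].
Qed.

Lemma slit_list_regular (h : nat -> R) : n_regular_comb n (slit_list h).
Proof.
  intros oh Hoh; apply in_slit_list in Hoh; destruct Hoh as [k [Hk [Hh ->]]]; simpl.
  assert (HnR := INR_n_pos); assert (HP := PI_RGT_0).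
  assert (Hkn : INR k / INR n < 1).
  { apply Rmult_lt_reg_r with (INR n); auto; unfold Rdiv; rewrite Rmult_assoc, Rinv_l by lra.
    rewrite Rmult_1_l, Rmult_1_r; now apply lt_INR. }
  assert (Hk0 : 0 <= INR k / INR n) by (apply Rdiv_le_0_compat; [apply pos_INR|auto]).
  replace (2 * PI * INR k / INR n) with (2 * PI * (INR k / INR n)) by (field; lra).
  split; [split; nra|split; auto].
  exists (Z.of_nat k); rewrite <- INR_IZR_INZ; field; lra.
Qed.

Lemma boundary_not_in_comb (tau : C -> C) (h : nat -> R) (t : R) : normalized tau ->
  slit_heights h ->
  ~ comb (slit_list h) (tau (RtoC t)).
Proof.
  intros Hnorm Hh [HI Hn]; apply Hn; clear Hn; assert (HnR := INR_n_pos).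
  destruct (reduce_mod_2PI (y 0%nat) t) as [m Hm]; set (s := t - 2 * PI * IZR m) in *.
  assert (Et : tau (RtoC t) = (tau (RtoC s) + RtoC (2 * PI * IZR m))%C).
  { destruct Hnorm as [Hb [Hc _]]; rewrite <- boundary_period by (auto; reim; lra).
    f_equal; rewrite <- RtoC_plus; f_equal; unfold s; ring. }
  rewrite Et in *; autorewrite with reim in HI.
  destruct (locate_gap s) as [k [Hk Hs]]; [rewrite y_period; lra|].
  destruct (gap_values tau k s Hnorm Hk Hs) as [G1 G2]; destruct (Hh k Hk) as [Hh0 [Hh1 _]].
  assert (HJ : 0 < bIm tau s) by (unfold bIm; apply Rmult_lt_0_compat; lra).
  assert (HF : 1 <= Rabs (Fr s)) by (apply Rnot_lt_le; intros Hlt; specialize (G2 ltac:(lra)); lra).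
  destruct (G1 HF) as [E1 E2]; specialize (Hh1 s Hs); rewrite <- E2 in Hh1.
  apply cosh_inj_le in Hh1; [|lra|nra].
  assert (Hle : Im (tau (RtoC s)) <= h k).
  { unfold bIm in Hh1; apply Rmult_le_reg_l with (INR n / 2); lra. }
  exists (2 * PI * INR k / INR n, h k); split.
  - apply in_slit_list; exists k; repeat split; auto; lra.
  - exists m; reim; simpl; split; [|lra].
    assert (E3 : Re (tau (RtoC s)) = 2 * PI * INR k / INR n); [|lra].
    unfold bRe in E1; apply Rmult_eq_reg_l with (INR n / 2); [|lra]; rewrite E1; field; lra.
Qed.

(** Every point of a slit is the image of a boundary point, and interior values differ from all
    boundary values. *)
Lemma branch_in_comb (tau : C -> C) (h : nat -> R) (z : C) : normalized tau ->
  slit_heights h ->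
  0 < Im z -> comb (slit_list h) (tau z).
Proof.
  intros Hnorm Hh Hz; assert (HnR := INR_n_pos); destruct Hnorm as [Hb [Hc H0]].
  split; [apply (proj1 Hb z Hz)|].
  intros [oh [Hin [m [Hre Him]]]]; apply in_slit_list in Hin; destruct Hin as [k [Hk [Hhk ->]]].
  simpl in Hre, Him.
  destruct (Hh k Hk) as [_ [_ [c [Hc1 Hc2]]]].
  set (v := cosh (INR n / 2 * Im (tau z))).
  assert (Hv1 : 1 <= v) by apply cosh_ge_1.
  assert (Hv : v <= Rabs (Fr c)).
  { rewrite Hc2; unfold v; apply Rnot_lt_le; intros Hlt.
    assert (INR n / 2 * h k <= INR n / 2 * Im (tau z)) by (apply cosh_inj_le; nra).
    assert (Im (tau z) = h k) by nra. rewrite H1 in Hlt; lra. }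
  (* The left side of the slit is enough: from the zero [y k] to the maximum at [c] the modulus
     takes every value up to the one that belongs to the tip. *)
  assert (Ht : exists t, y k <= t <= y (S k) /\ Rabs (Fr t) = v).
  { destruct Hv as [Hv|Hv]; [|exists c; split; [lra|auto]].
    destruct (Ranalysis5.IVT_interv (fun t => Rabs (Fr t) - v) (y k) c) as [t [Ht Et]].
    - intros t _; apply continuity_pt_minus; [|apply continuity_pt_const; intros ? ?; reflexivity].
      apply (continuity_pt_comp Fr Rabs); [apply Fr_continuity|apply Rcontinuity_abs].
    - lra.
    - rewrite Fr_zero, Rabs_R0 by lia; lra.
    - lra.
    - exists t; split; lra. }
  destruct Ht as [t [Ht Et]].
  destruct (gap_values tau k t (conj Hb (conj Hc H0)) Hk Ht) as [G1 _].
  destruct (G1 ltac:(lra)) as [E1 E2]; rewrite Et in E2.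
  assert (E3 : bIm tau t = INR n / 2 * Im (tau z)).
  { assert (0 <= bIm tau t) by (apply Rmult_le_pos; [lra|now apply boundary_Im]).
    apply Rle_antisym; apply cosh_inj_le; auto; try (unfold v in E2; lra); nra. }
  apply (boundary_separated tau z (t + 2 * PI * IZR m) Hb Hc Hz).
  rewrite RtoC_plus, boundary_period by (auto; reim; lra).
  apply C_ext; reim.
  - rewrite Hre; f_equal; unfold bRe in E1; apply Rmult_eq_reg_l with (INR n / 2); [|lra]; rewrite E1; field; lra.
  - rewrite Rplus_0_r; unfold bIm in E3; symmetry; apply Rmult_eq_reg_l with (INR n / 2); lra.
Qed.

(* A nonzero minimum of [|tau - w|] cannot be interior, since [tau'] does not vanish. *)
Lemma disc_solve (tau : C -> C) (z0 w : C) (r m : R) : comb_branch tau -> 0 < r ->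
  (forall z, Cmod (z - z0) <= r -> 0 < Im z) -> Cmod (tau z0 - w) < m ->
  (forall z, Cmod (z - z0) = r -> m <= Cmod (tau z - w)) ->
  exists z, 0 < Im z /\ tau z = w.
Proof.
  intros Hb Hr Hup H0 Hbd; destruct (branch_derivative tau Hb) as [dtau Hd].
  destruct (disc_minimum (fun z => Cmod (tau z - w)) z0 r) as [z1 [Hz1 Hmin]]; auto.
  { intros z Hz; apply (ccont_Cmod (fun z => tau z - w)%C).
    apply ccont_minus; [|apply ccont_const]; eapply cdiff_ccont; apply Hd; auto. }
  { intros; apply Cmod_ge_0. }
  exists z1; split; [auto|]; apply NNPP; intros Hne.
  set (v := (tau z1 - w)%C) in *.
  assert (Hv0 : v <> 0) by (intros E; apply Hne, Ceq_minus; auto).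
  assert (Hv : 0 < Cmod v) by (now apply Cmod_gt_0).
  destruct (Hd z1 (Hup z1 Hz1)) as [Hdz Hre]; set (l := dtau z1) in *.
  assert (Hl0 : l <> 0) by (intros E; rewrite E in Hre; simpl in Hre; lra).
  assert (Hl : 0 < Cmod l) by (now apply Cmod_gt_0).
  assert (Hint : Cmod (z1 - z0) < r).
  { destruct Hz1 as [H|H]; auto; exfalso.
    specialize (Hbd z1 H); fold v in Hbd.
    specialize (Hmin z0); replace (z0 - z0)%C with (RtoC 0) in Hmin by ring.
    rewrite Cmod_0 in Hmin; specialize (Hmin ltac:(lra)); lra. }
  destruct (cdiff_eps_inv _ _ _ Hdz (Cmod l / 2)) as [d [Hdp K]]; [lra|].
  set (q := Cmod v / Cmod l); assert (Hq : 0 < q) by (now apply Rdiv_lt_0_compat).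
  set (s := Rmin (1 / 2) (Rmin (d / (2 * q)) ((r - Cmod (z1 - z0)) / q))).
  assert (Hs : 0 < s /\ s <= 1 / 2 /\ s <= d / (2 * q) /\ s <= (r - Cmod (z1 - z0)) / q).
  { unfold s; repeat split.
    - repeat apply Rmin_pos; try lra; apply Rdiv_lt_0_compat; lra.
    - apply Rmin_l.
    - eapply Rle_trans; [apply Rmin_r|apply Rmin_l].
    - eapply Rle_trans; [apply Rmin_r|apply Rmin_r]. }
  destruct Hs as [Hs0 [Hs1 [Hs2 Hs3]]].
  (* A damped Newton step. Its linear part shrinks the residue [v] to [(1 - s) v], and the error is
     at most [s |v| / 2], so the modulus drops strictly. *)
  set (z := (z1 - RtoC s * (v / l))%C).
  assert (Ez : Cmod (z - z1) = s * q).
  { unfold z; replace (z1 - RtoC s * (v / l) - z1)%C with (- (RtoC s * (v / l)))%C by ring.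
    rewrite Cmod_opp, Cmod_mult, Cmod_R, Cmod_div, Rabs_pos_eq by (auto; lra); reflexivity. }
  assert (Hsq : s * q <= d / 2).
  { replace (d / 2) with (d / (2 * q) * q) by (field; lra); apply Rmult_le_compat_r; lra. }
  assert (Hsr : s * q <= r - Cmod (z1 - z0)).
  { replace (r - Cmod (z1 - z0)) with ((r - Cmod (z1 - z0)) / q * q) by (field; lra); apply Rmult_le_compat_r; lra. }
  specialize (K z ltac:(lra)).
  assert (Hzr : Cmod (z - z0) <= r).
  { eapply Rle_trans; [apply (Cmod_minus_triangle _ z1)|]; lra. }
  specialize (Hmin z Hzr); fold v in Hmin.
  assert (E : (tau z - w = RtoC (1 - s) * v + (tau z - tau z1 - l * (z - z1)))%C).
  { unfold z at 3, v at 1; rewrite RtoC_minus; unfold v; field; auto. }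
  rewrite E in Hmin.
  assert (Ht := Cmod_triangle (RtoC (1 - s) * v) (tau z - tau z1 - l * (z - z1))).
  rewrite Cmod_mult, Cmod_R, Rabs_pos_eq in Ht by lra; rewrite Ez in K.
  replace (Cmod l / 2 * (s * q)) with (s * Cmod v / 2) in K by (unfold q; field; lra).
  nra.
Qed.

(** * Surjectivity onto the comb *)

Lemma branch_image_open (tau : C -> C) (z0 : C) : comb_branch tau -> 0 < Im z0 ->
  exists d, 0 < d /\ forall w, Cmod (w - tau z0) < d -> exists z, 0 < Im z /\ tau z = w.
Proof.
  intros Hb Hz0; destruct (branch_derivative tau Hb) as [dtau Hd].
  destruct (Hd z0 Hz0) as [Hdz Hre]; set (l := dtau z0) in *.
  assert (Hl : 0 < Cmod l).
  { apply Cmod_gt_0; intros E; rewrite E in Hre; simpl in Hre; lra. }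
  destruct (cdiff_eps_inv _ _ _ Hdz (Cmod l / 2)) as [d [Hdp K]]; [lra|].
  set (r := Rmin d (Im z0) / 2).
  assert (Hr : 0 < r /\ r < d /\ r < Im z0) by (now apply half_min).
  (* On the circle of radius [r] the map moves away from [tau z0] by at least [|l| r / 2]; half of
     this remains as distance from [w]. *)
  exists (Cmod l * r / 4); split; [nra|]; intros w Hw.
  apply (disc_solve tau z0 w r (Cmod l * r / 4) Hb); [lra| | |].
  - intros z Hz; apply upper_open with z0; auto; lra.
  - now rewrite Cmod_minus_sym.
  - intros z Hz; specialize (K z ltac:(lra)); rewrite Hz in K.
    assert (H1 : Cmod l * r - Cmod l / 2 * r <= Cmod (tau z - tau z0)).
    { generalize (Cmod_triangle_inv (l * (z - z0)) (- (tau z - tau z0 - l * (z - z0)))%C).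
      rewrite Cmod_mult, Hz, Cmod_opp.
      replace (l * (z - z0) - - (tau z - tau z0 - l * (z - z0)))%C with (tau z - tau z0)%C by ring; lra. }
    assert (H2 := Cmod_minus_triangle (tau z) w (tau z0)); lra.
Qed.

(** High up [tau] is a translation by [kap] with error below 1/4. On a unit disc around [w' - kap]
    the distance to [w'] is thus larger on the rim than at the centre. *)
Lemma branch_image_high (tau : C -> C) (w : C) : comb_branch tau ->
  exists s, 0 <= s /\ exists z, 0 < Im z /\ tau z = (w + Ci * RtoC s)%C.
Proof.
  intros Hb; destruct (proj2 Hb) as [kap Hk]; destruct (Hk (1 / 4)) as [Y HY]; [lra|].
  set (s := Rabs (Y + 2 - Im w + Im kap) + Rabs (2 - Im w + Im kap)).
  assert (Hs : Y + 2 - Im w + Im kap <= s /\ 2 - Im w + Im kap <= s /\ 0 <= s).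
  { unfold s; generalize (Rle_abs (Y + 2 - Im w + Im kap)) (Rle_abs (2 - Im w + Im kap))
      (Rabs_pos (Y + 2 - Im w + Im kap)) (Rabs_pos (2 - Im w + Im kap)); lra. }
  exists s; split; [lra|]; set (w' := (w + Ci * RtoC s)%C).
  set (z0 := (w' - kap)%C).
  assert (Hup : forall z, Cmod (z - z0) <= 1 -> 0 < Im z /\ Y < Im z).
  { intros z Hz; assert (K := Rle_trans _ _ _ (Im_le_Cmod _) Hz); apply Rabs_le_between in K.
    unfold z0, w' in K; autorewrite with reim in K; lra. }
  assert (E : forall z, (tau z - w' = (tau z - z - kap) + (z - z0))%C) by (intros; unfold z0; ring).
  apply (disc_solve tau z0 w' 1 (1 / 2) Hb); [lra|intros z Hz; apply Hup; auto| |].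
  - rewrite E; replace (z0 - z0)%C with (RtoC 0) by ring.
    replace (tau z0 - z0 - kap + 0)%C with (tau z0 - z0 - kap)%C by ring.
    destruct (Hup z0) as [U1 U2]; [replace (z0 - z0)%C with (RtoC 0) by ring; rewrite Cmod_0; lra|].
    specialize (HY z0 U1 U2); lra.
  - intros z Hz; rewrite E; destruct (Hup z ltac:(lra)) as [U1 U2]; specialize (HY z U1 U2).
    generalize (Cmod_triangle_inv (z - z0) (- (tau z - z - kap))%C); rewrite Cmod_opp, Hz.
    replace (z - z0 - - (tau z - z - kap))%C with (tau z - z - kap + (z - z0))%C by ring; lra.
Qed.

(** Preimages are moved into one period strip, where they are bounded because [tau z - z] is bounded
    high up. A limit point may fall on the axis, hence the closed half-plane in the conclusion. *)
Lemma branch_image_closed (tau : C -> C) (w : nat -> C) (l : C) : comb_branch tau -> boundary_cont tau ->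
  (forall e, 0 < e -> exists N, forall i, (N <= i)%nat -> Cmod (w i - l) < e) ->
  (forall i, exists z, 0 < Im z /\ tau z = w i) -> exists z, 0 <= Im z /\ tau z = l.
Proof.
  intros Hb Hc Hl Hw; assert (HP := PI2_1).
  destruct (nat_choice (C * Z) (fun i p => 0 < Im (fst p) /\ 0 <= Re (fst p) <= 2 * PI /\
    tau (fst p) = (w i + RtoC (2 * PI * IZR (snd p)))%C)) as [u Hu].
  { intros i; destruct (Hw i) as [z [Hz Ez]]; destruct (reduce_mod_2PI 0 (Re z)) as [m Hm].
    exists ((z + RtoC (2 * PI * IZR (- m)))%C, (- m)%Z); cbn [fst snd]; split; [reim; lra|split].
    - reim; rewrite opp_IZR; lra.
    - rewrite boundary_period by (auto; lra); now rewrite Ez. }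
  destruct (Hl 1) as [N0 HN0]; [lra|].
  destruct (proj2 Hb) as [kap Hk]; destruct (Hk 1) as [Y HY]; [lra|].
  set (B := Rabs Y + Rabs (Im l + 2 - Im kap)).
  assert (HB : forall i, (N0 <= i)%nat -> Im (fst (u i)) <= B).
  { intros i Hi; destruct (Hu i) as [U1 [U2 U3]]; apply Rnot_lt_le; intros Hlt.
    assert (Hb1 := Rle_abs Y); assert (Hb2 := Rle_abs (Im l + 2 - Im kap)).
    assert (Hb3 := Rabs_pos Y); assert (Hb4 := Rabs_pos (Im l + 2 - Im kap)).
    specialize (HY (fst (u i)) U1 ltac:(unfold B in Hlt; lra)).
    assert (Q1 := Rle_lt_trans _ _ _ (Im_le_Cmod _) HY); apply Rabs_def2 in Q1; rewrite U3 in Q1.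
    assert (Q2 := Rle_lt_trans _ _ _ (Im_le_Cmod _) (HN0 i Hi)); apply Rabs_def2 in Q2.
    autorewrite with reim in Q1, Q2; unfold B in Hlt; lra. }
  destruct (C_bounded_subsequence (fun i => fst (u (N0 + i)%nat)) (2 * PI + B)) as [phi [z [Hphi Hz]]].
  { intros i; destruct (Hu (N0 + i)%nat) as [U1 [U2 U3]]; specialize (HB (N0 + i)%nat ltac:(lia)).
    eapply Rle_trans; [apply Cmod_le_ReIm|]; rewrite !Rabs_pos_eq; lra. }
  set (p := fun i => u (N0 + phi i)%nat).
  assert (Hz0 : 0 <= Im z).
  { apply Rnot_lt_le; intros Hlt; destruct (Hz (- Im z)) as [N HN]; [lra|]; specialize (HN N ltac:(lia)).
    assert (Q := Rle_lt_trans _ _ _ (Im_le_Cmod _) HN); apply Rabs_def2 in Q.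
    destruct (Hu (N0 + phi N)%nat) as [U1 _]; autorewrite with reim in Q; lra. }
  assert (Ht : forall e, 0 < e -> exists N, forall i, (N <= i)%nat -> Cmod (tau (fst (p i)) - tau z) < e).
  { intros e He; destruct (boundary_cont_closed tau Hb Hc z Hz0 e He) as [d [Hd H]].
    destruct (Hz d Hd) as [N HN]; exists N; intros i Hi; apply H; [left; apply Hu|]; apply HN; auto. }
  assert (Hwp : forall e, 0 < e -> exists N, forall i, (N <= i)%nat -> Cmod (w (N0 + phi i)%nat - l) < e).
  { intros e He; destruct (Hl e He) as [N HN].
    destruct (Hphi (fun k => (N <= k)%nat)) as [M HM]; [exists N; auto|].
    exists M; intros i Hi; apply HN; specialize (HM i Hi); simpl in HM; lia. }
  assert (Hsum : forall e, 0 < e -> exists N, forall i, (N <= i)%nat ->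
    Cmod (RtoC (2 * PI * IZR (snd (p i))) - (tau z - l)) < e).
  { intros e He; destruct (Ht (e / 2)) as [N1 H1]; [lra|]; destruct (Hwp (e / 2)) as [N2 H2]; [lra|].
    exists (N1 + N2)%nat; intros i Hi; specialize (H1 i ltac:(lia)); specialize (H2 i ltac:(lia)).
    destruct (Hu (N0 + phi i)%nat) as [_ [_ U3]]; fold (p i) in U3.
    replace (RtoC (2 * PI * IZR (snd (p i)))) with (tau (fst (p i)) - w (N0 + phi i)%nat)%C by (rewrite U3; ring).
    replace (tau (fst (p i)) - w (N0 + phi i)%nat - (tau z - l))%C
      with ((tau (fst (p i)) - tau z) + - (w (N0 + phi i)%nat - l))%C by ring.
    eapply Rle_lt_trans; [apply Cmod_triangle|]; rewrite Cmod_opp; lra. }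
  (* The translations are convergent integer multiples of [2 PI], so they are eventually constant
     and can be undone. *)
  destruct (Hsum (1 / 2)) as [N HN]; [lra|].
  set (m := snd (p N)).
  assert (Hm : forall i, (N <= i)%nat -> snd (p i) = m).
  { intros i Hi; assert (K1 := HN i Hi); assert (K2 := HN N ltac:(lia)); fold m in K2.
    apply (Rle_lt_trans _ _ _ (re_le_Cmod _)) in K1; apply (Rle_lt_trans _ _ _ (re_le_Cmod _)) in K2.
    apply Rabs_def2 in K1; apply Rabs_def2 in K2; autorewrite with reim in K1, K2.
    assert ((snd (p i) - m)%Z = 0%Z); [|lia].
    apply (IZR_small 0); [rewrite minus_IZR; apply Rabs_def1; lra|rewrite Rabs_R0; lra]. }
  assert (E : RtoC (2 * PI * IZR m) = (tau z - l)%C).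
  { apply C_eq_eps; intros e He; destruct (Hsum e He) as [M HM].
    specialize (HM (N + M)%nat ltac:(lia)); rewrite Hm in HM by lia; auto. }
  exists (z + RtoC (2 * PI * IZR (- m)))%C; split; [reim; lra|].
  rewrite boundary_period by auto; rewrite opp_IZR.
  replace (2 * PI * - IZR m) with (- (2 * PI * IZR m)) by ring; rewrite RtoC_opp, E; ring.
Qed.

(** The vertical ray above [w] stays in the comb and meets the image high up. Its lowest point in
    the closure of the image has an interior preimage, since boundary values avoid the comb;
    openness then forces that point to be [w]. *)
Lemma branch_onto_comb (tau : C -> C) (slits : list (R * R)) (w : C) :
  comb_branch tau -> boundary_cont tau -> (forall t, ~ comb slits (tau (RtoC t))) ->
  comb slits w -> exists z, 0 < Im z /\ tau z = w.
Proof.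
  intros Hb Hc Hbd Hw.
  (* [v] is minus the height above [w], so that the supremum corresponds to the lowest point. *)
  set (S0 := fun v => exists z, v <= 0 /\ 0 < Im z /\ tau z = (w + Ci * RtoC (- v))%C).
  destruct (completeness S0) as [v [V1 V2]].
  { exists 0; intros v [z [Hv _]]; auto. }
  { destruct (branch_image_high tau w Hb) as [s [Hs [z [Hz Ez]]]].
    exists (- s), z; rewrite Ropp_involutive; repeat split; auto; lra. }
  assert (Hv0 : v <= 0) by (apply V2; intros u [z [Hu _]]; auto).
  destruct (nat_choice R (fun i u => S0 u /\ v - / (INR i + 1) < u <= v)) as [u Hu].
  { intros i; apply NNPP; intros Hn.
    assert (Hi : 0 < / (INR i + 1)) by apply inv_INR_pos.
    assert (v <= v - / (INR i + 1)); [|lra].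
    apply V2; intros u Hu; apply Rnot_lt_le; intros Hlt; apply Hn; exists u; split; auto. }
  destruct (branch_image_closed tau (fun i => w + Ci * RtoC (- u i))%C (w + Ci * RtoC (- v))%C) as [z [Hz Ez]]; auto.
  { intros e He; assert (Hlim := is_lim_seq_inv_INR); apply is_lim_seq_spec in Hlim.
    destruct (Hlim (mkposreal e He)) as [N HN]; exists N; intros i Hi; specialize (HN i Hi); simpl in HN.
    rewrite Rminus_0_r in HN; apply Rabs_def2 in HN; destruct (Hu i) as [_ K].
    replace (w + Ci * RtoC (- u i) - (w + Ci * RtoC (- v)))%C with (Ci * RtoC (v - u i))%C
      by (rewrite RtoC_minus, !RtoC_opp; ring).
    rewrite Cmod_mult, Cmod_Ci, Cmod_R, Rabs_pos_eq; lra. }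
  { intros i; destruct (Hu i) as [[z [_ Hz]] _]; exists z; auto. }
  assert (Hzp : 0 < Im z).
  { destruct Hz as [Hz|Hz]; auto; exfalso.
    apply (Hbd (Re z)); rewrite <- Im_eq0_RtoC, Ez by auto; apply comb_up; auto; lra. }
  destruct Hv0 as [Hv0|Hv0].
  - exfalso; destruct (branch_image_open tau z Hb Hzp) as [d [Hd H]].
    set (e := Rmin (d / 2) (- v)).
    assert (He : 0 < e /\ e < d /\ e <= - v).
    { unfold e; repeat split; [apply Rmin_pos; lra| |apply Rmin_r].
      eapply Rle_lt_trans; [apply Rmin_l|lra]. }
    destruct (H (w + Ci * RtoC (- (v + e)))%C) as [z' [Hz' Ez']].
    { rewrite Ez; replace (w + Ci * RtoC (- (v + e)) - (w + Ci * RtoC (- v)))%C with (Ci * RtoC (- e))%C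
        by (rewrite !RtoC_opp, RtoC_plus; ring).
      rewrite Cmod_mult, Cmod_Ci, Cmod_R, Rabs_Ropp, Rabs_pos_eq; lra. }
    assert (v + e <= v); [|lra].
    apply V1; exists z'; repeat split; auto; lra.
  - exists z; split; auto; rewrite Ez, Hv0, Ropp_0; ring.
Qed.

Lemma comb_map_exists : exists (slits : list (R * R)) (tau : C -> C),
  n_regular_comb n slits /\ conformal_onto tau (comb slits) /\ cont_closed_half tau /\
  (forall z, 0 < Im z -> ccos (RtoC (INR n / 2) * tau z) = Fc z) /\
  (forall t, y 0%nat <= t < y n -> Rabs (Fr t) <= 1 -> Im (tau (RtoC t)) = 0) /\
  (forall k t, (k < n)%nat -> y k <= t <= y (S k) -> Rabs (Fr t) = 1 ->
     tau (RtoC t) = RtoC (2 * PI * INR k / INR n)).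
Proof.
  destruct normalized_branch_exists as [tau Hnorm]; destruct gap_heights as [h Hh].
  assert (Hn := Hnorm); destruct Hn as [Hb [Hc H0]]; assert (HnR := INR_n_pos).
  assert (Hval : forall t, bIm tau t = 0 -> Im (tau (RtoC t)) = 0).
  { intros t E; unfold bIm in E; apply Rmult_integral in E; destruct E; [lra|auto]. }
  exists (slit_list h), tau; split; [apply slit_list_regular|split; [|split; [|split; [|split]]]].
  - split; [|split; [|split]].
    + intros z Hz; destruct (proj1 (proj1 Hb z Hz)) as [l Hl]; exists l; now apply cdiff_is_derive.
    + intros z1 z2 H1 H2; now apply branch_injective.
    + intros z Hz; now apply branch_in_comb.
    + intros w Hw; destruct (branch_onto_comb tau (slit_list h) w Hb Hc) as [z [Hz Ez]]; auto.
      * intros t; now apply boundary_not_in_comb.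
      * exists z; auto.
  - intros z Hz; apply filterlim_locally; intros eps.
    destruct (boundary_cont_closed tau Hb Hc z Hz eps (cond_pos eps)) as [d [Hd H]].
    (* Balls of [locally] are squares in the two coordinates; half the radius keeps them inside the
       disc. *)
    assert (Hd2 : 0 < d / 2) by lra.
    exists (mkposreal _ Hd2); intros w Hw Hiw.
    apply C_NormedModule_mixin_compat1, (H w Hiw).
    destruct Hw as [B1 B2]; eapply Rle_lt_trans; [apply Cmod_le_ReIm|].
    change (Rabs (Re w - Re z) < d / 2) in B1; change (Rabs (Im w - Im z) < d / 2) in B2.
    reim; lra.
  - intros z Hz; apply Hb; auto.
  - intros t Ht HF; destruct (locate_gap t Ht) as [k [Hk Hk']].
    apply Hval, (gap_values tau k t Hnorm Hk Hk'); auto.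
  - intros k t Hk Ht HF; destruct (gap_values tau k t Hnorm Hk Ht) as [G1 G2].
    destruct (G1 ltac:(lra)) as [E1 _]; specialize (G2 ltac:(lra)).
    apply C_ext; reim; [|auto].
    unfold bRe in E1; apply Rmult_eq_reg_l with (INR n / 2); [|lra]; rewrite E1; field; lra.
Qed.

End CombMap.

(** * Extremality *)

Lemma Cmod_ehalf_real (n : nat) (t : R) : Cmod (ehalf n (RtoC t)) = 1.
Proof. unfold ehalf; rewrite <- Cmult_assoc, <- RtoC_mult; apply Cmod_cexp_real. Qed.

Lemma Cmod_peval_expi (n : nat) (a : nat -> C) (f : C -> C) (t : R) :
  (forall z, f z * ehalf n z = peval n a (cexp (Ci * z)))%C ->
  Cmod (peval n a (expi t)) = Cmod (f (RtoC t)).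
Proof. intros H; unfold expi; rewrite <- H, Cmod_mult, Cmod_ehalf_real; ring. Qed.

Lemma Cmod_pderiv_expi (n : nat) (a : nat -> C) (f : C -> C) (t : R) (l : C) : (1 <= n)%nat ->
  (forall z, f z * ehalf n z = peval n a (cexp (Ci * z)))%C ->
  f (RtoC t) = 0 -> cdiff f (RtoC t) l -> Cmod (pderiv n a (expi t)) = Cmod l.
Proof.
  intros Hn H H0 Hl.
  assert (D1 : cdiff (fun z => peval n a (cexp (Ci * z))) (RtoC t)
    (pderiv n a (expi t) * (cexp (Ci * RtoC t) * (Ci * 1)))%C).
  { apply (cdiff_comp (peval n a) (fun z => cexp (Ci * z))); [now apply cdiff_peval|].
    apply (cdiff_comp cexp (fun z => Ci * z)%C); [apply cdiff_cexp|apply cdiff_scal, cdiff_id]. }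
  assert (He : cdiff (ehalf n) (RtoC t) (ehalf n (RtoC t) * (Ci * RtoC (INR n / 2)))%C).
  { unfold ehalf; eapply cdiff_eq.
    - apply (cdiff_comp cexp (fun z => Ci * z * RtoC (INR n / 2))%C); [apply cdiff_cexp|].
      apply cdiff_mult; [apply cdiff_scal, cdiff_id|apply cdiff_const].
    - cbv beta; ring. }
  assert (D2 := cdiff_mult _ _ _ _ _ Hl He).
  apply (cdiff_ext _ (fun z => peval n a (cexp (Ci * z)))) in D2; [|exact H].
  assert (E := cdiff_unique _ _ _ _ D1 D2); rewrite H0 in E.
  assert (E' := f_equal Cmod E).
  replace (l * ehalf n (RtoC t) + 0 * (ehalf n (RtoC t) * (Ci * RtoC (INR n / 2))))%C
    with (l * ehalf n (RtoC t))%C in E' by ring.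
  rewrite !Cmod_mult, Cmod_ehalf_real, Cmod_cexp_real, Cmod_Ci, Cmod_1 in E'; lra.
Qed.

(** A better competitor, rescaled to the derivative of [f] at [x], has modulus below 1 at the [n]
    alternation points. The difference then has [n - 1] sign changes and a double zero at [x], one
    zero more than its degree allows. *)
Lemma alternation_extremal (n : nat) (x : R) (f g : C -> C) (h : R -> R) (t : nat -> R) (l l' : C) :
  (1 <= n)%nat -> Trig n f -> Trig n g -> (forall t, f (RtoC t) = RtoC (h t)) ->
  (forall k, (k < n)%nat -> x < t k < x + 2 * PI /\ h (t k) = (-1) ^ k /\ Cmod (g (RtoC (t k))) <= 1) ->
  (forall k, (S k < n)%nat -> t k < t (S k)) ->
  f (RtoC x) = 0 -> g (RtoC x) = 0 -> cdiff f (RtoC x) l -> cdiff g (RtoC x) l' -> Cmod l' <= Cmod l.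
Proof.
  intros Hn Hf Hg Hfr Ht Hinc Hf0 Hg0 Hl Hl'; apply Rnot_lt_le; intros Hlt.
  destruct (Trig_diff _ _ Hf) as [df [_ Hdf]].
  assert (El : l = df (RtoC x)) by (eapply cdiff_unique; eauto).
  assert (Hl0 := Cmod_ge_0 l).
  assert (Hl'0 : l' <> 0) by (apply Cmod_gt_0; lra).
  set (lam := (l / l')%C).
  assert (Hlam : Cmod lam < 1).
  { unfold lam; rewrite Cmod_div by auto; apply Rmult_lt_reg_r with (Cmod l'); [lra|].
    unfold Rdiv; rewrite Rmult_assoc, Rinv_l by lra; lra. }
  set (q := fun z => (lam * g z)%C).
  assert (Hq : Trig n q) by (now apply Trig_scal).
  destruct (Trig_star n q Hq) as [qs [Hqs Eqs]].
  (* On the real line this is [f - Re q]; writing the real part through [qs] keeps it a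
     trigonometric polynomial of index [n]. *)
  set (D := fun z => (f z + - RtoC (/ 2) * (q z + qs z))%C).
  assert (HD : Trig n D) by (apply Trig_plus; auto; apply Trig_scal, Trig_plus; auto).
  set (d := fun s => h s - Re (q (RtoC s))).
  assert (HDr : forall s, D (RtoC s) = RtoC (d s)).
  { intros s; unfold D, d; rewrite Hfr, Eqs; apply C_ext; reim; rewrite ?re_conj, ?im_conj; lra. }
  destruct (Trig_diff _ _ HD) as [dD [_ HdD]].
  assert (Hd0 : d x = 0).
  { unfold d, q; rewrite Hg0, Cmult_0_r, Re_R.
    assert (h x = 0) by (apply RtoC_inj; now rewrite <- Hfr); lra. }
  destruct (real_derivative D dD d HDr HdD x) as [K1 K2].
  destruct (real_derivative f df h Hfr Hdf x) as [K3 K4].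
  assert (HD0 : dD (RtoC x) = 0).
  { rewrite K2; f_equal.
    assert (K5 := cdiff_segment g lam 0 1 l' x).
    replace (0 + RtoC x * 1)%C with (RtoC x) in K5 by ring; specialize (K5 Hl').
    assert (K6 : is_derive d x (Re (df (RtoC x)) - Re (lam * (l' * 1))%C)).
    { apply (is_derive_minus h (fun s => Re (q (RtoC s)))); [exact K3|].
      eapply is_derive_ext; [|apply K5]; intros s; cbv beta.
      unfold q; replace (0 + RtoC s * 1)%C with (RtoC s) by ring; reflexivity. }
    apply is_derive_unique in K1; apply is_derive_unique in K6; rewrite K1 in K6; rewrite K6, <- El.
    replace (lam * (l' * 1))%C with l by (unfold lam; field; auto); ring. }
  destruct n as [|m]; [lia|].
  destruct (Trig_factor m D x HD) as [D1 [HD1 ED1]]; [now rewrite HDr, Hd0|].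
  assert (HD1x : D1 (RtoC x) = 0).
  { destruct (Trig_diff _ _ HD1) as [dD1 [_ HdD1]].
    assert (K := cdiff_mult _ _ _ _ _ (cdiff_hsin_self x) (HdD1 (RtoC x))).
    apply (cdiff_ext _ D) in K; [|intros; now rewrite ED1].
    assert (E := cdiff_unique _ _ _ _ (HdD (RtoC x)) K); rewrite HD0, hsin_self in E.
    assert (E' : (RtoC (/ 2) * D1 (RtoC x) = 0)%C) by (rewrite E; ring).
    apply Cmult_eq0 in E'; destruct E' as [E'|E']; auto.
    apply RtoC_inj in E'; lra. }
  assert (Hsig : forall k, (k < S m)%nat -> 0 < (-1) ^ k * d (t k)).
  { intros k Hk; destruct (Ht k Hk) as [_ [E G]]; unfold d; rewrite E.
    assert (Hre : Rabs (Re (q (RtoC (t k)))) < 1).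
    { eapply Rle_lt_trans; [apply re_le_Cmod|]; unfold q; rewrite Cmod_mult.
      generalize (Cmod_ge_0 lam) (Cmod_ge_0 (g (RtoC (t k)))); nra. }
    apply Rabs_def2 in Hre.
    assert (E1 : Rabs ((-1) ^ k) = 1) by apply pow_1_abs.
    revert E1; generalize ((-1) ^ k); intros p; unfold Rabs; destruct (Rcase_abs p); intros; nra. }
  assert (Hdc : continuity d).
  { intros s; apply ccont_continuity with D; auto; eapply cdiff_ccont; apply HdD. }
  destruct (nat_choice R (fun k s => (k < m)%nat -> t k < s < t (S k) /\ d s = 0)) as [s Hs].
  { intros k; destruct (Nat.lt_ge_cases k m) as [Hk|Hk]; [|exists 0; lia].
    destruct (IVT_sign d (t k) (t (S k))) as [s Hs]; [auto|apply Hinc; lia| |exists s; auto].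
    assert (S1 := Hsig k ltac:(lia)); assert (S2 := Hsig (S k) ltac:(lia)); simpl in S2.
    assert (E1 : Rabs ((-1) ^ k) = 1) by apply pow_1_abs.
    revert E1 S1 S2; generalize ((-1) ^ k); intros p; unfold Rabs; destruct (Rcase_abs p); intros; nra. }
  assert (Htm : forall j k, (j <= k)%nat -> (k < S m)%nat -> t j <= t k).
  { intros j k Hjk; induction Hjk; intros Hk; [lra|].
    specialize (IHHjk ltac:(lia)); specialize (Hinc m0 ltac:(lia)); lra. }
  assert (Hsx : forall k, (k < m)%nat -> x < s k < x + 2 * PI).
  { intros k Hk; destruct (Hs k Hk) as [Q _].
    generalize (proj1 (Ht k ltac:(lia))) (proj1 (Ht (S k) ltac:(lia))); lra. }
  destruct (Trig_divide_simple m 0 D1 s) as [c [Hc Ec]].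
  - now rewrite Nat.add_0_r.
  - intros k Hk; assert (E := HDr (s k)); rewrite ED1, (proj2 (Hs k Hk)) in E.
    apply Cmult_eq0 in E; destruct E as [E|E]; auto; exfalso; revert E.
    rewrite hsin_real; apply RtoC_neq0, sin_half_neq0; [generalize (Hsx k Hk); lra|].
    generalize (Hsx k Hk); intros; rewrite Rabs_pos_eq; lra.
  - intros j k Hjk; rewrite hsin_real; apply RtoC_neq0.
    assert (s j < s k).
    { destruct (Hs j ltac:(lia)) as [Q1 _], (Hs k ltac:(lia)) as [Q2 _].
      generalize (Htm (S j) k ltac:(lia) ltac:(lia)); lra. }
    generalize (Hsx j ltac:(lia)) (Hsx k ltac:(lia)); intros.
    apply sin_half_neq0; [lra|rewrite Rabs_pos_eq; lra].
  - apply Trig_0 in Hc; destruct Hc as [c0 Hc0].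
    (* The second zero at [x] has to come from the constant cofactor; then [D] vanishes identically,
       against its sign at [t 0]. *)
    assert (E := HD1x); rewrite Ec, Hc0 in E; apply Cmult_eq0 in E; destruct E as [E|E].
    + revert E; apply sprod_neq0; intros k Hk; rewrite hsin_real; apply RtoC_neq0.
      generalize (Hsx k Hk); intros; apply sin_half_neq0; [lra|apply Rabs_def1; lra].
    + assert (K := HDr (t 0%nat)); rewrite ED1, Ec, Hc0, E in K.
      assert (d (t 0%nat) = 0) by (apply RtoC_inj; rewrite <- K; ring).
      generalize (Hsig 0%nat ltac:(lia)); rewrite H; lra.
Qed.

Theorem theorem3p3 (E : C -> Prop) (x : R) (n : nat) :
  finite_arc_union E -> ~ E (expi x) -> (1 <= n)%nat ->
  exists (slits : list (R * R)) (tau : C -> C) (a : nat -> C),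
    n_regular_comb n slits /\
    conformal_onto tau (comb slits) /\
    cont_closed_half tau /\
    (forall z, Cplus_half z ->
       peval n a (cexp (Cmult Ci z)) =
       Cmult (cexp (Cmult (Cmult Ci z) (RtoC (INR n / 2))))
             (ccos (Cmult (RtoC (INR n / 2)) (tau z)))) /\
    extremal E n (expi x) a /\
    A_n E n (expi x) = Finite (Cmod (pderiv n a (expi x))) /\
    (forall w, E w -> exists t : R, Im (tau (RtoC t)) = 0 /\ w = expi t) /\
    (forall k : nat, (k < n)%nat ->
       exists t : R, tau (RtoC t) = RtoC (2 * PI * INR k / INR n) /\ E (expi t)).
Proof.
  intros HE Hx Hn.
  destruct (extremal_data E x n HE Hx Hn) as [y [t [A [y0 [yn [yinc [Ht Hbd]]]]]]].
  (* The sign is constant on a gap, so it can be read off at the alternation point [t k], where the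
     value is [(-1)^k]. *)
  assert (Hsign : forall k s, (k < n)%nat -> y k < s < y (S k) -> 0 < (-1) ^ k * Fr n y A s).
  { intros k s Hk Hs; unfold Fr; destruct (Ht k Hk) as [Htk [_ E1]].
    assert (S1 := rprod_sign y n k s yinc yn Hk Hs).
    assert (S2 := rprod_sign y n k (t k) yinc yn Hk Htk).
    rewrite <- E1.
    assert (HA : 0 < A * A).
    { apply Rsqr_pos_lt; intros EA; rewrite EA, Rmult_0_l in E1.
      assert (K := pow_1_abs k); rewrite <- E1, Rabs_R0 in K; lra. }
    set (p := (-1) ^ (n - S k)) in *.
    assert (0 < rprod y n (t k) * rprod y n s).
    { assert (0 < (p * rprod y n s) * (p * rprod y n (t k))) by (now apply Rmult_lt_0_compat).
      assert (K := pow_1_abs (n - S k)); fold p in K.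
      assert (p * p = 1) by (revert K; unfold Rabs; destruct (Rcase_abs p); intros; nra).
      replace (p * rprod y n s * (p * rprod y n (t k))) with (p * p * (rprod y n (t k) * rprod y n s)) in H by ring.
      rewrite H0, Rmult_1_l in H; auto. }
    replace (A * rprod y n (t k) * (A * rprod y n s)) with (A * A * (rprod y n (t k) * rprod y n s)) by ring.
    now apply Rmult_lt_0_compat. }
  assert (Habs : forall k, (k < n)%nat -> Rabs (Fr n y A (t k)) = 1).
  { intros k Hk; destruct (Ht k Hk) as [_ [_ E1]]; unfold Fr; rewrite E1; apply pow_1_abs. }
  destruct (comb_map_exists n y A Hn yn yinc Hsign) as [slits [tau [C1 [C2 [C3 [C4 [C5 C6]]]]]]].
  { intros k Hk; exists (t k); split; [apply Ht; auto|rewrite Habs by auto; lra]. }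
  destruct (Trig_Fc n y A) as [p [[a Ha] Ep]].
  assert (Ea : forall z, (Fc n y A z * ehalf n z)%C = peval n a (cexp (Ci * z))).
  { intros z; now rewrite Ep, Ha. }
  assert (F0 : Fc n y A (RtoC x) = 0).
  { rewrite Fc_real, <- y0, Fr_zero by (auto; lia); reflexivity. }
  destruct (Trig_diff _ _ (Trig_Fc n y A)) as [dF [_ HdF]].
  assert (Hext : extremal E n (expi x) a).
  { split; [split|].
    - intros w Hw; destruct (arc_union_param E x HE Hx w Hw) as [s [Hs ->]].
      rewrite (Cmod_peval_expi n a (Fc n y A)), Fc_real, Cmod_R by auto; now apply Hbd.
    - unfold expi; rewrite <- Ea, F0; ring.
    - intros b [Hb1 Hb2].
      (* Division by a factor of modulus 1 on the axis: the bounds on the arcs and the modulus of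
         the derivative at the zero [x] carry over to [g]. *)
      set (g := fun z => (peval n b (cexp (Ci * z)) / ehalf n z)%C).
      assert (Eg : forall z, (g z * ehalf n z)%C = peval n b (cexp (Ci * z))).
      { intros z; unfold g; field; apply ehalf_neq0. }
      assert (HgT : Trig n g) by (exists (peval n b); split; [exists b; auto|auto]).
      destruct (Trig_diff _ _ HgT) as [dg [_ Hdg]].
      assert (g0 : g (RtoC x) = 0).
      { unfold g; change (cexp (Ci * RtoC x)) with (expi x); rewrite Hb2; field; apply ehalf_neq0. }
      rewrite (Cmod_pderiv_expi n b g x (dg (RtoC x))), (Cmod_pderiv_expi n a (Fc n y A) x (dF (RtoC x))) by auto.
      assert (Hiy := nondecreasing_upto n y yinc).
      apply (alternation_extremal n x (Fc n y A) g (Fr n y A) t); auto.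
      + apply Trig_Fc.
      + intros s; apply Fc_real.
      + intros k Hk; destruct (Ht k Hk) as [T1 [T2 T3]]; split; [|split].
        * assert (y 0%nat <= y k) by (apply Hiy; lia).
          assert (y (S k) <= y n) by (apply Hiy; lia).
          lra.
        * exact T3.
        * rewrite <- (Cmod_peval_expi n b g) by auto; auto.
      + intros k Hk; destruct (Ht k ltac:(lia)) as [T1 _], (Ht (S k) Hk) as [T2 _]; lra. }
  exists slits, tau, a.
  split; [auto|split; [auto|split; [auto|split; [|split; [auto|split; [|split]]]]]].
  - intros z Hz; rewrite C4 by auto; rewrite <- Ea; unfold ehalf; ring.
  - apply is_lub_Rbar_unique; split.
    + intros r [b [Hb ->]]; apply Hext; auto.
    + intros r Hr; apply Hr; exists a; split; auto; apply Hext.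
  - intros w Hw; destruct (arc_union_param E x HE Hx w Hw) as [s [Hs ->]].
    exists s; split; auto; apply C5; [rewrite yn, y0; lra|now apply Hbd].
  - intros k Hk; destruct (Ht k Hk) as [T1 [T2 _]]; exists (t k); split; auto.
    apply C6; auto; lra.
Qed.
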